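(* Let $d\in\{1,2,3\}$, let $\mathcal{D}\subset\mathbb{R}^d$ be bounded and let $\nu>0$, $\phi>0$, $\sigma_0^2>0$, $\sigma_1^2>0$. Let $\mathcal{D}_1\subset\mathcal{D}_2\subset\cdots\subset\mathcal{D}$, where $\mathcal{D}_n=\{\mathbf{s}_1,\dots,\mathbf{s}_n\}$ consists of $n$ distinct observation locations, and let $\mathbf{s}_0\in\mathcal{D}$ belong to no $\mathcal{D}_n$ and be a limit point of $\bigcup_n\mathcal{D}_n$. Let $\mathcal{P}_0$ be the Gaussian probability measure on $\mathcal{D}$ under the Matérn covariance $\mathcal{M}(h;\nu,\phi,\sigma_0^2)$ and $\mathcal{P}_1$ the Gaussian probability measure on $\mathcal{D}$ under the CH covariance $C(h;\nu,\alpha,\beta,\sigma_1^2)$. Let $\hat Z_n(\alpha,\beta)$ be the kriging predictor of $Z(\mathbf{s}_0)$ under $C(h;\nu,\alpha,\beta,\sigma_1^2)$ and $\hat Z_n(\phi)$ the kriging predictor of $Z(\mathbf{s}_0)$ under $\mathcal{M}(h;\nu,\phi,\sigma_0^2)$. If $$\sigma_1^2(\beta^2/2)^{-\nu}\,\Gamma(\nu+\alpha)/\Gamma(\alpha)=\sigma_0^2\,\phi^{-2\nu},$$ then, as $n\to\infty$, $$\frac{\mathrm{Var}_{\nu,\alpha,\beta,\sigma_1^2}\{\hat Z_n(\alpha,\beta)-Z(\mathbf{s}_0)\}}{\mathrm{Var}_{\nu,\phi,\sigma_0^2}\{\hat Z_n(\phi)-Z(\mathbf{s}_0)\}}\to1,$$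 for any fixed $\alpha>0$ and $\beta>0$.
   Context: The CH covariance function with parameters $\nu,\alpha,\beta,\sigma^2>0$ is $$C(h;\nu,\alpha,\beta,\sigma^2)=\frac{\sigma^2\beta^{2\alpha}\Gamma(\nu+\alpha)}{\Gamma(\nu)\Gamma(\alpha)}\int_0^\infty x^{\nu-1}(x+\beta^2)^{-(\nu+\alpha)}\exp(-\nu h^2/x)\,dx,\quad h\ge0.$$ The Matérn covariance function is $\mathcal{M}(h;\nu,\phi,\sigma^2)=\sigma^2\frac{2^{1-\nu}}{\Gamma(\nu)}\left(\frac{\sqrt{2\nu}}{\phi}h\right)^{\nu}\mathcal{K}_\nu\left(\frac{\sqrt{2\nu}}{\phi}h\right)$ for $h>0$, with $\mathcal{M}(0)=\sigma^2$, where $\mathcal{K}_\nu$ is the modified Bessel function of the second kind. The Gaussian measure under a covariance function $K$ is the law of a mean-zero Gaussian process $Z$ with $\mathrm{cov}(Z(\mathbf{s}),Z(\mathbf{u}))=K(|\mathbf{s}-\mathbf{u}|)$ (Euclidean norm). The kriging predictor under $K$ based on $\mathbf{Z}_n=(Z(\mathbf{s}_1),\dots,Z(\mathbf{s}_n))^\top$ is $\mathbf{k}_n^\top\mathbf{K}_n^{-1}\mathbf{Z}_n$ with $\mathbf{k}_n=[K(|\mathbf{s}_0-\mathbf{s}_i|)]_{i\le n}$ and $\mathbf{K}_n=[K(|\mathbf{s}_i-\mathbf{s}_j|)]_{i,j\le n}$. $\mathrm{Var}_{\nu,\alpha,\beta,\sigma_1^2}$ and $\mathrm{Var}_{\nu,\phi,\sigma_0^2}$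 denote variances computed when $Z$ has the CH covariance $C(\cdot;\nu,\alpha,\beta,\sigma_1^2)$, respectively the Matérn covariance $\mathcal{M}(\cdot;\nu,\phi,\sigma_0^2)$. *)

(* Defs.v *)
From HB Require Import structures.
From mathcomp Require Import all_boot all_order all_algebra.
From mathcomp Require Import all_classical all_reals all_analysis.

Set Implicit Arguments.
Unset Strict Implicit.
Unset Printing Implicit Defensive.

Import Order.TTheory GRing.Theory Num.Theory.
Import numFieldNormedType.Exports.

Local Open Scope classical_set_scope.
Local Open Scope ring_scope.

(* Euler's Gamma function on the positive half-line (meaningful for 0 < a). *)
Definition Gamma (R : realType) (a : R) : R :=
  \int[@lebesgue_measure R]_(x in `]0, +oo[) (x `^ (a - 1) * expR (- x)).

Definition cosh (R : realType) (t : R) : R := (expR t + expR (- t)) / 2.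

(* Modified Bessel function of the second kind of real order nu, at 0 < x,
   by its integral representation
     K_nu(x) = \int_0^oo exp(- x cosh t) cosh(nu t) dt,
   valid for every real order, integers included. *)
Definition besselK (R : realType) (nu x : R) : R :=
  \int[@lebesgue_measure R]_(t in `]0, +oo[)
    (expR (- (x * cosh t)) * cosh (nu * t)).

(* In both covariance functions s2 stands for the variance sigma^2 itself. *)
Definition CH_cov (R : realType) (nu alpha beta s2 h : R) : R :=
  s2 * beta `^ (2 * alpha) * Gamma (nu + alpha) / (Gamma nu * Gamma alpha) *
  \int[@lebesgue_measure R]_(x in `]0, +oo[)
    (x `^ (nu - 1) * (x + beta ^+ 2) `^ (- (nu + alpha)) *
     expR (- (nu * h ^+ 2 / x))).

Definition matern_cov (R : realType) (nu phi s2 h : R) : R :=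
  if h == 0 then s2 else
    let y := Num.sqrt (2 * nu) / phi * h in
    s2 * (2 `^ (1 - nu) / Gamma nu) * y `^ nu * besselK nu y.

(* The library norm on row vectors is the sup norm, hence this one. *)
Definition enorm (R : realType) (d : nat) (x : 'rV[R]_d) : R :=
  Num.sqrt (\sum_(i < d) x 0 i ^+ 2).

(* X is N(m, v)-distributed under P, for 0 <= v. The case v = 0 is split off
   because normal_prob m 0 is not the Dirac mass at m. *)
Definition normally_distributed (R : realType) (disp : measure_display)
    (T : measurableType disp) (P : probability T R) (X : T -> R) (m v : R) :
    Prop :=
  forall A : set R, measurable A ->
    P (X @^-1` A) =
      if v == 0 then \d_m A else normal_prob m (Num.sqrt v) A.

(* The family (Z u), u in D, is a Gaussian process under P: all its finite
   linear combinations are (possibly degenerate) normal. *)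
Definition gaussian_process (R : realType) (d : nat) (D : set 'rV[R]_d)
    (disp : measure_display) (T : measurableType disp) (P : probability T R)
    (Z : 'rV[R]_d -> {mfun T >-> R}) : Prop :=
  forall (n : nat) (u : 'I_n -> 'rV[R]_d) (a : 'I_n -> R),
    (forall i, D (u i)) ->
    exists m v : R, 0 <= v /\
      normally_distributed P (fun w => \sum_(i < n) a i * Z (u i) w) m v.

(* The law of Z on D under P is the Gaussian measure of covariance function K:
   Z is a mean-zero Gaussian process on D with cov(Z u, Z v) = K(|u - v|).
   Outside D, Z is only assumed measurable. *)
Definition gaussian_measure (R : realType) (d : nat) (D : set 'rV[R]_d)
    (disp : measure_display) (T : measurableType disp) (P : probability T R)
    (Z : 'rV[R]_d -> {mfun T >-> R}) (K : R -> R) : Prop :=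
  [/\ gaussian_process D P Z,
      forall u, D u -> ('E_P[Z u] = 0)%E
    & forall u v, D u -> D v ->
        covariance P (Z u) (Z v) = (K (enorm (u - v)))%:E].

Definition kriging (R : realType) (d : nat) (K : R -> R) (n : nat)
    (s : 'I_n -> 'rV[R]_d) (s0 : 'rV[R]_d) (z : 'rV[R]_d -> R) : R :=
  let k : 'cV[R]_n := \col_i K (enorm (s0 - s i)) in
  let KK : 'M[R]_n := \matrix_(i, j) K (enorm (s i - s j)) in
  let zn : 'cV[R]_n := \col_i z (s i) in
  (k^T *m invmx KK *m zn) 0 0.

Definition kriging_error (R : realType) (d : nat) (K : R -> R)
    (disp : measure_display) (T : measurableType disp)
    (Z : 'rV[R]_d -> {mfun T >-> R}) (s : nat -> 'rV[R]_d) (s0 : 'rV[R]_d)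
    (n : nat) (w : T) : R :=
  kriging K (fun i : 'I_n => s i) s0 (fun u => Z u w) - Z s0 w.

(* Main.v *)
Require Import Defs.
From HB Require Import structures.
From mathcomp Require Import all_boot all_order all_algebra.
From mathcomp Require Import all_classical all_reals all_analysis.
From mathcomp Require Import measurable_realfun ring lra.

(**
Both covariance functions are scale mixtures of Gaussian kernels: with
G_a(u, v) = exp(- a |u - v|^2),
  K(|u - v|) = int_0^oo w(t) G_(nu/t)(u, v) dt,
where w is proportional to t^(nu-1) exp(- t / (2 phi^2)) for the Matern
covariance (by the integral representation of the Bessel function) and to
t^(nu-1) (t + beta^2)^(-(nu+alpha)) for the CH covariance.  The condition on
the parameters says exactly that the two weights are equivalent as t -> 0.

The variance of a finite linear combination of values of Z is the value of the
quadratic form of the covariance at the corresponding signed measure with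
finite support.  Write Q and Q' for the two quadratic forms and l_n for the
error functional of the predictor that is optimal for Q: it puts mass -1 at the
target point, is supported on the first n observation points and the target,
is Q-orthogonal to the observations, and minimizes Q among all such measures
(error_min).  By this minimality, applied to both covariances, the theorem
follows from Q'(l_n) / Q(l_n) -> 1 (error_ratio_cvg) and its analogue with the
roles exchanged (optimal_error_ratio_cvg).

To prove it, write Q' - Q as the integral of (w' - w)(t) G_(nu/t)(l_n).  For
small t, |w' - w| is at most a small multiple of w, which costs a small
multiple of Q(l_n).  Away from 0, G_(nu/t)(l_n) has to be negligible: for
every a > 0, G_a(l_n) / Q(l_n) -> 0, with a bound uniform over bounded a so
that the limit may be taken under the integral sign.  Expand
  G_a(u, v) = sum_k exp(- a |u|^2 - a |v|^2) (2 a <u, v>)^k / k!.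
The k-th term is a finite sum of kernels f(u) f(v), so its value at l_n is a
sum of squares of linear functionals f(l_n), each bounded for the norm of Q.
Such a functional is negligible (bounded_functional_negligible): the norms of
l_n go to 0 because the target is a limit point of the observations, hence the
normalized errors are almost orthogonal to any fixed measure; if f did not
tend to 0 along them, a sum of m of them, with suitable signs and indices,
would have norm of order sqrt m and image of order m.

What remains is to bound the terms and the tail of the series by C Q, that is,
to see that exp(b |u|^2 + b |v|^2) G_a(u, v) is at most C times Q on bounded
sets, in the order of positive semidefinite kernels (taylor_domination).  By
the power-type behaviour of w at 0, Q dominates, up to constants, the products
of a fixed Gaussian kernel with mixtures of Gaussian kernels for a gamma weight
of large exponent.  On the line such a mixture, with quadratic form M say,
dominates up to a constant a kernel which is a finite sum of exponentials
exp(- r_j |u - v|) (kle_exp_mix).  For that kernel, a measure whose exponential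
moments at the rates r_j and - r_j vanish can be integrated exactly against
exp(c z) over an interval, and every measure is turned into such a measure by a
few signed translations (annihilate); the result is
  (int exp(c u) dl(u))^2 <= C exp(K |c|) M(l)    (exp_le_gamma_mix).
Averaging over a Gaussian variable c gives the bound for exp(b u^2), and the
tensor product of the one-dimensional bounds (tensor_gamma_mix) gives the
multivariate one.
*)

Set Implicit Arguments.
Unset Strict Implicit.
Unset Printing Implicit Defensive.

Import Order.TTheory GRing.Theory Num.Theory.
Import numFieldNormedType.Exports.

Local Open Scope classical_set_scope.
Local Open Scope ring_scope.

(** * Signed measures with finite support, quadratic forms and positive semidefinite kernels *)

Section functionals.
Variables (R : realType) (X : Type).
Implicit Types (l m : seq (R * X)) (k : X -> X -> R) (f : X -> R).

(** A list of pairs (weight, point) stands for a signed measure with finite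
    support, repetitions allowed.  [lin] integrates a function against it, [bil]
    and [qf] are the bilinear and quadratic forms of a kernel, [psd] is positive
    semidefiniteness and [kle] the order it induces on kernels.  Lists make sums
    and scalings of measures available over an arbitrary type of points. *)
Definition lin f l : R := \sum_(p <- l) p.1 * f p.2.
Definition bil k l m : R := lin (fun x => lin (k x) m) l.
Definition qf k l : R := bil k l l.
Definition psd k := forall l, 0 <= qf k l.
Definition kle k k' := forall l, qf k l <= qf k' l.
Definition scale (a : R) l : seq (R * X) := [seq (a * p.1, p.2) | p <- l].
Definition wt f l : seq (R * X) := [seq (p.1 * f p.2, p.2) | p <- l].

Lemma lin_nil f : lin f [::] = 0. Proof. by rewrite /lin big_nil. Qed.

Lemma lin_cons f p l : lin f (p :: l) = p.1 * f p.2 + lin f l.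
Proof. by rewrite /lin big_cons. Qed.

Lemma lin_cat f l m : lin f (l ++ m) = lin f l + lin f m.
Proof. by rewrite /lin big_cat. Qed.

Lemma lin_scale f a l : lin f (scale a l) = a * lin f l.
Proof.
by rewrite /lin big_map mulr_sumr; apply: eq_bigr => p _ /=; rewrite mulrA.
Qed.

Lemma lin_wt f g l : lin f (wt g l) = lin (fun x => g x * f x) l.
Proof. by rewrite /lin big_map; apply: eq_bigr => p _ /=; rewrite mulrA. Qed.

Lemma eq_lin f g l : f =1 g -> lin f l = lin g l.
Proof. by move=> fg; apply: eq_bigr => p _; rewrite fg. Qed.

Lemma linD f g l : lin (fun x => f x + g x) l = lin f l + lin g l.
Proof. by rewrite /lin -big_split; apply: eq_bigr => p _ /=; rewrite mulrDr. Qed.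

Lemma linZ a f l : lin (fun x => a * f x) l = a * lin f l.
Proof.
by rewrite /lin mulr_sumr; apply: eq_bigr => p _ /=; rewrite mulrCA.
Qed.

Lemma linZr a f l : lin (fun x => f x * a) l = lin f l * a.
Proof. by rewrite mulrC -linZ; apply: eq_lin => x; rewrite mulrC. Qed.

Lemma linN f l : lin (fun x => - f x) l = - lin f l.
Proof. by rewrite -mulN1r -linZ; apply: eq_lin => x; rewrite mulN1r. Qed.

Lemma linB f g l : lin (fun x => f x - g x) l = lin f l - lin g l.
Proof. by rewrite linD linN. Qed.

Lemma lin_sum (I : Type) (r : seq I) (P : pred I) (F : I -> X -> R) l :
  lin (fun x => \sum_(i <- r | P i) F i x) l = \sum_(i <- r | P i) lin (F i) l.
Proof.
rewrite /lin exchange_big /=; apply: eq_bigr => p _.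
by rewrite mulr_sumr.
Qed.

Lemma eq_bil k k' l m : (forall x y, k x y = k' x y) -> bil k l m = bil k' l m.
Proof. by move=> e; apply: eq_lin => x; apply: eq_lin. Qed.

Lemma bil_catl k l l' m : bil k (l ++ l') m = bil k l m + bil k l' m.
Proof. exact: lin_cat. Qed.

Lemma bil_catr k l m m' : bil k l (m ++ m') = bil k l m + bil k l m'.
Proof. by rewrite /bil -linD; apply: eq_lin => x; rewrite lin_cat. Qed.

Lemma bil_scalel k a l m : bil k (scale a l) m = a * bil k l m.
Proof. exact: lin_scale. Qed.

Lemma bil_scaler k a l m : bil k l (scale a m) = a * bil k l m.
Proof. by rewrite /bil -linZ; apply: eq_lin => x; rewrite lin_scale. Qed.

Lemma bilE k l m :
  bil k l m = \sum_(p <- l) \sum_(q <- m) p.1 * (q.1 * k p.2 q.2).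
Proof. by apply: eq_bigr => p _; rewrite mulr_sumr. Qed.

Lemma bil_sym k l m : (forall x y, k x y = k y x) -> bil k l m = bil k m l.
Proof.
move=> ks; rewrite !bilE exchange_big /=; apply: eq_bigr => p _.
by apply: eq_bigr => q _; rewrite ks mulrCA.
Qed.

Lemma qf_cat k l m : (forall x y, k x y = k y x) ->
  qf k (l ++ m) = qf k l + qf k m + 2 * bil k l m.
Proof.
move=> ks; rewrite /qf !(bil_catl, bil_catr) [bil k m l]bil_sym//; ring.
Qed.

Lemma qf_scale k a l : qf k (scale a l) = a ^+ 2 * qf k l.
Proof. by rewrite /qf bil_scalel bil_scaler; ring. Qed.

Lemma eq_qf k k' l : (forall x y, k x y = k' x y) -> qf k l = qf k' l.
Proof. exact: eq_bil. Qed.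

Lemma qfD k k' l : qf (fun x y => k x y + k' x y) l = qf k l + qf k' l.
Proof. by rewrite /qf /bil -linD; apply: eq_lin => x; rewrite linD. Qed.

Lemma qfZ a k l : qf (fun x y => a * k x y) l = a * qf k l.
Proof. by rewrite /qf /bil -linZ; apply: eq_lin => x; rewrite linZ. Qed.

Lemma qfB k k' l : qf (fun x y => k x y - k' x y) l = qf k l - qf k' l.
Proof. by rewrite /qf /bil -linB; apply: eq_lin => x; rewrite linB. Qed.

Lemma qf_sum (I : Type) (r : seq I) (P : pred I) (K : I -> X -> X -> R) l :
  qf (fun x y => \sum_(i <- r | P i) K i x y) l
  = \sum_(i <- r | P i) qf (K i) l.
Proof. by rewrite /qf /bil -lin_sum; apply: eq_lin => x; rewrite lin_sum. Qed.

Lemma qf_rank1 f l : qf (fun x y => f x * f y) l = lin f l ^+ 2.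
Proof.
rewrite /qf /bil expr2 -linZr; apply: eq_lin => x; exact: linZ.
Qed.

Lemma qf_wt f k l : qf (fun x y => f x * f y * k x y) l = qf k (wt f l).
Proof.
rewrite /qf /bil lin_wt; apply: eq_lin => x; rewrite lin_wt -linZ.
by apply: eq_lin => y; rewrite mulrA.
Qed.

(** Expand the nonnegative value of the form at l - m. *)
Lemma bil_amgm k l m : psd k -> (forall x y, k x y = k y x) ->
  2 * bil k l m <= qf k l + qf k m.
Proof.
move=> kp ks; have := kp (l ++ scale (-1) m).
by rewrite qf_cat// qf_scale bil_scaler; lra.
Qed.

Lemma bil_CS k l m : psd k -> (forall x y, k x y = k y x) ->
  bil k l m ^+ 2 <= qf k l * qf k m.
Proof.
move=> kp ks.
have H t : 0 <= qf k l + t ^+ 2 * qf k m + 2 * t * bil k l m.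
  have := kp (l ++ scale t m).
  by rewrite qf_cat// qf_scale bil_scaler mulrA.
have [m0|m0] := eqVneq (qf k m) 0.
  rewrite m0 mulr0.
  have [->|b0] := eqVneq (bil k l m) 0; first by rewrite expr0n.
  (* with this t the nonnegative form at l + t m would be -1 *)
  have := H (- (qf k l + 1) / (2 * bil k l m)).
  rewrite m0 mulr0 addr0.
  have -> : 2 * (- (qf k l + 1) / (2 * bil k l m)) * bil k l m = - (qf k l + 1).
    by field; rewrite b0.
  lra.
have mp : 0 < qf k m by rewrite lt_neqAle eq_sym m0 kp.
have := H (- bil k l m / qf k m).
have -> : qf k l + (- bil k l m / qf k m) ^+ 2 * qf k m
    + 2 * (- bil k l m / qf k m) * bil k l m
  = (qf k l * qf k m - bil k l m ^+ 2) / qf k m by field.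
by rewrite pmulr_lge0 ?invr_gt0// subr_ge0.
Qed.

Lemma psdB k k' : psd (fun x y => k' x y - k x y) -> kle k k'.
Proof. by move=> p l; rewrite -subr_ge0 -qfB. Qed.

Lemma kle_psd k k' : kle k k' -> psd (fun x y => k' x y - k x y).
Proof. by move=> h l; rewrite qfB subr_ge0. Qed.

Lemma psd_wt f k : psd k -> psd (fun x y => f x * f y * k x y).
Proof. by move=> kp l; rewrite qf_wt. Qed.

Lemma psd_sum (I : Type) (r : seq I) (K : I -> X -> X -> R) :
  (forall i, psd (K i)) -> psd (fun x y => \sum_(i <- r) K i x y).
Proof. by move=> Kp l; rewrite qf_sum sumr_ge0// => i _; exact: Kp. Qed.

Lemma psd_eq k k' : (forall x y, k x y = k' x y) -> psd k -> psd k'.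
Proof. by move=> e kp l; rewrite -(eq_qf _ e). Qed.

Lemma psdZ a k : 0 <= a -> psd k -> psd (fun x y => a * k x y).
Proof. by move=> a0 kp l; rewrite qfZ mulr_ge0. Qed.

Lemma cvg_lin (F : nat -> X -> R) f l :
  (forall x, F n x @[n --> \oo] --> f x) ->
  lin (F n) l @[n --> \oo] --> lin f l.
Proof.
move=> h; elim: l => [|p l IH].
  by under eq_cvg do rewrite lin_nil; rewrite lin_nil; exact: cvg_cst.
under eq_cvg do rewrite lin_cons; rewrite lin_cons.
by apply: cvgD => //; apply: cvgM => //; exact: cvg_cst.
Qed.

Lemma cvg_qf (K : nat -> X -> X -> R) k l :
  (forall x y, K n x y @[n --> \oo] --> k x y) ->
  qf (K n) l @[n --> \oo] --> qf k l.
Proof. by move=> h; apply: cvg_lin => x; apply: cvg_lin. Qed.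

Lemma psd_cvg (K : nat -> X -> X -> R) k :
  (forall n, psd (K n)) ->
  (forall x y, K n x y @[n --> \oo] --> k x y) -> psd k.
Proof.
move=> Kp h l; have c := cvg_qf (l := l) h.
rewrite -(cvg_lim _ c)//; apply: limr_ge; first by apply/cvg_ex; exists (qf k l).
by near=> n; exact: Kp.
Unshelve. all: by end_near.
Qed.

End functionals.

Definition push (R : realType) (X Y : Type) (g : X -> Y) (l : seq (R * X)) :
  seq (R * Y) := [seq (p.1, g p.2) | p <- l].

Lemma lin_push (R : realType) (X Y : Type) (g : X -> Y) (f : Y -> R) l :
  lin f (push g l) = lin (f \o g) l.
Proof. by rewrite /lin big_map. Qed.

Lemma bil_push (R : realType) (X Y : Type) (g h : X -> Y) (k : Y -> Y -> R) l m :
  bil k (push g l) (push h m) = bil (fun x y => k (g x) (h y)) l m.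
Proof. by rewrite /bil lin_push; apply: eq_lin => x /=; rewrite lin_push. Qed.

Lemma qf_push (R : realType) (X Y : Type) (g : X -> Y) (k : Y -> Y -> R) l :
  qf k (push g l) = qf (fun x y => k (g x) (g y)) l.
Proof. exact: bil_push. Qed.

Section schur.
Variables (R : realType) (X : Type).
Implicit Types (A : X -> X -> R) (x : X -> R).

Lemma expR_series (z : R) :
  (\sum_(0 <= n < N) z ^+ n / n`!%:R) @[N --> \oo] --> expR z.
Proof. by rewrite /expR; exact: is_cvg_series_exp_coeff. Qed.

Lemma psd_expX A x (c : R) n : 0 <= c -> psd A ->
  psd (fun i j => A i j * (c * (x i * x j)) ^+ n).
Proof.
move=> c0 Ap; apply: (@psd_eq _ _ (fun i j => c ^+ n * (x i ^+ n * x j ^+ n * A i j))).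
  by move=> i j; rewrite !exprMn; ring.
by apply: psdZ; [rewrite exprn_ge0|exact: psd_wt].
Qed.

(** The exponential series has nonnegative coefficients, so Schur products with
    exp(c x y) preserve positivity term by term. *)
Lemma psd_exp A x (c : R) : 0 <= c -> psd A ->
  psd (fun i j => A i j * expR (c * (x i * x j))).
Proof.
move=> c0 Ap.
apply: (@psd_cvg _ _ (fun N i j =>
    A i j * \sum_(0 <= n < N) (c * (x i * x j)) ^+ n / n`!%:R)).
  move=> N; apply: (@psd_eq _ _ (fun i j => \sum_(0 <= n < N)
     (n`!%:R)^-1 * (A i j * (c * (x i * x j)) ^+ n))).
    by move=> i j; rewrite mulr_sumr; apply: eq_bigr => n _; rewrite mulrCA; congr (_ * _); rewrite mulrC.
  by apply: psd_sum => n; apply: psdZ; rewrite ?invr_ge0//; exact: psd_expX.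
by move=> i j; apply: cvgM; [exact: cvg_cst|exact: expR_series].
Qed.

Definition gauss (a : R) x (i j : X) := expR (- (a * (x i - x j) ^+ 2)).

(** exp(- a (x - y)^2) is a rank-one reweighting of exp(2 a x y). *)
Lemma psd_gaussM A x (a : R) : 0 <= a -> psd A ->
  psd (fun i j => A i j * gauss a x i j).
Proof.
move=> a0 Ap; set f := fun i => expR (- (a * x i ^+ 2)).
apply: (@psd_eq _ _ (fun i j => f i * f j * (A i j * expR (2 * a * (x i * x j))))).
  move=> i j; rewrite /f /gauss mulrCA -!expRD; congr (_ * expR _); ring.
by apply: psd_wt; apply: psd_exp => //; rewrite mulr_ge0.
Qed.

(** Gaussian kernel in the coordinates listed in L; the list makes induction on
    the number of coordinates possible. *)
Definition gaussL (I : Type) (a : R) (L : seq I) (x : I -> X -> R) (i j : X) :=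
  expR (- (a * \sum_(c <- L) (x c i - x c j) ^+ 2)).

Lemma gaussL_nil (I : Type) a (x : I -> X -> R) i j : @gaussL I a [::] x i j = 1.
Proof. by rewrite /gaussL big_nil mulr0 oppr0 expR0. Qed.

Lemma gaussL_cons (I : Type) a c L (x : I -> X -> R) i j :
  @gaussL I a (c :: L) x i j = gaussL a L x i j * gauss a (x c) i j.
Proof. by rewrite /gaussL /gauss big_cons -expRD mulrDr opprD addrC. Qed.

Lemma psd_gaussLM (I : Type) A (L : seq I) (x : I -> X -> R) (a : R) : 0 <= a -> psd A ->
  psd (fun i j => A i j * gaussL a L x i j).
Proof.
move=> a0; elim: L A => [|c L IH] A Ap.
  by apply: psd_eq Ap => i j; rewrite gaussL_nil mulr1.
apply: (@psd_eq _ _ (fun i j => A i j * gauss a (x c) i j * gaussL a L x i j)).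
  by move=> i j; rewrite gaussL_cons mulrAC mulrA.
by apply: IH; exact: psd_gaussM.
Qed.

Lemma psd1 : psd (fun _ _ : X => 1 : R).
Proof.
move=> l; have := sqr_ge0 (lin (fun=> 1) l).
by rewrite -qf_rank1; congr (_ <= _); apply: eq_qf => *; rewrite mulr1.
Qed.

Lemma psd_gaussL (I : Type) (L : seq I) (x : I -> X -> R) (a : R) : 0 <= a ->
  psd (gaussL a L x).
Proof.
move=> a0; apply: (@psd_eq _ _ (fun i j => 1 * gaussL a L x i j)).
  by move=> i j; rewrite mul1r.
by apply: psd_gaussLM => //; exact: psd1.
Qed.

Lemma kle_gaussLM (I : Type) A A' (L : seq I) (x : I -> X -> R) (a : R) : 0 <= a -> kle A A' ->
  kle (fun i j => A i j * gaussL a L x i j) (fun i j => A' i j * gaussL a L x i j).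
Proof.
move=> a0 /kle_psd h; apply: psdB.
apply: psd_eq (psd_gaussLM L x a0 h) => i j; ring.
Qed.

Lemma kle_gaussM A A' x (a : R) : 0 <= a -> kle A A' ->
  kle (fun i j => A i j * gauss a x i j) (fun i j => A' i j * gauss a x i j).
Proof.
move=> a0 /kle_psd h; apply: psdB.
apply: psd_eq (psd_gaussM x a0 h) => i j; ring.
Qed.

Lemma kle_wt A A' (f : X -> R) : kle A A' ->
  kle (fun i j => f i * f j * A i j) (fun i j => f i * f j * A' i j).
Proof. by move=> h l; rewrite !qf_wt. Qed.

Lemma gaussLC (I : Type) a (L : seq I) (x : I -> X -> R) i j :
  gaussL a L x i j = gaussL a L x j i.
Proof.
rewrite /gaussL; congr (expR (- (_ * _))); apply: eq_bigr => c _.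
by rewrite -sqrrN opprB.
Qed.

Lemma gaussL_le1 (I : Type) a (L : seq I) (x : I -> X -> R) i j :
  0 <= a -> gaussL a L x i j <= 1.
Proof.
move=> a0; rewrite expR_le1 oppr_le0 mulr_ge0// sumr_ge0// => c _.
exact: sqr_ge0.
Qed.

Lemma gaussL_ge0 (I : Type) a (L : seq I) (x : I -> X -> R) i j :
  0 <= gaussL a L x i j.
Proof. exact: expR_ge0. Qed.

End schur.

(** * Integrals over the positive half-line *)

Section linear_integral.
Variable R : realType.
Notation mu := (@lebesgue_measure R).

Lemma lin_integral (D : set (measurableTypeR R)) (X : Type) (F : R -> X -> R) l :
  measurable D -> (forall x, mu.-integrable D (EFin \o (fun t => F t x))) ->
  mu.-integrable D (EFin \o (fun t => lin (F t) l)) /\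
  lin (fun x => \int[mu]_(t in D) F t x) l = \int[mu]_(t in D) lin (F t) l.
Proof.
move=> mD Fi; elim: l => [|p l [IH1 IH2]].
  split.
    apply: eq_integrable (integrable0 mu D) => // t _ /=.
    by rewrite lin_nil.
  rewrite lin_nil /Rintegral (eq_integral (cst 0%E)) ?integral0// => t _ /=.
  by rewrite lin_nil.
have i1 : mu.-integrable D (EFin \o (fun t => p.1 * F t p.2)).
  by have := integrableZl mD p.1 (Fi p.2); exact: eq_integrable.
split.
  have := integrableD mD i1 IH1; apply: eq_integrable => // t _ /=.
  by rewrite lin_cons.
rewrite lin_cons IH2 -RintegralZl// -RintegralD//.
by apply: eq_Rintegral => t _; rewrite lin_cons.
Qed.

End linear_integral.

Section halfline.
Variable R : realType.
Notation mu := (@lebesgue_measure R).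
Let D : set (measurableTypeR R) := `]0%R, +oo[%classic.
Implicit Types f g : R -> R.

(** Functions such as x^(p-1) are regular only at positive points, so continuity,
    measurability and integrability are all restricted to them. *)
Definition cpos f := forall x, 0 < x -> {for x, continuous f}.
Definition pmeas f := @measurable_fun _ _ (measurableTypeR R) (measurableTypeR R) `]0, +oo[%classic f.
Definition pitg f := mu.-integrable `]0, +oo[ (EFin \o f).
Definition pint f : R := \int[mu]_(x in `]0, +oo[) f x.

Let mI : measurable (`]0%R, +oo[%classic : set (measurableTypeR R)).
Proof. exact: measurable_itv. Qed.

Lemma in0y (x : R) : (`]0, +oo[%classic : set R) x -> 0 < x.
Proof. by rewrite /= in_itv /= andbT. Qed.

Lemma cpos_meas f : cpos f -> pmeas f.
Proof.
move=> fc; apply: open_continuous_measurable_fun => //.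
by move=> x; rewrite inE => /in0y; exact: fc.
Qed.

Lemma pmeas_pitg f : pitg f -> pmeas f.
Proof. by move=> /integrableP[/measurable_EFinP]. Qed.

Lemma pitg_le f g : pmeas f -> (forall x, 0 < x -> `|f x| <= g x) ->
  pitg g -> pitg f.
Proof.
move=> fm fg; apply: le_integrable => //; first exact/measurable_EFinP.
by move=> x /in0y x0; rewrite lee_fin (le_trans (fg _ x0))// ler_norm.
Qed.

Lemma eq_pitg f g : (forall x, 0 < x -> f x = g x) -> pitg f -> pitg g.
Proof.
move=> fg; apply: eq_integrable => // x; rewrite inE => /in0y x0 /=.
by rewrite fg.
Qed.

Lemma eq_pint f g : (forall x, 0 < x -> f x = g x) -> pint f = pint g.
Proof.
by move=> fg; apply: eq_Rintegral => x; rewrite inE => /in0y x0; rewrite fg.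
Qed.

Lemma pitgD f g : pitg f -> pitg g -> pitg (fun x => f x + g x).
Proof. by move=> fi gi; by have := integrableD mI fi gi; exact: eq_integrable. Qed.

Lemma pitgZ a f : pitg f -> pitg (fun x => a * f x).
Proof. by move=> fi; by have := integrableZl mI a fi; exact: eq_integrable. Qed.

Lemma pitgN f : pitg f -> pitg (fun x => - f x).
Proof. by move=> fi; by have := integrableN fi; exact: eq_integrable. Qed.

Lemma pitgB f g : pitg f -> pitg g -> pitg (fun x => f x - g x).
Proof. by move=> fi gi; apply: pitgD => //; exact: pitgN. Qed.

Lemma pitg0 : pitg (fun=> 0).
Proof. exact: integrable0. Qed.

Lemma pintD f g : pitg f -> pitg g ->
  pint (fun x => f x + g x) = pint f + pint g.
Proof. by move=> fi gi; exact: RintegralD. Qed.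

Lemma pintB f g : pitg f -> pitg g ->
  pint (fun x => f x - g x) = pint f - pint g.
Proof. by move=> fi gi; exact: RintegralB. Qed.

Lemma pintZ a f : pitg f -> pint (fun x => a * f x) = a * pint f.
Proof. by move=> fi; exact: RintegralZl. Qed.

Lemma le_pint f g : pitg f -> pitg g -> (forall x, 0 < x -> f x <= g x) ->
  pint f <= pint g.
Proof. by move=> fi gi fg; apply: le_Rintegral => // x /in0y; exact: fg. Qed.

Lemma pint_ge0 f : (forall x, 0 < x -> 0 <= f x) -> 0 <= pint f.
Proof. by move=> f0; apply: Rintegral_ge0 => x /in0y; exact: f0. Qed.

Lemma pint0 : pint (fun=> 0) = 0.
Proof. by rewrite /pint /Rintegral integral0. Qed.

Lemma pitg_sum (I : Type) (r : seq I) (F : I -> R -> R) :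
  (forall i, pitg (F i)) -> pitg (fun x => \sum_(i <- r) F i x).
Proof.
move=> Fi; elim: r => [|i r IH].
  by apply: eq_pitg pitg0 => x _; rewrite big_nil.
by apply: eq_pitg (pitgD (Fi i) IH) => x _; rewrite big_cons.
Qed.

Lemma pint_sum (I : Type) (r : seq I) (F : I -> R -> R) :
  (forall i, pitg (F i)) ->
  pint (fun x => \sum_(i <- r) F i x) = \sum_(i <- r) pint (F i).
Proof.
move=> Fi; elim: r => [|i r IH].
  by rewrite big_nil -[RHS]pint0; apply: eq_pint => x _; rewrite big_nil.
rewrite big_cons -IH -pintD//; last exact: pitg_sum.
by apply: eq_pint => x _; rewrite big_cons.
Qed.

Lemma pint_cvg (f_ : nat -> R -> R) f g :
  (forall n, pmeas (f_ n)) -> (forall x, 0 < x -> f_ n x @[n --> \oo] --> f x) ->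
  pitg g -> (forall n x, 0 < x -> `|f_ n x| <= g x) ->
  pint (f_ n) @[n --> \oo] --> pint f.
Proof.
move=> fm fc gi fg.
have fm' n : measurable_fun D (EFin \o f_ n) by apply/measurable_EFinP; exact: fm.
have fc' x : D x -> (EFin \o f_ n) x @[n --> \oo] --> (EFin \o f) x.
  move=> /in0y x0; apply: cvg_EFin. by apply: nearW. exact: fc.
have fg' n x : D x -> (`|(EFin \o f_ n) x| <= (EFin \o g) x)%E.
  by move=> /in0y x0; rewrite lee_fin; exact: fg.
have fi n : pitg (f_ n) by apply: pitg_le gi => //; exact: fg.
have fi' : pitg f.
  apply: pitg_le gi; first by apply: (measurable_fun_cvg fm) => x /in0y; exact: fc.
  move=> x x0; have c : `|f_ n x| @[n --> \oo] --> `|f x| by apply: cvg_norm; exact: fc.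
  rewrite -(cvg_lim _ c)//; apply: limr_le; first by apply/cvg_ex; exists `|f x|.
  by apply: nearW => n; exact: fg.
have h := dominated_cvg (mu := mu) (g := EFin \o g) mI fm' fc' (fun _ _ => isT) gi fg'.
rewrite /pint /Rintegral; apply: fine_cvg; rewrite fineK; last exact: integrable_fin_num.
exact: h.
Qed.

(** The quadratic form of a mixture of kernels is the mixture of the quadratic
    forms. *)
Lemma qf_pint (X : Type) (k : R -> X -> X -> R) (w : R -> R) l :
  (forall x y, pitg (fun t => w t * k t x y)) ->
  pitg (fun t => w t * qf (k t) l) /\
  qf (fun x y => pint (fun t => w t * k t x y)) l = pint (fun t => w t * qf (k t) l).
Proof.
move=> ki.
have step (F : R -> X -> R) m : (forall x, pitg (fun t => w t * F t x)) ->
    pitg (fun t => w t * lin (F t) m) /\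
    lin (fun x => pint (fun t => w t * F t x)) m = pint (fun t => w t * lin (F t) m).
  move=> Fi; have [h1 h2] := lin_integral m mI Fi.
  split; first by apply: eq_pitg h1 => t _; rewrite linZ.
  by rewrite h2; apply: eq_pint => t _; rewrite linZ.
have s1 x := step (fun t => k t x) l (ki x).
rewrite /qf /bil; have [i2 e2] := step (fun t x => lin (k t x) l) l (fun x => (s1 x).1).
split => //; rewrite -e2; apply: eq_lin => x; exact: (s1 x).2.
Qed.

End halfline.

(** * Change of variables on unbounded intervals *)

Section substitution.
Variable R : realType.
Notation mu := (@lebesgue_measure R).
Implicit Types F f G : R -> R.

(** Substitution is known on compact intervals; monotone convergence along an
    exhaustion extends it to unbounded ones. *)
Lemma exhaust_eq (f g : R -> R) (A B : nat -> set (measurableTypeR R)) :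
  nondecreasing_seq A -> nondecreasing_seq B ->
  (forall n, measurable (A n)) -> (forall n, measurable (B n)) ->
  (forall n, measurable_fun (A n) f) -> (forall n, measurable_fun (B n) g) ->
  (forall n x, A n x -> 0 <= f x) -> (forall n x, B n x -> 0 <= g x) ->
  (forall n, \int[mu]_(x in A n) (f x)%:E = \int[mu]_(x in B n) (g x)%:E)%E ->
  (\int[mu]_(x in \bigcup_n A n) (f x)%:E = \int[mu]_(x in \bigcup_n B n) (g x)%:E)%E.
Proof.
move=> nA nB mA mB mf mg f0 g0 e.
have cA := @ge0_nondecreasing_set_cvg_integral _ _ _ A (EFin \o f) mu nA mA
  (fun n => (measurable_EFinP _ _).2 (mf n)) (fun n x h => f0 n x h).
have cB := @ge0_nondecreasing_set_cvg_integral _ _ _ B (EFin \o g) mu nB mB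
  (fun n => (measurable_EFinP _ _).2 (mg n)) (fun n x h => g0 n x h).
move: cA; rewrite (_ : (fun i => _) = (fun i => \int[mu]_(x in B i) (EFin \o g) x)%E).
  by move=> cA; exact: cvg_unique cA cB.
by apply/funext => n; exact: e.
Qed.

Lemma cont_meas f (a b : R) :
  (forall x, a <= x <= b -> {for x, continuous f}) ->
  {within `[a, b], continuous f} /\
  measurable_fun (`[a, b]%classic : set (measurableTypeR R)) f.
Proof.
move=> h; have c : {within `[a, b], continuous f}.
  by apply: continuous_in_subspaceT => x; rewrite inE /= in_itv /=; exact: h.
split => //; exact: subspace_continuous_measurable_fun.
Qed.

Lemma nd_itv (a b : nat -> R) : {homo a : m n / (m <= n)%N >-> n <= m} ->
  {homo b : m n / (m <= n)%N >-> m <= n} ->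
  nondecreasing_seq (fun n => `[a n, b n]%classic : set (measurableTypeR R)).
Proof.
move=> ha hb m n mn; apply/subsetPset => x /=; rewrite !in_itv /= => /andP[ax xb].
by rewrite (le_trans (ha _ _ mn))// (le_trans xb)// hb.
Qed.

Lemma cup_itv0y : \bigcup_n (`[0%R, n%:R]%classic) = `[0%R, +oo[%classic :> set R.
Proof.
apply/seteqP; split => x.
  by move=> [n _]; rewrite /= !in_itv /= andbT => /andP[].
rewrite /= in_itv /= andbT => x0; exists (Num.bound x) => //=.
by rewrite in_itv /= x0 /= ltW// archi_boundP.
Qed.

Lemma homo_natr : {homo (fun n : nat => n%:R : R) : m n / (m <= n)%N >-> m <= n}.
Proof. by move=> m n; rewrite ler_nat. Qed.

Lemma derive1_is F f : (forall t, is_derive t (1:R) F (f t)) -> (F^`())%classic = f.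
Proof. by move=> dF; apply/funext => t; rewrite derive1E derive_val. Qed.

Lemma is_derive_cont F f : (forall t, is_derive t (1:R) F (f t)) -> continuous F.
Proof.
move=> dF t; have [h _] := dF t.
exact/differentiable_continuous/derivable1_diffP.
Qed.

Lemma LR_cont F f a b : (forall t, is_derive t (1:R) F (f t)) ->
  derivable_oo_LRcontinuous F a b.
Proof.
move=> dF; have cF := is_derive_cont dF; split.
- by move=> x _; have [] := dF x.
- exact/cvg_at_right_filter/cF.
- exact/cvg_at_left_filter/cF.
Qed.

Lemma subst_incr F f c G : (forall t, is_derive t (1:R) F (f t)) -> continuous f ->
  (forall x y, 0 <= x -> x < y -> F x < F y) -> F 0 = c ->
  (forall M, exists n : nat, M <= F n%:R) ->
  (forall x, c <= x -> {for x, continuous G}) -> (forall x, c <= x -> 0 <= G x) ->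
  (forall t, 0 <= t -> 0 <= f t) ->
  (\int[mu]_(x in `[c, +oo[) (G x)%:E = \int[mu]_(t in `[0%R, +oo[) (G (F t) * f t)%:E)%E.
Proof.
move=> dF cf iF F0 Fy cG G0 f0.
have mF x y : 0 <= x -> x <= y -> F x <= F y.
  by move=> x0; rewrite le_eqVlt => /predU1P[->//|xy]; exact/ltW/iF.
have Fc t : 0 <= t -> c <= F t by rewrite -F0; exact: mF.
have nF : {homo (fun n : nat => F n%:R) : m n / (m <= n)%N >-> m <= n}.
  by move=> m n mn; apply: mF => //; rewrite ler_nat.
have cGF n x : 0 <= x <= n -> {for x, continuous (fun t => G (F t) * f t)}.
  move=> /andP[x0 _]; apply: continuousM; last exact: cf.
  by apply: continuous_comp; [exact: is_derive_cont dF x|exact/cG/Fc].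
have -> : `[c, +oo[%classic = \bigcup_n `[c, F n%:R]%classic :> set R.
  apply/seteqP; split => x; last by move=> [n _]; rewrite /= !in_itv /= andbT => /andP[].
  rewrite /= in_itv /= andbT => cx; have [n Mn] := Fy x; exists n => //=.
  by rewrite in_itv /= cx.
rewrite -cup_itv0y; apply: (exhaust_eq (g := fun t => G (F t) * f t)).
- exact: nd_itv.
- by apply: nd_itv => //; exact: homo_natr.
- by move=> n; exact: measurable_itv.
- by move=> n; exact: measurable_itv.
- by move=> n; apply: (cont_meas _).2 => x /andP[cx _]; exact: cG.
- by move=> n; apply: (cont_meas _).2 => x; exact: cGF.
- by move=> n x; rewrite /= in_itv /= => /andP[cx _]; exact: G0.
- by move=> n x; rewrite /= in_itv /= => /andP[x0 _]; rewrite mulr_ge0 ?f0//; exact/G0/Fc.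
move=> n; rewrite -{1}F0 integration_by_substitution_increasing//.
- by apply: eq_integral => x _; rewrite (derive1_is dF).
- by move=> x y; rewrite !in_itv /= => /andP[x0 _] _; exact: iF.
- by rewrite (derive1_is dF) => x _; exact: cf.
- by rewrite (derive1_is dF); apply/cvg_ex; exists (f 0); exact/cvg_at_right_filter/cf.
- by rewrite (derive1_is dF); apply/cvg_ex; exists (f n%:R); exact/cvg_at_left_filter/cf.
- exact: LR_cont dF.
- by rewrite F0; apply: (cont_meas _).1 => x /andP[cx _]; exact: cG.
Qed.

Lemma subst_decr F f c G : (forall t, is_derive t (1:R) F (f t)) -> continuous f ->
  (forall x y, 0 <= x -> x < y -> F y < F x) -> F 0 = c ->
  (forall M, 0 < M -> exists n : nat, F n%:R <= M) -> (forall t, 0 < F t) ->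
  (forall x, 0 < x -> {for x, continuous G}) -> (forall x, 0 < x -> 0 <= G x) ->
  (forall t, 0 <= t -> f t <= 0) ->
  (\int[mu]_(x in `]0%R, c]) (G x)%:E = \int[mu]_(t in `[0%R, +oo[) (G (F t) * - f t)%:E)%E.
Proof.
move=> dF cf iF F0 Fy Fp cG G0 f0.
have mF x y : 0 <= x -> x <= y -> F y <= F x.
  by move=> x0; rewrite le_eqVlt => /predU1P[->//|xy]; exact/ltW/iF.
have nF : {homo (fun n : nat => F n%:R) : m n / (m <= n)%N >-> n <= m}.
  by move=> m n mn; apply: mF => //; rewrite ler_nat.
have cGF n x : 0 <= x <= n -> {for x, continuous (fun t => G (F t) * - f t)}.
  move=> /andP[x0 _]; apply: continuousM; last by apply: continuousN; exact: cf.
  by apply: continuous_comp; [exact: is_derive_cont dF x|exact/cG/Fp].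
have -> : `]0%R, c]%classic = \bigcup_n `[F n%:R, c]%classic :> set R.
  apply/seteqP; split => x; last first.
    by move=> [n _]; rewrite /= !in_itv /= => /andP[h ->]; rewrite (lt_le_trans (Fp n%:R)).
  rewrite /= in_itv /= => /andP[x0 xc]; have [n Mn] := Fy x x0; exists n => //=.
  by rewrite in_itv /= xc Mn.
rewrite -cup_itv0y; apply: (exhaust_eq (g := fun t => G (F t) * - f t)).
- exact: nd_itv.
- by apply: nd_itv => //; exact: homo_natr.
- by move=> n; exact: measurable_itv.
- by move=> n; exact: measurable_itv.
- by move=> n; apply: (cont_meas _).2 => x /andP[cx _]; apply: cG; exact: lt_le_trans (Fp _) cx.
- by move=> n; apply: (cont_meas _).2 => x; exact: cGF.
- by move=> n x; rewrite /= in_itv /= => /andP[cx _]; apply: G0; exact: lt_le_trans (Fp _) cx.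
- move=> n x; rewrite /= in_itv /= => /andP[x0 _]; rewrite mulr_ge0//; first exact/G0/Fp.
  by rewrite oppr_ge0 f0.
move=> n; rewrite -{1}F0 integration_by_substitution_decreasing//.
- by apply: eq_integral => x _; rewrite (derive1_is dF).
- by move=> x y; rewrite !in_itv /= => _ /andP[x0 _]; exact: iF.
- by rewrite (derive1_is dF) => x _; exact: cf.
- by rewrite (derive1_is dF); apply/cvg_ex; exists (f 0); exact/cvg_at_right_filter/cf.
- by rewrite (derive1_is dF); apply/cvg_ex; exists (f n%:R); exact/cvg_at_left_filter/cf.
- exact: LR_cont dF.
- by rewrite F0; apply: (cont_meas _).1 => x /andP[cx _]; apply: cG; exact: lt_le_trans (Fp _) cx.
Qed.

Lemma expR_natr_ge (M : R) : exists n : nat, M <= expR n%:R.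
Proof.
exists (Num.bound `|M|); rewrite (le_trans (ler_norm _))// ltW//.
rewrite (lt_le_trans (archi_boundP (normr_ge0 _)))// (le_trans _ (expR_ge1Dx _))//.
by rewrite lerDr.
Qed.

(** Cut the half-line at c and put x = c e^t on the right part and x = c e^-t on
    the left one.  Folding the two parts onto t > 0 is what turns integrals of
    x^(p-1) exp(- b x - d / x) into hyperbolic cosines. *)
Lemma subst_exp (c : R) G : 0 < c -> cpos G -> (forall x, 0 < x -> 0 <= G x) ->
  (\int[mu]_(x in `]0%R, +oo[) (G x)%:E =
   \int[mu]_(t in `]0%R, +oo[)
     (G (c * expR t) * (c * expR t) + G (c * expR (- t)) * (c * expR (- t)))%:E)%E.
Proof.
move=> c0 cG G0.
have cp t : 0 < c * expR t by rewrite mulr_gt0// expR_gt0.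
have d1 (t : R) : is_derive t (1:R) (fun t => c * expR t) (c * expR t).
  by apply: is_derive_eq.
have d2 (t : R) : is_derive t (1:R) (fun t => c * expR (- t)) (- (c * expR (- t))).
  by apply: is_derive_eq; rewrite /GRing.scale /= mulrN1 mulrN.
have c1 : continuous (fun t => c * expR t) := is_derive_cont d1.
have c2 : continuous (fun t => c * expR (- t)) := is_derive_cont d2.
have k1' t : {for t, continuous (fun t => G (c * expR t) * (c * expR t))}.
  apply: continuousM; last exact: c1.
  by apply: continuous_comp; [exact: c1|exact/cG/cp].
have k2' t : {for t, continuous (fun t => G (c * expR (- t)) * (c * expR (- t)))}.
  apply: continuousM; last exact: c2.
  by apply: continuous_comp; [exact: c2|exact/cG/cp].
have k1 : continuous _ := k1'; have k2 : continuous _ := k2'.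
have m D f : measurable D -> continuous f ->
    @measurable_fun _ _ (measurableTypeR R) _ D (EFin \o f).
  move=> mD fc; apply/measurable_EFinP; apply: measurable_funS (continuous_measurable_fun fc) => //.
rewrite [LHS](_ : _ = \int[mu]_(x in `]0%R, c] `|` `]c, +oo[) (G x)%:E)%E; last first.
  by congr integral; rewrite -itv_bndbnd_setU// bnd_simp// ltW.
have mG (a : itv_bound R) b : (BRight 0 <= a)%O -> 
  measurable_fun ([set` Interval a b] : set (measurableTypeR R)) (fun x => (G x)%:E).
  move=> h; apply/measurable_EFinP.
  apply: (measurable_funS (measurable_itv `]0%R, +oo[)); last exact: cpos_meas.
  by apply: subset_itv => //; case: b => [[] ?|[]].
have hc : (BRight 0 <= BRight c)%O by rewrite bnd_simp ltW.
rewrite ge0_integral_setU//=.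
- rewrite [X in (_ + X)%E]integral_itv_obnd_cbnd; last exact: mG hc.
  rewrite (@subst_incr (fun t => c * expR t) (fun t => c * expR t) c)//; first last.
  + by move=> t _; exact: ltW.
  + by move=> x cx; apply: G0; exact: lt_le_trans c0 cx.
  + by move=> x cx; apply: cG; exact: lt_le_trans c0 cx.
  + move=> M; have [n Mn] := expR_natr_ge (M / c); exists n.
    by rewrite -ler_pdivrMl// mulrC.
  + by rewrite expR0 mulr1.
  + by move=> x y _ xy; rewrite ltr_pM2l// ltr_expR.
  rewrite (@subst_decr (fun t => c * expR (- t)) (fun t => - (c * expR (- t))) c)//; first last.
  + by move=> t _; rewrite oppr_le0 ltW.
  + move=> M M0; have [n Mn] := expR_natr_ge (c / M); exists n.
    by rewrite expRN ler_pdivrMr ?expR_gt0// mulrC -ler_pdivrMr.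
  + by rewrite oppr0 expR0 mulr1.
  + by move=> x y _ xy; rewrite ltr_pM2l// ltr_expR ltrN2.
  + by move=> t; apply: cvgN; exact: c2.
  rewrite -[in LHS]integral_itv_obnd_cbnd; last by apply: m => //; under eq_fun do rewrite opprK.
  rewrite -[X in (_ + X)%E]integral_itv_obnd_cbnd; last by apply: m.
  rewrite -ge0_integralD//=.
  + by apply: eq_integral => t _; rewrite -EFinD opprK addrC.
  + by move=> t _; rewrite lee_fin opprK mulr_ge0 ?G0// ltW.
  + by apply: m => //; under eq_fun do rewrite opprK.
  + by move=> t _; rewrite lee_fin mulr_ge0 ?G0// ltW.
  + exact: m.
- by apply/measurable_funU => //; split; exact: mG.
- move=> x [|]; rewrite /= in_itv /= ?andbT => h; rewrite lee_fin G0//.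
    by case/andP: h.
  exact: lt_trans c0 h.
- apply/disj_setPS => x []; rewrite /= !in_itv /= andbT => /andP[_ h] h'.
  by have := le_lt_trans h h'; rewrite ltxx.
Qed.

End substitution.

(** * Continuity and integrability on the half-line *)

Section integrals.
Variable R : realType.
Notation mu := (@lebesgue_measure R).

Lemma cst_cpos (c : R) : cpos (fun=> c).
Proof. by move=> x _; exact: cst_continuous. Qed.

Lemma cposM (f g : R -> R) : cpos f -> cpos g -> cpos (fun x => f x * g x).
Proof. by move=> cf cg x x0; apply: continuousM; [exact: cf|exact: cg]. Qed.

Lemma cpos_powR (p : R) : cpos (fun x => x `^ p).
Proof. move=> x x0; have [h _] := is_derive1_powR p x0.
exact/differentiable_continuous/derivable1_diffP. Qed.

Lemma cpos_expR (f : R -> R) : cpos f -> cpos (fun x => expR (f x)).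
Proof. by move=> cf x x0; apply: continuous_comp; [exact: cf|exact: continuous_expR]. Qed.

Lemma cposN (f : R -> R) : cpos f -> cpos (fun x => - f x).
Proof. by move=> cf x x0; apply: continuousN; exact: cf. Qed.

Lemma cposD (f g : R -> R) : cpos f -> cpos g -> cpos (fun x => f x + g x).
Proof. by move=> cf cg x x0; apply: continuousD; [exact: cf|exact: cg]. Qed.

Lemma cpos_id : cpos (fun x : R => x).
Proof. by move=> x _; exact: cvg_id. Qed.

Lemma cpos_inv : cpos (fun x : R => x^-1).
Proof. by move=> x x0; apply: inv_continuous; rewrite gt_eqF. Qed.

Lemma cpos_comp (f g : R -> R) : cpos f -> cpos g -> (forall x, 0 < x -> 0 < f x) ->
  cpos (fun x => g (f x)).
Proof.
by move=> cf cg f0 x x0; apply: continuous_comp; [exact: cf|exact/cg/f0].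
Qed.

Lemma pitg_ge0 (f : R -> R) : cpos f -> (forall x, 0 < x -> 0 <= f x) ->
  (\int[mu]_(x in `]0%R, +oo[) (f x)%:E < +oo)%E -> pitg f.
Proof.
move=> cf f0 fy; apply/integrableP; split; first by apply/measurable_EFinP; exact: cpos_meas.
apply: le_lt_trans fy; rewrite le_eqVlt; apply/orP; left; apply/eqP.
apply: eq_integral => x; rewrite inE => /in0y x0.
by rewrite /= ger0_norm// f0.
Qed.

Lemma pitg_fin (f : R -> R) : pitg f ->
  (\int[mu]_(x in `]0%R, +oo[) (f x)%:E = (pint f)%:E)%E.
Proof.
move=> fi; rewrite /pint /Rintegral fineK//; apply: integrable_fin_num => //.
Qed.

Lemma pitg_exp (a : R) : 0 < a -> pitg (fun t => expR (- (a * t))).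
Proof.
move=> a0; have cf : continuous (fun t => expR (- (a * t))).
  move=> t; apply: (@continuous_comp _ _ _ (fun t => - (a * t)) expR); last exact: continuous_expR.
  apply: cvgN; apply: cvgM; [exact: cvg_cst|exact: cvg_id].
apply: pitg_ge0 => [x _|x _|]; [exact: cf|exact: expR_ge0|].
rewrite integral_itv_obnd_cbnd; last first.
  apply/measurable_EFinP; apply: measurable_funS (continuous_measurable_fun cf) => //.
have dF (t : R) : is_derive t (1:R) (fun t => - (a^-1 * expR (- (a * t)))) (expR (- (a * t))).
  have h : is_derive t (1:R) (fun t => - (a * t)) (- a).
    by apply: is_derive_eq; rewrite /GRing.scale /= mulr1.
  apply: is_derive_eq; rewrite /GRing.scale /=; by field; rewrite gt_eqF.
rewrite (@ge0_continuous_FTC2y _ _ (fun t => - (a^-1 * expR (- (a * t)))) _ 0).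
- by rewrite -EFinB ltry.
- by move=> *; exact: expR_ge0.
- exact: continuous_subspaceT.
- rewrite -[X in _ --> X]oppr0; apply: cvgN; rewrite -[X in _ --> X](mulr0 a^-1).
  apply: cvgM; first exact: cvg_cst.
  have h : (a * x) @[x --> +oo] --> +oo.
    by apply: gt0_cvgMry => //; exact: cvg_id.
  exact: (cvg_comp _ _ h (@cvgr_expR R)).
- by move=> x _; have [] := dF x.
- apply: cvg_at_right_filter; apply: (is_derive_cont dF).
- by move=> x _; rewrite (derive1_is dF).
Qed.

Lemma subst_exp_pint (c : R) G : 0 < c -> cpos G -> (forall x, 0 < x -> 0 <= G x) ->
  let H t := G (c * expR t) * (c * expR t) + G (c * expR (- t)) * (c * expR (- t)) in
  [/\ cpos H, pitg G <-> pitg H & pint G = pint H].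
Proof.
move=> c0 cG G0 H; have e := subst_exp c0 cG G0.
have cp t : 0 < c * expR t by rewrite mulr_gt0// expR_gt0.
have H0 t : 0 < t -> 0 <= H t.
  by move=> _; rewrite addr_ge0// mulr_ge0 ?G0//; exact: ltW.
have c1 : cpos (fun t => c * expR t).
  by apply: cposM; [exact: cst_cpos|apply: cpos_expR; exact: cpos_id].
have c2 : cpos (fun t => c * expR (- t)).
  by apply: cposM; [exact: cst_cpos|apply: cpos_expR; apply: cposN; exact: cpos_id].
have cH : cpos H.
  by apply: cposD; apply: cposM => //; apply: cpos_comp.
split => //; last by rewrite /pint /Rintegral e.
by split=> i; apply: pitg_ge0 => //; [rewrite -e|rewrite e]; rewrite pitg_fin ?ltry.
Qed.

End integrals.

(** * Beta and Gamma integrals *)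

Section weights.
Variable R : realType.

Lemma powRB1_mulr (x p : R) : 0 < x -> x `^ (p - 1) * x = x `^ p.
Proof.
move=> x0; rewrite -[in RHS](subrK 1 p) [RHS]powRD ?powRr1 ?ltW//.
by rewrite (gt_eqF x0) implybT.
Qed.

Lemma powR_expR (p t : R) : expR t `^ p = expR (p * t).
Proof. by rewrite -expRM mulrC. Qed.

(** After x = e^t both halves decay exponentially, at rates a and p. *)
Lemma pitg_beta (p a : R) : 0 < p -> 0 < a ->
  pitg (fun x => x `^ (p - 1) * (1 + x) `^ (- (p + a))).
Proof.
move=> p0 a0.
set G := fun x : R => _.
have cG : cpos G.
  apply: cposM; first exact: cpos_powR.
  apply: (@cpos_comp _ (fun x : R => 1 + x) (fun y => y `^ (- (p + a)))).
  - by apply: cposD; [exact: cst_cpos|exact: cpos_id].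
  - exact: cpos_powR.
  - by move=> x x0; rewrite addr_gt0.
have G0 x : 0 < x -> 0 <= G x by move=> _; rewrite mulr_ge0 ?powR_ge0.
have [cH GH _] := subst_exp_pint ltr01 cG G0; apply/GH.
have GE (t : R) : G (1 * expR t) * (1 * expR t) = expR (p * t) * (1 + expR t) `^ (- (p + a)).
  by rewrite /G mul1r mulrAC powRB1_mulr ?expR_gt0// powR_expR.
have le_pow (x y q : R) : 0 <= q -> 0 < x -> x <= y -> y `^ (- q) <= x `^ (- q).
  move=> q0 x0 xy; rewrite !powRN lef_pV2 ?posrE ?powR_gt0 ?(lt_le_trans x0 xy)//.
  by apply: ge0_ler_powR => //; rewrite nnegrE ltW // (lt_le_trans x0 xy).
have pa : 0 <= p + a by rewrite addr_ge0 ?ltW.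
apply: (@pitg_le _ _ (fun t => expR (- (a * t)) + expR (- (p * t)))).
- exact: cpos_meas.
- move=> t t0; rewrite !GE ger0_norm; last first.
    by rewrite addr_ge0// mulr_ge0 ?expR_ge0 ?powR_ge0.
  apply: lerD.
    apply: (@le_trans _ _ (expR (p * t) * expR t `^ (- (p + a)))).
      by rewrite ler_wpM2l ?expR_ge0// le_pow ?expR_gt0// lerDr.
    by rewrite powR_expR -expRD ler_expR; lra.
  rewrite mulrN -[leRHS]mulr1 ler_wpM2l ?expR_ge0//.
  have := le_pow 1 (1 + expR (- t)) (p + a) pa ltr01.
  by rewrite powR1; apply; rewrite lerDl expR_ge0.
- by apply: pitgD; exact: pitg_exp.
Qed.

Lemma powR_le_exp (q b : R) : 0 < q -> 0 < b ->
  exists2 C, 0 < C & forall x, 0 < x -> (1 + x) `^ q <= C * expR (b * x).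
Proof.
move=> q0 b0; exists ((b / q) `^ (- q) * expR b).
  by rewrite mulr_gt0 ?expR_gt0// powR_gt0// divr_gt0.
move=> x x0; have x1 : 0 < 1 + x by rewrite addr_gt0.
have m0 : 0 < b / q by rewrite divr_gt0.
have h : (b / q * (1 + x)) `^ q <= expR (b / q * (1 + x)) `^ q.
  apply: ge0_ler_powR; [exact: ltW| |exact: expR_ge0|].
    by rewrite nnegrE ltW// mulr_gt0.
  by rewrite (le_trans _ (expR_ge1Dx _))// lerDr.
move: h; rewrite (powRM _ (ltW m0) (ltW x1)) powR_expR => h; rewrite powRN -mulrA -expRD.
rewrite mulrC ler_pdivlMr ?powR_gt0// mulrC (le_trans h)// ler_expR.
by rewrite le_eqVlt; apply/orP; left; apply/eqP; field; rewrite gt_eqF.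
Qed.

Lemma pitg_gamma (p b : R) : 0 < p -> 0 < b ->
  pitg (fun x => x `^ (p - 1) * expR (- (b * x))).
Proof.
move=> p0 b0; have [C C0 hC] := @powR_le_exp (p + 1) b (addr_gt0 p0 ltr01) b0.
apply: pitg_le (pitgZ C (pitg_beta p0 ltr01)).
  apply: cpos_meas; apply: cposM; first exact: cpos_powR.
  apply: cpos_expR; apply: cposN; apply: cposM; [exact: cst_cpos|exact: cpos_id].
move=> x x0; rewrite ger0_norm ?mulr_ge0 ?powR_ge0 ?expR_ge0// mulrCA.
rewrite ler_wpM2l ?powR_ge0// powRN expRN.
have x1 : 0 < 1 + x by rewrite addr_gt0.
by rewrite ler_pdivlMr ?powR_gt0// mulrC ler_pdivrMr ?expR_gt0// hC.
Qed.

Lemma pint_indic_itv (c : R) (a b : R) : 0 < a -> a <= b ->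
  pitg (fun x => c * \1_(`[a, b]%classic : set R) x) /\
  pint (fun x => c * \1_(`[a, b]%classic : set R) x) = c * (b - a).
Proof.
move=> a0 ab.
have mI : measurable (`[a, b]%classic : set (measurableTypeR R)) by exact: measurable_itv.
have mD : measurable (`]0%R, +oo[%classic : set (measurableTypeR R)) by exact: measurable_itv.
have i : pitg (\1_(`[a, b]%classic : set R)).
  apply: (@integrableS _ _ _ _ setT) => //.
  exact: (integrable_indic_itv a b true false).
split; first exact: pitgZ.
rewrite pintZ//; congr (_ * _).
rewrite /pint /Rintegral integral_indic//.
rewrite (_ : _ `&` _ = `[a, b]%classic); last first.
  apply/seteqP; split => x; first by case.
  move=> h; split => //; move: h; rewrite /= !in_itv /= andbT => /andP[ax _].
  exact: lt_le_trans ax.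
have h := lebesgue_measure_itv `[a, b]; transitivity (fine (b - a)%:E) => //.
congr fine; apply: etrans h _.
rewrite /= lte_fin; case: ltP => // ba.
by have -> : a = b; [apply/le_anti; rewrite ab|rewrite subrr].
Qed.

(** Compare f with c times the indicator function of [a, b]. *)
Lemma pint_ge (f : R -> R) (c a b : R) : 0 < a -> a <= b -> pitg f ->
  (forall x, 0 < x -> 0 <= f x) -> (forall x, a <= x <= b -> c <= f x) ->
  c * (b - a) <= pint f.
Proof.
move=> a0 ab fi f0 fc; have [i <-] := pint_indic_itv c a0 ab.
apply: le_pint => // x x0; rewrite indicE.
have [h|] := boolP (x \in `[a, b]%classic); rewrite ?mulr0 ?mulr1; last by rewrite f0.
by apply: fc; move: h; rewrite inE /= in_itv.
Qed.

Lemma GammaE (a : R) : Gamma a = pint (fun x => x `^ (a - 1) * expR (- x)).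
Proof. by []. Qed.

Lemma pint_gamma (p b : R) : 0 < p -> 0 < b ->
  pint (fun x => x `^ (p - 1) * expR (- (b * x))) = b `^ (- p) * Gamma p.
Proof.
move=> p0 b0; rewrite GammaE.
have cG c : cpos (fun x : R => x `^ (p - 1) * expR (- (c * x))).
  apply: cposM; first exact: cpos_powR.
  apply: cpos_expR; apply: cposN; apply: cposM; [exact: cst_cpos|exact: cpos_id].
have G0 (c x : R) : 0 < x -> 0 <= x `^ (p - 1) * expR (- (c * x)).
  by move=> _; rewrite mulr_ge0 ?powR_ge0 ?expR_ge0.
have bV : 0 < b^-1 by rewrite invr_gt0.
rewrite [X in _ * X](@eq_pint _ _ (fun x => x `^ (p - 1) * expR (- (1 * x)))); last first.
  by move=> x _; rewrite mul1r.
have [_ _ ->] := subst_exp_pint bV (cG b) (G0 b).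
have [_ [h _] ->] := subst_exp_pint ltr01 (cG 1) (G0 1).
rewrite -pintZ; last by apply: h; exact: pitg_gamma.
apply: eq_pint => t _.
have e (u : R) : 0 < u -> (b^-1 * u) `^ (p - 1) * expR (- (b * (b^-1 * u))) * (b^-1 * u)
   = b `^ (- p) * ((1 * u) `^ (p - 1) * expR (- (1 * (1 * u))) * (1 * u)).
  move=> u0; rewrite !mul1r mulVKf ?gt_eqF//.
  rewrite mulrAC powRB1_mulr ?mulr_gt0// (powRM _ (ltW bV) (ltW u0)) -(powR_inv1 (ltW b0)) -powRrM mulN1r.
  by rewrite [X in _ = _ * X]mulrAC (powRB1_mulr p u0) mulrA.
by rewrite !e ?expR_gt0// mulrDr.
Qed.

Lemma Gamma_gt0 (a : R) : 0 < a -> 0 < Gamma a.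
Proof.
move=> a0; rewrite GammaE.
have i : pitg (fun x => x `^ (a - 1) * expR (- x)).
  by apply: eq_pitg (pitg_gamma a0 ltr01) => x _; rewrite mul1r.
have f0 (x : R) : 0 < x -> 0 <= x `^ (a - 1) * expR (- x).
  by move=> _; rewrite mulr_ge0 ?powR_ge0 ?expR_ge0.
set c := Num.min (2 `^ (a - 1)) 1 * expR (- 2).
have := @pint_ge _ c 1 2 ltr01 _ i f0 _.
have c0 : 0 < c by rewrite mulr_gt0 ?expR_gt0// lt_min ltr01 powR_gt0.
move=> h; apply: lt_le_trans (h _ _); [by rewrite mulr_gt0//; lra|by lra|].
move=> x /andP[x1 x2]; rewrite /c; apply: ler_pM;
  [by rewrite le_min ler01 powR_ge0|exact: expR_ge0| |by rewrite ler_expR lerN2].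
rewrite ge_min; have [a1|a1] := leP 1 a.
  by apply/orP; right; rewrite -[leLHS](powRr0 x) ler_powR// subr_ge0.
have x0 : 0 < x by lra.
apply/orP; left; rewrite -(opprB 1 a) !powRN lef_pV2 ?posrE ?powR_gt0//.
by apply: ge0_ler_powR => //; rewrite ?subr_ge0 ?nnegrE ltW.
Qed.

End weights.

(** * The Bessel integral and subordination *)

Section bessel.
Variable R : realType.
Notation mu := (@lebesgue_measure R).

Lemma cpos_scale (c : R) : cpos (fun x => c * x).
Proof. by apply: cposM; [exact: cst_cpos|exact: cpos_id]. Qed.

Lemma cpos_div (c : R) : cpos (fun x => c / x).
Proof. by apply: cposM; [exact: cst_cpos|exact: cpos_inv]. Qed.

Lemma cpos_gig (p b d : R) :
  cpos (fun x => x `^ (p - 1) * expR (- (b * x)) * expR (- (d / x))).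
Proof.
apply: cposM; first (apply: cposM; first exact: cpos_powR).
- by apply: cpos_expR; apply: cposN; exact: cpos_scale.
- by apply: cpos_expR; apply: cposN; exact: cpos_div.
Qed.

Lemma pitg_gig (p b d : R) : 0 < p -> 0 < b -> 0 <= d ->
  pitg (fun x => x `^ (p - 1) * expR (- (b * x)) * expR (- (d / x))).
Proof.
move=> p0 b0 d0; apply: pitg_le (pitg_gamma p0 b0).
  by apply: cpos_meas; exact: cpos_gig.
move=> x x0; rewrite ger0_norm ?mulr_ge0 ?powR_ge0 ?expR_ge0//.
by rewrite ler_piMr ?mulr_ge0 ?powR_ge0 ?expR_ge0// expR_le1 oppr_le0 divr_ge0 ?(ltW x0).
Qed.

(** With c = sqrt (d / b), the substitution x = c e^(+-t) makes the exponent
    symmetric, since b c = d / c: it becomes - y cosh t with y = 2 sqrt (b d). *)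
Lemma pint_bessel (p b d : R) : 0 < p -> 0 < b -> 0 < d ->
  pint (fun x => x `^ (p - 1) * expR (- (b * x)) * expR (- (d / x))) =
  2 * Num.sqrt (d / b) `^ p * besselK p (2 * Num.sqrt (b * d)).
Proof.
move=> p0 b0 d0; set c := Num.sqrt (d / b); set y := 2 * Num.sqrt (b * d).
have c0 : 0 < c by rewrite sqrtr_gt0 divr_gt0.
set G := fun x : R => _.
have G0 x : 0 < x -> 0 <= G x by move=> _; rewrite !mulr_ge0 ?powR_ge0 ?expR_ge0.
have [_ [h _] ->] := subst_exp_pint c0 (@cpos_gig p b d) G0.
have bc : b * c = y / 2.
  have -> : y / 2 = Num.sqrt (b * d) by rewrite /y mulrC mulKf.
  rewrite /c -{1}(ger0_norm (ltW b0)) -sqrtr_sqr -sqrtrM ?sqr_ge0//.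
  by congr Num.sqrt; field; rewrite gt_eqF.
have dc : d / c = y / 2.
  rewrite -bc; have c2 : c * c = d / b by rewrite -expr2 sqr_sqrtr// divr_ge0// ltW.
  apply: (mulIf (lt0r_neq0 c0)); rewrite divfK ?lt0r_neq0// -mulrA c2 mulrC divfK// lt0r_neq0 //.
have e (u v : R) : 0 < u -> v = u^-1 ->
    G (c * u) * (c * u) = c `^ p * (u `^ p * expR (- (y * ((u + v) / 2)))).
  move=> u0 vE; have cu : 0 < c * u by rewrite mulr_gt0.
  rewrite /G mulrAC [X in X * _ = _]mulrAC powRB1_mulr//.
  rewrite (powRM _ (ltW c0) (ltW u0)) -!mulrA -expRD; congr (_ * (_ * expR _)).
  have -> : d / (c * u) = d / c * v by rewrite vE -mulrA invfM.
  have -> : b * (c * u) = y / 2 * u by rewrite mulrA bc.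
  by rewrite dc /y; field.
have eH t : G (c * expR t) * (c * expR t) + G (c * expR (- t)) * (c * expR (- t))
    = 2 * c `^ p * (expR (- (y * cosh t)) * cosh (p * t)).
  have tN : expR t = (expR (- t))^-1 by rewrite expRN invrK.
  rewrite (e _ _ (expR_gt0 t) (expRN t)) (e _ _ (expR_gt0 (- t)) tN).
  by rewrite !powR_expR /cosh [expR (- t) + _]addrC mulrN; field.
have k0 : 2 * c `^ p != 0 by rewrite mulf_neq0// gt_eqF// powR_gt0.
transitivity (pint (fun t => 2 * c `^ p * (expR (- (y * cosh t)) * cosh (p * t)))).
  by apply: eq_pint => t _; exact: eH.
rewrite pintZ//.
apply: eq_pitg (pitgZ (2 * c `^ p)^-1 (h (pitg_gig p0 b0 (ltW d0)))) => t _.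
by rewrite eH mulKf.
Qed.

Lemma is_derive_sinh (s t : R) :
  is_derive t (1:R) (fun t => s * ((expR (t / 2) - expR (- (t / 2))) / 2)) (s * cosh (t / 2) / 2).
Proof.
apply: is_derive_eq; rewrite /GRing.scale /= /cosh; ring.
Qed.

(** The substitution u = sqrt (2 y) sinh (t / 2) turns the Gauss integral into
    this one, because 1 + 2 sinh(t/2)^2 = cosh t. *)
Lemma bessel_half (y : R) : 0 < y ->
  besselK (2^-1) y = Num.sqrt pi / Num.sqrt (2 * y) * expR (- y).
Proof.
move=> y0; set s := Num.sqrt (2 * y).
have s0 : 0 < s by rewrite sqrtr_gt0 mulr_gt0.
have s2 : s ^+ 2 = 2 * y by rewrite sqr_sqrtr// mulr_ge0// ltW.
have ch0 (t : R) : 0 <= cosh t by rewrite /cosh divr_ge0// addr_ge0// expR_ge0.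
have cosh_c : continuous (fun t : R => s * cosh (t / 2) / 2).
  move=> t; rewrite /cosh; apply: cvgM; last exact: cvg_cst.
  apply: cvgM; first exact: cvg_cst.
  apply: cvgM; last exact: cvg_cst.
  have c2 : continuous (fun t : R => t / 2) by move=> u; apply: cvgM; [exact: cvg_id|exact: cvg_cst].
  apply: cvgD.
    by apply: (@continuous_comp _ _ _ (fun t : R => t / 2) expR); [exact: c2|exact: continuous_expR].
  apply: (@continuous_comp _ _ _ (fun t : R => - (t / 2)) expR); last exact: continuous_expR.
  by apply: cvgN; exact: c2.
have sh_y (M : R) : exists n : nat,
    M <= s * ((expR (n%:R / 2) - expR (- (n%:R / 2))) / 2).
  have [n Mn] := expR_natr_ge (2 * `|M| / s + 1); exists (n * 2)%N.
  rewrite natrM mulfK// (le_trans (ler_norm _))// -ler_pdivrMl// ler_pdivlMr//.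
  rewrite lerBrDr (le_trans _ Mn)//.
  have -> : s^-1 * `|M| * 2 = 2 * `|M| / s by rewrite mulrC [s^-1 * _]mulrC mulrA.
  by rewrite lerD2l expR_le1 oppr_le0.
have gi := @integral0y_gauss R.
rewrite (subst_incr (is_derive_sinh s) cosh_c) in gi.
- pose H (t : R) := s / 2 * expR y * (expR (- (y * cosh t)) * cosh (2^-1 * t)).
  have ee (t : R) : gauss_fun (s * ((expR (t / 2) - expR (- (t / 2))) / 2)) * (s * cosh (t / 2) / 2)
     = H t.
    rewrite /H [2^-1 * t]mulrC /gauss_fun.
    have -> : - (s * ((expR (t / 2) - expR (- (t / 2))) / 2)) ^+ 2 = y - y * cosh t.
      have tE : t = t / 2 + t / 2 by field.
      rewrite exprMn s2 /cosh [in RHS]tE opprD !expRD.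
      have := expRxMexpNx_1 (t / 2).
      set E1 := expR (t / 2); set E2 := expR (- (t / 2)) => E12.
      have -> : 2 * y * ((E1 - E2) / 2) ^+ 2 = y * ((E1 * E1 + E2 * E2) / 2) - y * (E1 * E2) by field.
      by rewrite E12; ring.
    by rewrite expRD; ring.
  have cH : continuous H.
    have c1 : continuous (fun t : R => gauss_fun (s * ((expR (t / 2) - expR (- (t / 2))) / 2)) * (s * cosh (t / 2) / 2)).
      move=> t; apply: cvgM; last exact: cosh_c.
      apply: continuous_comp; last exact: continuous_gauss_fun.
      exact: (is_derive_cont (is_derive_sinh s)).
    by rewrite (_ : H = fun t => gauss_fun (s * ((expR (t / 2) - expR (- (t / 2))) / 2)) * (s * cosh (t / 2) / 2))//; apply/funext => t; rewrite ee.
  have H0 t : 0 <= H t by rewrite !mulr_ge0 ?expR_ge0// ltW.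
  have gi' : (\int[mu]_(t in `]0%R, +oo[) (H t)%:E = (Num.sqrt pi / 2)%:E)%E.
    rewrite -gi integral_itv_obnd_cbnd; first by apply: eq_integral => t _; rewrite ee.
    by apply/measurable_EFinP; apply: measurable_funS (continuous_measurable_fun cH).
  have iH : pitg H by apply: pitg_ge0 => [x _|//|]; [exact: cH|rewrite gi' ltry].
  have pH : pint H = Num.sqrt pi / 2 by rewrite /pint /Rintegral gi'.
  have k0 : s / 2 * expR y != 0 by rewrite !mulf_neq0 ?expR_eq0 ?lt0r_neq0.
  have iK : pitg (fun t => expR (- (y * cosh t)) * cosh (2^-1 * t)).
    by apply: eq_pitg (pitgZ (s / 2 * expR y)^-1 iH) => t _; rewrite /H mulKf.
  apply: (mulfI k0); rewrite -[LHS]pintZ// pH expRN; field.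
  by rewrite expR_eq0 lt0r_neq0.
- move=> x w x0 xw; rewrite ltr_pM2l// ltr_pM2r ?invr_gt0//.
  by rewrite ltrD// ?ltrN2 ltr_expR ?ltrN2 ltr_pM2r ?invr_gt0.
- by rewrite mul0r oppr0 subrr mul0r mulr0.
- exact: sh_y.
- by move=> x _; exact: continuous_gauss_fun.
- by move=> x _; exact: gauss_fun_ge0.
- by move=> t _; rewrite divr_ge0// mulr_ge0 ?ch0// ltW.
Qed.

Lemma subordination_gt0 (b d : R) : 0 < b -> 0 < d ->
  pint (fun t => t `^ (2^-1 - 1) * expR (- (b * t)) * expR (- (d / t)))
  = Num.sqrt (pi / b) * expR (- (2 * Num.sqrt (b * d))).
Proof.
move=> b0 d0; rewrite pint_bessel ?invr_gt0//.
have bd0 : 0 < Num.sqrt (b * d) by rewrite sqrtr_gt0 mulr_gt0.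
rewrite bessel_half ?mulr_gt0// powR12_sqrt ?sqrtr_ge0//.
rewrite !mulrA; congr (_ * _).
set q := Num.sqrt (b * d).
have -> : Num.sqrt (2 * 2 * q) = 2 * Num.sqrt q.
  by rewrite sqrtrM ?mulr_ge0// -expr2 sqrtr_sqr ger0_norm.
have qp : 0 < Num.sqrt q by rewrite sqrtr_gt0.
have bp : 0 < Num.sqrt b by rewrite sqrtr_gt0.
have -> : Num.sqrt (pi / b) = Num.sqrt pi / Num.sqrt b :> R.
  by rewrite sqrtrM ?pi_ge0// sqrtrV ?(ltW b0).
have -> : Num.sqrt (Num.sqrt (d / b)) = Num.sqrt q / Num.sqrt b.
  rewrite -sqrtrV ?(ltW b0)// -sqrtrM ?sqrtr_ge0//; congr Num.sqrt.
  rewrite /q -{3}(ger0_norm (ltW b0)) -sqrtr_sqr -sqrtrV ?sqr_ge0// -sqrtrM; last first.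
    by rewrite mulr_ge0 // ltW.
  by congr Num.sqrt; field; rewrite lt0r_neq0.
by field; rewrite !lt0r_neq0.
Qed.

Lemma cvgn_expR_comp (f : nat -> R) a : f n @[n --> \oo] --> a ->
  expR (f n) @[n --> \oo] --> expR a.
Proof. by move=> h; apply: continuous_cvg => //; exact: continuous_expR. Qed.

(** The kernel exp(- r |h|) is a mixture of Gaussian kernels.  The degenerate case
    d = 0 follows from d > 0 by continuity. *)
Lemma subordination (b d : R) : 0 < b -> 0 <= d ->
  pint (fun t => t `^ (2^-1 - 1) * expR (- (b * t)) * expR (- (d / t)))
  = Num.sqrt (pi / b) * expR (- (2 * Num.sqrt (b * d))).
Proof.
move=> b0; rewrite le_eqVlt => /predU1P[<-|]; last exact: subordination_gt0.
have h0 : (n.+1%:R^-1 : R) @[n --> \oo] --> (0 : R) by exact: cvg_harmonic.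
have p0 : 0 < 2^-1 :> R by rewrite invr_gt0.
have h1 : pint (fun t => t `^ (2^-1 - 1) * expR (- (b * t)) * expR (- (n.+1%:R^-1 / t)))
    @[n --> \oo] --> pint (fun t => t `^ (2^-1 - 1) * expR (- (b * t)) * expR (- (0 / t))).
  apply: pint_cvg (pitg_gamma p0 b0) _ => [n|x x0|n x x0].
  - by apply: cpos_meas; exact: cpos_gig.
  - apply: cvgM; first exact: cvg_cst.
    apply: cvgn_expR_comp.
    by apply: cvgN; apply: cvgM => //; exact: cvg_cst.
  - rewrite ger0_norm ?mulr_ge0 ?powR_ge0 ?expR_ge0//.
    rewrite ler_piMr ?mulr_ge0 ?powR_ge0 ?expR_ge0// expR_le1 oppr_le0.
    by rewrite divr_ge0 ?invr_ge0 ?(ltW x0).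
have h2 : pint (fun t => t `^ (2^-1 - 1) * expR (- (b * t)) * expR (- (n.+1%:R^-1 / t)))
    @[n --> \oo] --> Num.sqrt (pi / b) * expR (- (2 * Num.sqrt (b * 0))).
  under eq_cvg do rewrite subordination_gt0// ?invr_gt0//.
  apply: cvgM; first exact: cvg_cst.
  apply: cvgn_expR_comp.
  apply: cvgN; apply: cvgM; first exact: cvg_cst.
  apply: continuous_cvg => //; first exact: sqrt_continuous.
  by apply: cvgM => //; exact: cvg_cst.
exact: cvg_unique h1 h2.
Qed.

End bessel.

(** * Gaussian kernels on the line *)

Section gaussian_line.
Variable R : realType.
Notation mu := (@lebesgue_measure R).

Definition ritg (f : R -> R) := mu.-integrable setT (EFin \o f).
Definition rint (f : R -> R) : R := \int[mu]_(x in setT) f x.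

Lemma eq_ritg f g : f =1 g -> ritg f -> ritg g.
Proof. by move=> fg; apply: eq_integrable => // x _ /=; rewrite fg. Qed.

Lemma ritgZ a f : ritg f -> ritg (fun x => a * f x).
Proof.
move=> fi; have := integrableZl (@measurableT _ (measurableTypeR R)) a fi.
exact: eq_integrable.
Qed.

Lemma ritgD f g : ritg f -> ritg g -> ritg (fun x => f x + g x).
Proof.
move=> fi gi; have := integrableD (@measurableT _ (measurableTypeR R)) fi gi.
exact: eq_integrable.
Qed.

Lemma rintZ a f : ritg f -> rint (fun x => a * f x) = a * rint f.
Proof. by move=> fi; exact: RintegralZl. Qed.

Lemma rintD f g : ritg f -> ritg g ->
  rint (fun x => f x + g x) = rint f + rint g.
Proof. by move=> fi gi; exact: RintegralD. Qed.

Lemma eq_rint f g : f =1 g -> rint f = rint g.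
Proof. by move=> fg; apply: eq_Rintegral => x _; rewrite fg. Qed.

Lemma le_rint f g : ritg f -> ritg g -> (forall x, f x <= g x) ->
  rint f <= rint g.
Proof. by move=> fi gi fg; apply: le_Rintegral. Qed.

Lemma lin_rint (X : Type) (F : R -> X -> R) l :
  (forall x, ritg (fun t => F t x)) ->
  ritg (fun t => lin (F t) l) /\
  lin (fun x => rint (fun t => F t x)) l = rint (fun t => lin (F t) l).
Proof.
move=> Fi; exact: lin_integral.
Qed.

Lemma gauss_int (c m : R) : 0 < c ->
  ritg (fun y => expR (- (c * (y - m) ^+ 2))) /\
  rint (fun y => expR (- (c * (y - m) ^+ 2))) = Num.sqrt (pi / c).
Proof.
move=> c0; pose s := Num.sqrt (2 * c)^-1.
have s2 : s ^+ 2 = (2 * c)^-1 by rewrite sqr_sqrtr// invr_ge0 mulr_ge0// ltW.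
have s0 : s != 0 by rewrite gt_eqF// sqrtr_gt0 invr_gt0 mulr_gt0.
have q0 : Num.sqrt (pi / c) != 0.
  by rewrite gt_eqF// sqrtr_gt0 divr_gt0// pi_gt0.
have e y : normal_pdf m s y = (Num.sqrt (pi / c))^-1 * expR (- (c * (y - m) ^+ 2)).
  rewrite normal_pdfE// /normal_peak /normal_fun s2; congr (_^-1 * expR _).
    by congr Num.sqrt; rewrite -mulr_natr; field; rewrite gt_eqF.
  by rewrite -mulr_natr; field; rewrite gt_eqF.
have i : ritg (fun y => expR (- (c * (y - m) ^+ 2))).
  apply: (@eq_ritg (fun y => Num.sqrt (pi / c) * normal_pdf m s y)).
    by move=> y; rewrite e mulVKf.
  by apply: ritgZ; exact: integrable_normal_pdf.
split => //.
apply: (mulfI (invr_neq0 q0)); rewrite mulVf// -rintZ//.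
rewrite -(eq_rint e) /rint /Rintegral integral_normal_pdf//.
Qed.

Definition gauss_line (a : R) (u v : R) := expR (- (a * (u - v) ^+ 2)).

Lemma psd_gauss_line (a : R) : 0 <= a -> psd (gauss_line a).
Proof.
move=> a0; apply: (@psd_eq _ _ (fun i j => 1 * gauss a id i j)).
  by move=> u v; rewrite mul1r.
by apply: psd_gaussM => //; exact: psd1.
Qed.

Lemma gauss_line_sym (a u v : R) : gauss_line a u v = gauss_line a v u.
Proof. by rewrite /gauss_line -sqrrN opprB. Qed.

Lemma gauss_line_conv (b r h : R) : 0 < b -> 0 < r ->
  ritg (fun y => expR (- (r * y ^+ 2)) * expR (- (b * (h - y) ^+ 2))) /\
  rint (fun y => expR (- (r * y ^+ 2)) * expR (- (b * (h - y) ^+ 2)))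
  = Num.sqrt (pi / (b + r)) * expR (- (b * r / (b + r) * h ^+ 2)).
Proof.
move=> b0 r0; have br : 0 < b + r by rewrite addr_gt0.
have e y : expR (- (b * r / (b + r) * h ^+ 2)) * expR (- ((b + r) * (y - b * h / (b + r)) ^+ 2))
    = expR (- (r * y ^+ 2)) * expR (- (b * (h - y) ^+ 2)).
  by rewrite -!expRD; congr expR; field; rewrite gt_eqF.
have [i1 i2] := gauss_int (b * h / (b + r)) br.
split; first exact: eq_ritg e (ritgZ _ i1).
by rewrite -(eq_rint e) rintZ// i2 mulrC.
Qed.

(** A wide Gaussian is a narrower one convolved with a Gaussian density, hence an
    average of the translated kernels k(u, v + y).  A stationary form evaluated at
    a measure and at one of its translates is at most the form itself, by
    [bil_amgm], so averaging only costs the ratio of the normalizing constants. *)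
Lemma gauss_line_narrow (a b : R) : 0 < a -> a <= b ->
  kle (gauss_line a) (fun u v => Num.sqrt (b / a) * gauss_line b u v).
Proof.
move=> a0; rewrite le_eqVlt => /predU1P[<-|ab] l.
  by rewrite qfZ divff ?gt_eqF// sqrtr1 mul1r.
have b0 : 0 < b := lt_trans a0 ab.
set r := a * b / (b - a).
have ba : 0 < b - a by rewrite subr_gt0.
have r0 : 0 < r by rewrite divr_gt0// mulr_gt0.
have br : 0 < b + r by rewrite addr_gt0.
have brE : b + r = b ^+ 2 / (b - a) by rewrite /r; field; rewrite gt_eqF.
have rE : b * r / (b + r) = a by rewrite brE /r; field; rewrite !gt_eqF.
have e u v : gauss_line a u v = (Num.sqrt (pi / (b + r)))^-1 *
    rint (fun y => expR (- (r * y ^+ 2)) * gauss_line b u (v + y)).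
  rewrite (eq_rint (g := fun y => expR (- (r * y ^+ 2)) * expR (- (b * (u - v - y) ^+ 2)))); last first.
    by move=> y; rewrite /gauss_line opprD addrA.
  rewrite (gauss_line_conv (u - v) b0 r0).2 mulKf ?gt_eqF ?sqrtr_gt0 ?divr_gt0 ?pi_gt0//.
  by rewrite rE.
rewrite (eq_qf _ e) !qfZ ler_pdivrMl ?sqrtr_gt0 ?divr_gt0 ?pi_gt0//.
have i1 u v : ritg (fun y => expR (- (r * y ^+ 2)) * gauss_line b u (v + y)).
  apply: eq_ritg (gauss_line_conv (u - v) b0 r0).1 => y.
  by rewrite /gauss_line opprD addrA.
have i2 u := lin_rint l (i1 u).
have [i3 e3] := lin_rint l (fun u => (i2 u).1).
have -> : qf (fun u v => rint (fun y => expR (- (r * y ^+ 2)) * gauss_line b u (v + y))) l =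
    rint (fun t => lin (fun u => lin (fun v => expR (- (r * t ^+ 2)) * gauss_line b u (v + t)) l) l).
  by rewrite -e3; apply: eq_lin => u; rewrite (i2 u).2.
have ig : ritg (fun y => expR (- (r * y ^+ 2))).
  by apply: eq_ritg (gauss_int 0 r0).1 => y; rewrite subr0.
have gi : rint (fun y => expR (- (r * y ^+ 2))) = Num.sqrt (pi / r).
  by rewrite -(gauss_int 0 r0).2; apply: eq_rint => y; rewrite subr0.
apply: (@le_trans _ _ (rint (fun y => qf (gauss_line b) l * expR (- (r * y ^+ 2))))).
  apply: le_rint => //; first exact: ritgZ.
  move=> y; rewrite (@eq_lin _ _ _ (fun u => expR (- (r * y ^+ 2)) * lin (fun v => gauss_line b u (v + y)) l)); last first.
    by move=> u; rewrite linZ.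
  rewrite linZ mulrC ler_wpM2r ?expR_ge0//.
  have -> : lin (fun u => lin (fun v => gauss_line b u (v + y)) l) l = bil (gauss_line b) l (push (fun v => v + y) l).
    by apply: eq_lin => u; rewrite lin_push.
  have := bil_amgm l (push (fun v => v + y) l) (psd_gauss_line (ltW b0)) (gauss_line_sym b).
  rewrite qf_push (@eq_qf _ _ (fun u v => gauss_line b (u + y) (v + y)) (gauss_line b)).
    by lra.
  by move=> u v; rewrite /gauss_line opprD addrACA subrr addr0.
rewrite rintZ// gi mulrC mulrA.
suff -> : Num.sqrt (pi / (b + r)) * Num.sqrt (b / a) = Num.sqrt (pi / r) by [].
rewrite -sqrtrM; last by rewrite divr_ge0 ?pi_ge0// ltW.
by congr Num.sqrt; rewrite brE /r; field; rewrite !gt_eqF.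
Qed.

End gaussian_line.

(** * Exponential moments and signed translations *)

Section exponentials.
Variable R : realType.
Notation mu := (@lebesgue_measure R).
Implicit Types l : seq (R * R).

Definition shiftdiff (q y : R) l := l ++ scale (- q) (push (fun u => u + y) l).

Lemma lin_shiftdiff (q y c : R) l :
  lin (fun u => expR (c * u)) (shiftdiff q y l)
  = (1 - q * expR (c * y)) * lin (fun u => expR (c * u)) l.
Proof.
have e : lin ((fun u => expR (c * u)) \o (fun u => u + y)) l
    = expR (c * y) * lin (fun u => expR (c * u)) l.
  by rewrite -linZ; apply: eq_lin => u /=; rewrite -expRD; congr expR; ring.
by rewrite lin_cat lin_scale lin_push e; ring.
Qed.

Lemma supp_shiftdiff (B q y : R) l : (forall p, p \in l -> `|p.2| <= B) ->
  forall p, p \in shiftdiff q y l -> `|p.2| <= B + `|y|.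
Proof.
move=> h p; rewrite mem_cat => /orP[/h|]; first by move=> /le_trans; apply; rewrite lerDl.
move=> /mapP[p' /mapP[p'' /h pB ->] ->] /=.
by rewrite (le_trans (ler_normD _ _))// lerD2r.
Qed.

Lemma qf_shiftdiff (k : R -> R -> R) (q y : R) l : psd k ->
  (forall u v, k u v = k v u) -> (forall u v, k (u + y) (v + y) = k u v) ->
  0 <= q <= 1 -> qf k (shiftdiff q y l) <= 4 * qf k l.
Proof.
move=> kp ks kt /andP[q0 q1]; rewrite qf_cat// qf_scale bil_scaler.
have e : qf k (push (fun u => u + y) l) = qf k l by rewrite qf_push; apply: eq_qf.
have := bil_amgm (scale (-1) l) (push (fun u => u + y) l) kp ks.
rewrite bil_scalel e qf_scale sqrrN expr1n mul1r => h.
have l0 := kp l.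
have q2 : q ^+ 2 <= 1 by rewrite expr_le1.
rewrite sqrrN.
set b := bil _ _ _ in h *.
have h1 : - b <= qf k l by lra.
have h2 : q * (- b) <= q * qf k l by rewrite ler_wpM2l.
have h3 : q * qf k l <= qf k l by rewrite ler_piMl.
have h4 : q ^+ 2 * qf k l <= qf k l by rewrite ler_piMl.
rewrite mulNr mulrN -mulrN; lra.
Qed.

(** Each step multiplies the exponential moment of order c by
    (1 - q e^c) (1 - q e^-c); with q = e^-r it kills the moments of order r and
    - r.  The translations are by 1 and -1, so the support grows by at most 2. *)
Fixpoint annihilate (q : nat -> R) (n : nat) l :=
  if n is n'.+1 then shiftdiff (q n') 1 (shiftdiff (q n') (-1) (annihilate q n' l))
  else l.

Lemma lin_annihilate q n (c : R) l :
  lin (fun u => expR (c * u)) (annihilate q n l)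
  = (\prod_(j < n) ((1 - q j * expR c) * (1 - q j * expR (- c))))
    * lin (fun u => expR (c * u)) l.
Proof.
elim: n => [|n IH] /=; first by rewrite big_ord0 mul1r.
rewrite !lin_shiftdiff IH big_ord_recr /= mulr1 mulrN1 !mulrA; congr (_ * _).
by rewrite [RHS]mulrC !mulrA [RHS]mulrC !mulrA; ring.
Qed.

Lemma supp_annihilate (B : R) q n l : (forall p, p \in l -> `|p.2| <= B) ->
  forall p, p \in annihilate q n l -> `|p.2| <= B + 2 * n%:R.
Proof.
move=> h; elim: n => [|n IH] p /=; first by rewrite mulr0 addr0; exact: h.
have := supp_shiftdiff (supp_shiftdiff IH (y := -1) (q := q n)) (y := 1) (q := q n) (p := p).
move=> H /H /le_trans; apply; rewrite normrN1 normr1 -natr1; lra.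
Qed.

Lemma qf_annihilate (k : R -> R -> R) q n l : psd k ->
  (forall u v, k u v = k v u) -> (forall u v y, k (u + y) (v + y) = k u v) ->
  (forall j, 0 <= q j <= 1) -> qf k (annihilate q n l) <= 16 ^+ n * qf k l.
Proof.
move=> kp ks kt q01; elim: n => [|n IH] /=; first by rewrite mul1r.
rewrite (le_trans (qf_shiftdiff _ kp ks (fun u v => kt u v 1) (q01 n)))// exprS.
have := qf_shiftdiff (annihilate q n l) kp ks (fun u v => kt u v (-1)) (q01 n).
by move=> h; rewrite -mulrA; lra.
Qed.

Lemma int_exp (a x y : R) : a != 0 -> x <= y ->
  mu.-integrable `[x, y] (EFin \o (fun z => expR (a * z))) /\
  \int[mu]_(z in `[x, y]) expR (a * z) = (expR (a * y) - expR (a * x)) / a.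
Proof.
move=> a0 xy.
have dF (t : R) : is_derive t (1:R) (fun z => a^-1 * expR (a * z)) (expR (a * t)).
  by apply: is_derive_eq; rewrite /GRing.scale /= mulr1; field.
have de (t : R) : is_derive t (1:R) (fun z => expR (a * z)) (a * expR (a * t)).
  by apply: is_derive_eq; rewrite /GRing.scale /= mulr1 mulrC.
have ce : continuous (fun z => expR (a * z)) := is_derive_cont de.
split.
  apply: continuous_compact_integrable; first exact: segment_compact.
  exact: continuous_subspaceT.
move: xy; rewrite le_eqVlt => /predU1P[<-|xy].
  by rewrite set_itv1 Rintegral_set1 subrr mul0r.
rewrite /Rintegral (@continuous_FTC2 _ _ (fun z => a^-1 * expR (a * z)))//=; first by field.
- exact: continuous_subspaceT.
- exact: LR_cont dF.
- by move=> z _; rewrite (derive1_is dF).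
Qed.

(** Besides the transform of exp(- al |.|), integration over a bounded interval
    leaves two boundary terms; they depend on u only through exp(- al u) and
    exp(al u), which is why measures without these moments see none of them. *)
Lemma int_kernel (al c B u : R) : `|c| < al -> `|u| <= B ->
  mu.-integrable `[- B, B] (EFin \o (fun z => expR (- (al * `|u - z|)) * expR (c * z))) /\
  \int[mu]_(z in `[- B, B]) (expR (- (al * `|u - z|)) * expR (c * z))
  = 2 * al / (al ^+ 2 - c ^+ 2) * expR (c * u)
    - expR (- ((al + c) * B)) / (al + c) * expR (- al * u)
    - expR (- ((al - c) * B)) / (al - c) * expR (al * u).
Proof.
move=> cal; rewrite ler_norml => /andP[Bu uB].
have [ac1 ac2] : 0 < al + c /\ 0 < al - c.
  by move: cal; rewrite ltr_norml => /andP[]; lra.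
pose f z : R := expR (- (al * `|u - z|)) * expR (c * z).
have cf : continuous f.
  move=> z; rewrite /f; apply: cvgM.
    apply: continuous_cvg; first exact: continuous_expR.
    apply: cvgN; apply: cvgM; first exact: cvg_cst.
    by apply: cvg_norm; apply: cvgB; [exact: cvg_cst|exact: cvg_id].
  apply: continuous_cvg; first exact: continuous_expR.
  by apply: cvgM; [exact: cvg_cst|exact: cvg_id].
have fi : mu.-integrable `[- B, B] (EFin \o f).
  apply: continuous_compact_integrable; first exact: segment_compact.
  exact: continuous_subspaceT.
split => //.
have s := @Rintegral_itvB R f (BLeft (- B)) (BRight B) u fi.
rewrite !bnd_simp in s; move: {s}(s Bu uB) => s.
have fi2 : mu.-integrable `[u, B] (EFin \o f).
  apply: continuous_compact_integrable; first exact: segment_compact.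
  exact: continuous_subspaceT.
have fi3 : mu.-integrable `]u, B] (EFin \o f).
  apply: integrableS fi2 => //.
  by move=> z; rewrite /= !in_itv /= => /andP[/ltW -> ->].
rewrite Rintegral_itv_obnd_cbnd// in s.
rewrite -[LHS](subrK (\int[mu]_(z in `[- B, u]) f z)) s.
have -> : \int[mu]_(z in `[- B, u]) f z = expR (- al * u) * ((expR ((al + c) * u) - expR ((al + c) * (- B))) / (al + c)).
  have [i <-] := int_exp (lt0r_neq0 ac1) Bu.
  rewrite -RintegralZl//; apply: eq_Rintegral => z.
  rewrite inE /= in_itv /= => /andP[_ zu].
  by rewrite /f ger0_norm ?subr_ge0// -!expRD; congr expR; ring.
have -> : \int[mu]_(z in `[u, B]) f z = expR (al * u) * ((expR ((c - al) * B) - expR ((c - al) * u)) / (c - al)).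
  have ac3 : c - al != 0 by rewrite -opprB oppr_eq0 lt0r_neq0.
  have [i <-] := int_exp ac3 uB.
  rewrite -RintegralZl//; apply: eq_Rintegral => z.
  rewrite inE /= in_itv /= => /andP[uz _].
  by rewrite /f ler0_norm ?subr_le0// -!expRD; congr expR; ring.
have e1 : expR (- al * u) * expR ((al + c) * u) = expR (c * u) by rewrite -expRD; congr expR; ring.
have e2 : expR (al * u) * expR ((c - al) * u) = expR (c * u) by rewrite -expRD; congr expR; ring.
have -> : (al + c) * - B = - ((al + c) * B) by ring.
have -> : (c - al) * B = - ((al - c) * B) by ring.
rewrite !mulrA !mulrBr e1 e2.
have -> : al ^+ 2 - c ^+ 2 = (al + c) * (al - c) by ring.
field; rewrite (lt0r_neq0 ac1) (lt0r_neq0 ac2) -opprB oppr_eq0 lt0r_neq0//.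
Qed.

End exponentials.

(** * A gamma mixture of Gaussians above a finite sum of exponentials *)

Section key_one_dim.
Variables (R : realType) (th : R) (N : nat).
Hypothesis th0 : 0 < th.

Definition gamma_wt (q t : R) : R := t `^ (q - 1) * expR (- t).

Lemma pitg_gamma_wtM (q a d : R) : 0 < q -> 0 <= a -> 0 <= d ->
  pitg (fun t => gamma_wt q t * expR (- (a / t * d))).
Proof.
move=> q0 a0 d0; apply: eq_pitg (pitg_gig q0 ltr01 (mulr_ge0 a0 d0)) => t _.
by rewrite /gamma_wt mul1r [a / t * d]mulrAC.
Qed.

Definition gamma_mix (u v : R) := pint (fun t => gamma_wt (N%:R + 2^-1) t * gauss_line (th / t) u v).

(** For s >= 1 this weight is at most s^N times the gamma weight of exponent
    N + 1/2.  Its factor (1 - e^(-s t))^N vanishes to order N at 0, and its binomial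
    expansion makes the corresponding mixture a finite combination of exponentials
    by subordination. *)
Definition binom_wt (s t : R) : R := t `^ (2^-1 - 1) * expR (- (s * t)) * (1 - expR (- (s * t))) ^+ N.

Definition exp_mix (s u v : R) := pint (fun t => binom_wt s t * gauss_line (th / t) u v).

Definition exp_rate (s : R) (j : nat) := 2 * Num.sqrt (j.+1%:R * s * th).
Definition exp_coef (s : R) (j : nat) := (-1) ^+ j * 'C(N, j)%:R * Num.sqrt (pi / (j.+1%:R * s)).

Lemma binom_wt_ge0 s t : 0 < s -> 0 < t -> 0 <= binom_wt s t.
Proof.
move=> s0 t0; rewrite !mulr_ge0 ?powR_ge0 ?expR_ge0// exprn_ge0// subr_ge0.
by rewrite expR_le1 oppr_le0 mulr_ge0 ?(ltW s0) ?(ltW t0).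
Qed.

Lemma binom_wt_le s t : 1 <= s -> 0 < t -> binom_wt s t <= s ^+ N * gamma_wt (N%:R + 2^-1) t.
Proof.
move=> s1 t0; have s0 : 0 < s by lra.
have e : t `^ (N%:R + 2^-1 - 1) = t ^+ N * t `^ (2^-1 - 1).
  by rewrite -addrA powRD ?powR_mulrn ?(ltW t0)// (gt_eqF t0) implybT.
rewrite /binom_wt /gamma_wt e.
rewrite [leRHS](_ : _ = t `^ (2^-1 - 1) * expR (- t) * (s * t) ^+ N); last first.
  by rewrite exprMn; ring.
apply: ler_pM; rewrite ?mulr_ge0 ?powR_ge0 ?expR_ge0//.
- by rewrite exprn_ge0// subr_ge0 expR_le1 oppr_le0 mulr_ge0 ?(ltW s0) ?(ltW t0).
- by rewrite ler_wpM2l ?powR_ge0// ler_expR lerN2 ler_peMl ?(ltW t0).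
- apply: lerXn2r.
  + by rewrite nnegrE subr_ge0 expR_le1 oppr_le0 mulr_ge0 ?(ltW s0) ?(ltW t0).
  + by rewrite nnegrE mulr_ge0 ?(ltW s0) ?(ltW t0).
  + by have := expR_ge1Dx (- (s * t)); lra.
Qed.

Lemma pitg_gamma_mix u v : pitg (fun t => gamma_wt (N%:R + 2^-1) t * gauss_line (th / t) u v).
Proof. by apply: pitg_gamma_wtM; rewrite ?sqr_ge0 ?(ltW th0)// ltr_wpDl// invr_gt0. Qed.

Lemma binom_wt_expand s t d : binom_wt s t * expR (- (d / t)) =
  \sum_(j < N.+1) (-1) ^+ j * 'C(N, j)%:R *
    (t `^ (2^-1 - 1) * expR (- (j.+1%:R * s * t)) * expR (- (d / t))).
Proof.
rewrite /binom_wt exprBn mulr_sumr mulr_suml; apply: eq_bigr => j _.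
rewrite expr1n mulr1 -expRM_natr -mulr_natr.
have -> : expR (- (j.+1%:R * s * t)) = expR (- (s * t)) * expR (- (s * t) * j%:R).
  by rewrite -expRD; congr expR; rewrite -natr1; ring.
ring.
Qed.

Lemma pitg_exp_mix s u v : 0 < s -> pitg (fun t => binom_wt s t * gauss_line (th / t) u v).
Proof.
move=> s0; apply: (@eq_pitg _ (fun t => \sum_(j < N.+1) (-1) ^+ j * 'C(N, j)%:R *
    (t `^ (2^-1 - 1) * expR (- (j.+1%:R * s * t)) * expR (- (th * (u - v) ^+ 2 / t))))).
  by move=> t _; rewrite -binom_wt_expand /gauss_line [th / t * _]mulrAC.
apply: pitg_sum => j; apply: pitgZ; apply: pitg_gig; rewrite ?invr_gt0 ?mulr_gt0//.
by rewrite mulr_ge0 ?sqr_ge0 ?ltW.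
Qed.

(** Expand the binomial weight and apply subordination to each term. *)
Lemma exp_mixE s u v : 0 < s ->
  exp_mix s u v = \sum_(j < N.+1) exp_coef s j * expR (- (exp_rate s j * `|u - v|)).
Proof.
move=> s0; rewrite /exp_mix (eq_pint (g := fun t => \sum_(j < N.+1) (-1) ^+ j * 'C(N, j)%:R *
    (t `^ (2^-1 - 1) * expR (- (j.+1%:R * s * t)) * expR (- (th * (u - v) ^+ 2 / t))))); last first.
  by move=> t _; rewrite -binom_wt_expand /gauss_line [th / t * _]mulrAC.
have i j : pitg (fun t => t `^ (2^-1 - 1) * expR (- (j.+1%:R * s * t)) * expR (- (th * (u - v) ^+ 2 / t))).
  apply: pitg_gig; rewrite ?invr_gt0 ?mulr_gt0//.
  by rewrite mulr_ge0 ?sqr_ge0 ?ltW.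
rewrite pint_sum => [|j]; last exact: pitgZ.
apply: eq_bigr => j _; rewrite pintZ// subordination ?mulr_gt0//; last first.
  by rewrite mulr_ge0 ?sqr_ge0 ?ltW.
rewrite /exp_coef -[RHS]mulrA; congr (_ * (_ * expR (- _))).
rewrite /exp_rate -mulrA; congr (_ * _).
by rewrite mulrA sqrtrM ?sqrtr_sqr// !mulr_ge0 ?ltW.
Qed.

Lemma psd_pint (X : Type) (w : R -> R) (k : R -> X -> X -> R) :
  (forall t, 0 < t -> 0 <= w t) -> (forall t, 0 < t -> psd (k t)) ->
  (forall x y, pitg (fun t => w t * k t x y)) ->
  psd (fun x y => pint (fun t => w t * k t x y)).
Proof.
move=> w0 kp ki l; rewrite (qf_pint l ki).2; apply: pint_ge0 => t t0.
by rewrite mulr_ge0 ?w0//; exact: kp.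
Qed.

Lemma psd_exp_mix s : 0 < s -> psd (exp_mix s).
Proof.
move=> s0; apply: psd_pint => [t|t t0|u v].
- exact: binom_wt_ge0.
- by apply: psd_gauss_line; rewrite divr_ge0 ?ltW.
- exact: pitg_exp_mix.
Qed.

Lemma psd_gamma_mix : psd gamma_mix.
Proof.
apply: psd_pint => [t _|t t0|u v].
- by rewrite mulr_ge0 ?powR_ge0 ?expR_ge0.
- by apply: psd_gauss_line; rewrite divr_ge0 ?ltW.
- exact: pitg_gamma_mix.
Qed.

Lemma exp_mix_sym s u v : exp_mix s u v = exp_mix s v u.
Proof. by apply: eq_pint => t _; rewrite gauss_line_sym. Qed.

Lemma exp_mix_shift s u v y : exp_mix s (u + y) (v + y) = exp_mix s u v.
Proof. by apply: eq_pint => t _; rewrite /gauss_line opprD addrACA subrr addr0. Qed.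

Lemma kle_exp_mix s : 1 <= s -> kle (exp_mix s) (fun u v => s ^+ N * gamma_mix u v).
Proof.
move=> s1 l; have s0 : 0 < s by lra.
have [i1 e1] := qf_pint l (fun u v => pitg_exp_mix u v s0).
have [i2 e2] := qf_pint l pitg_gamma_mix.
rewrite qfZ e1 e2 -pintZ//; apply: le_pint => //; first exact: pitgZ.
move=> t t0; rewrite mulrA ler_wpM2r ?binom_wt_le//.
by apply: psd_gauss_line; rewrite divr_ge0 ?ltW.
Qed.

Lemma exp_mix_diag_le s u : 1 <= s -> exp_mix s u u <= s ^+ N * gamma_mix 0 0.
Proof.
move=> s1; have := kle_exp_mix s1 [:: (1, u)].
rewrite qfZ /qf /bil /lin !big_seq1 /= !mul1r => /le_trans; apply.
rewrite ler_wpM2l ?exprn_ge0//; first by lra.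
by rewrite le_eqVlt; apply/orP; left; apply/eqP/eq_pint => t _; rewrite /gauss_line !subrr.
Qed.

(** Partial fractions of n! / (x (x + 1) ... (x + n)); the induction uses
    Pascal's rule, which makes the sum at n + 1 the difference of the sums at n in
    x and x + 1. *)
Lemma beta_sum n (x : R) : 0 < x ->
  \sum_(j < n.+1) (-1) ^+ j * 'C(n, j)%:R / (x + j%:R) = n`!%:R / \prod_(i < n.+1) (x + i%:R).
Proof.
elim: n x => [|n IH] x x0.
  by rewrite !big_ord_recl !big_ord0 /= bin0 addr0 expr0 !mulr1 fact0.
have x1 : 0 < x + 1 by rewrite addr_gt0.
have pos (y : R) m : 0 < y -> 0 < \prod_(i < m) (y + i%:R).
  by move=> y0; apply: prodr_gt0 => i _; rewrite ltr_wpDr.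
have -> : \sum_(j < n.+2) (-1) ^+ j * 'C(n.+1, j)%:R / (x + j%:R) =
   \sum_(j < n.+1) (-1) ^+ j * 'C(n, j)%:R / (x + j%:R)
   - \sum_(j < n.+1) (-1) ^+ j * 'C(n, j)%:R / (x + 1 + j%:R).
  rewrite big_ord_recl [X in _ = X - _]big_ord_recl /= !bin0 -addrA; congr (_ + _).
  under eq_bigr => j _ do rewrite binS natrD mulrDr mulrDl.
  rewrite big_split /=; congr (_ + _).
    rewrite big_ord_recr /= bin_small// mulr0 mul0r addr0.
    by apply: eq_bigr.
  rewrite -sumrN; apply: eq_bigr => j _.
  by rewrite /bump /= add1n exprS -natr1; rewrite addrA addrAC; ring.
rewrite !IH// [X in _ / X - _]big_ord_recl [X in _ - _ / X]big_ord_recr.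
rewrite [X in _ = _ / X]big_ord_recl [X in _ = _ / (_ * X)]big_ord_recr /= addr0.
set P := \prod_(i < n) (x + (bump 0 i)%:R).
have -> : \prod_(i < n) (x + 1 + i%:R) = P.
  by apply: eq_bigr => i _; rewrite /bump add1n -natr1 addrA addrAC.
have P0 : 0 < P by apply: prodr_gt0 => i _; rewrite ltr_wpDr.
have xn : 0 < x + 1 + n%:R by rewrite ltr_wpDr.
have -> : x + (bump 0 n)%:R = x + 1 + n%:R by rewrite /bump add1n -natr1 addrA addrAC.
rewrite factS natrM -natr1.
by field; rewrite !gt_eqF.
Qed.

End key_one_dim.

(** * Exponential functionals are bounded by the gamma mixture *)

Section key_bound.
Variables (R : realType) (th : R) (N : nat) (B : R).
Hypothesis th0 : 0 < th.
Hypothesis B0 : 0 <= B.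
Notation mu := (@lebesgue_measure R).
Notation exp_rate := (exp_rate th).
Notation exp_mix := (exp_mix th N).
Notation gamma_mix := (gamma_mix th N).
Notation exp_coef := (exp_coef N).

Let B' := B + 2 * N.+1%:R.
Let q s j := expR (- exp_rate s j).

(** The bilateral transform of the kernel at the real argument c. *)
Definition exp_mix_hat (s c : R) := \sum_(j < N.+1) exp_coef s j * (2 * exp_rate s j / (exp_rate s j ^+ 2 - c ^+ 2)).

Lemma exp_rate_gt0 s j : 0 < s -> 0 < exp_rate s j.
Proof. by move=> s0; rewrite mulr_gt0// sqrtr_gt0 !mulr_gt0. Qed.

Lemma exp_rate_ge s j : 0 < s -> 2 * Num.sqrt (s * th) <= exp_rate s j.
Proof.
move=> s0; rewrite ler_wpM2l// ler_sqrt ?mulr_ge0 ?(ltW s0) ?(ltW th0)//.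
by rewrite -mulrA ler_peMl ?mulr_ge0 ?(ltW s0) ?(ltW th0)// ler1n.
Qed.

(** On a measure without exponential moments of the rates occurring in the
    kernel, the boundary terms of [int_kernel] vanish, and integration against
    exp(c z) multiplies the moment of order c by the transform of the kernel. *)
Lemma exp_mix_transform (s c : R) (A : seq (R * R)) : 0 < s -> (forall j, `|c| < exp_rate s j) ->
  (forall p, p \in A -> `|p.2| <= B') ->
  (forall j, (j < N.+1)%N -> lin (fun u => expR (- exp_rate s j * u)) A = 0) ->
  (forall j, (j < N.+1)%N -> lin (fun u => expR (exp_rate s j * u)) A = 0) ->
  mu.-integrable `[- B', B'] (EFin \o (fun z => expR (c * z) * lin (fun u => exp_mix s u z) A)) /\
  \int[mu]_(z in `[- B', B']) (expR (c * z) * lin (fun u => exp_mix s u z) A)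
  = exp_mix_hat s c * lin (fun u => expR (c * u)) A.
Proof.
move=> s0 cal sA a1 a2.
have mI : measurable (`[- B', B']%classic : set (measurableTypeR R)) by exact: measurable_itv.
(* points outside the support are moved to 0 so that the integral formula holds everywhere *)
pose cl (u : R) := if `|u| <= B' then u else 0.
have B'0 : 0 <= B' by rewrite addr_ge0// mulr_ge0.
have clB u : `|cl u| <= B' by rewrite /cl; case: ifP => // _; rewrite normr0.
have eqA (f g : R -> R) : (forall u, `|u| <= B' -> f u = g u) -> lin f A = lin g A.
  move=> fg; rewrite /lin big_seq [RHS]big_seq; apply: eq_bigr => p pA.
  by rewrite fg// sA.
pose F (j : nat) z u := expR (- (exp_rate s j * `|cl u - z|)) * expR (c * z).
have FI j u := int_kernel (cal j) (clB u).
have Fl (j : nat) := @lin_integral R _ R (F j) A mI (fun u => (FI j u).1).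
have eF z : expR (c * z) * lin (fun u => exp_mix s u z) A = \sum_(j < N.+1) exp_coef s j * lin (F j z) A.
  rewrite -linZ (eqA _ (fun u => \sum_(j < N.+1) exp_coef s j * F j z u)).
    by rewrite lin_sum; apply: eq_bigr => j _; rewrite linZ.
  move=> u uB; rewrite exp_mixE// mulr_sumr; apply: eq_bigr => j _.
  by rewrite /F /cl uB; ring.
have Fv (j : nat) : (j < N.+1)%N -> \int[mu]_(z in `[- B', B']) lin (F j z) A =
    2 * exp_rate s j / (exp_rate s j ^+ 2 - c ^+ 2) * lin (fun u => expR (c * u)) A.
  move=> jN; rewrite -(Fl j).2.
  rewrite (eqA _ (fun u => 2 * exp_rate s j / (exp_rate s j ^+ 2 - c ^+ 2) * expR (c * u)
    - expR (- ((exp_rate s j + c) * B')) / (exp_rate s j + c) * expR (- exp_rate s j * u)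
    - expR (- ((exp_rate s j - c) * B')) / (exp_rate s j - c) * expR (exp_rate s j * u))); last first.
    by move=> u uB; rewrite (FI j u).2 /cl uB.
  set p1 := 2 * _ / _; set p2 := _ / (exp_rate s j + c); set p3 := _ / (exp_rate s j - c).
  rewrite (linB (fun u => p1 * expR (c * u) - p2 * expR (- exp_rate s j * u)) (fun u => p3 * expR (exp_rate s j * u))).
  rewrite (linB (fun u => p1 * expR (c * u)) (fun u => p2 * expR (- exp_rate s j * u))).
  rewrite (linZ p1 (fun u => expR (c * u))) (linZ p2 (fun u => expR (- exp_rate s j * u))).
  by rewrite (linZ p3 (fun u => expR (exp_rate s j * u))) (a1 j jN) (a2 j jN) !mulr0 !subr0.
have iS (r : seq 'I_N.+1) :
   mu.-integrable `[- B', B'] (EFin \o (fun z => \sum_(j <- r) exp_coef s j * lin (F j z) A)) /\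
   \int[mu]_(z in `[- B', B']) (\sum_(j <- r) exp_coef s j * lin (F j z) A) =
   \sum_(j <- r) exp_coef s j * \int[mu]_(z in `[- B', B']) lin (F j z) A.
  elim: r => [|j r [IH1 IH2]].
    split.
      by apply: eq_integrable (integrable0 mu _) => // z _ /=; rewrite big_nil.
    rewrite big_nil /Rintegral (eq_integral (cst 0%E)) ?integral0// => z _ /=.
    by rewrite big_nil.
  have i1 : mu.-integrable `[- B', B'] (EFin \o (fun z => exp_coef s j * lin (F j z) A)).
    by have := integrableZl mI (exp_coef s j) (Fl j).1; exact: eq_integrable.
  split.
    have := integrableD mI i1 IH1; apply: eq_integrable => // z _ /=.
    by rewrite big_cons.
  rewrite big_cons -IH2 -RintegralZl//; last exact: (Fl j).1.
  by rewrite -RintegralD//; apply: eq_Rintegral => z _; rewrite big_cons.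
have [i1 i2] := iS (index_enum 'I_N.+1).
split; first by apply: eq_integrable i1 => // z _ /=; rewrite eF.
transitivity (\int[mu]_(z in `[- B', B']) (\sum_(j < N.+1) exp_coef s j * lin (F j z) A)).
  by apply: eq_Rintegral => z _; exact: eF.
rewrite i2 /exp_mix_hat mulr_suml; apply: eq_bigr => j _.
by rewrite Fv// mulrA.
Qed.

(** In terms of x = 1 - c^2 / (4 s th), which lies in (0, 1], the transform is a
    constant times the sum of [beta_sum]; its denominator is at most (N + 1)!. *)
Lemma exp_mix_hat_ge (s c : R) : 0 < s -> c ^+ 2 <= s * th ->
  Num.sqrt (pi / th) / s / N.+1%:R <= exp_mix_hat s c.
Proof.
move=> s0 cs.
have th1 : 0 < s * th by rewrite mulr_gt0.
set x := 1 - c ^+ 2 / (4 * s * th).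
have x1 : x <= 1 by rewrite gerBl divr_ge0 ?sqr_ge0// !mulr_ge0 ?ltW.
have x0 : 0 < x.
  rewrite subr_gt0 ltr_pdivrMr ?mulr_gt0// mul1r -mulrA; lra.
have e j : exp_coef s j * (2 * exp_rate s j / (exp_rate s j ^+ 2 - c ^+ 2)) =
    Num.sqrt (pi / th) / s * ((-1) ^+ j * 'C(N, j)%:R / (x + j%:R)).
  have xj : x + j%:R = (exp_rate s j ^+ 2 - c ^+ 2) / (4 * s * th).
    rewrite /exp_rate exprMn sqr_sqrtr ?mulr_ge0 ?(ltW s0) ?(ltW th0)// -natr1 /x.
    by field; rewrite !gt_eqF.
  have D0 : 0 < exp_rate s j ^+ 2 - c ^+ 2.
    have -> : exp_rate s j ^+ 2 - c ^+ 2 = (x + j%:R) * (4 * s * th).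
      by rewrite xj divfK// gt_eqF// !mulr_gt0.
    by rewrite !mulr_gt0// ltr_wpDr.
  rewrite xj /exp_coef.
  have ra : Num.sqrt (pi / (j.+1%:R * s)) * exp_rate s j = 2 * Num.sqrt (pi / th) * th.
    rewrite /exp_rate mulrCA -!mulrA; congr (_ * _).
    rewrite -sqrtrM ?divr_ge0 ?pi_ge0 ?mulr_ge0 ?(ltW s0)//.
    rewrite -{3}(ger0_norm (ltW th0)) -sqrtr_sqr -sqrtrM ?divr_ge0 ?pi_ge0 ?(ltW th0)//.
    by congr Num.sqrt; field; rewrite !gt_eqF.
  move: D0 ra; set D := _ - _; set r := Num.sqrt (pi / (_ * _)); set w := Num.sqrt _.
  move=> D0 ra; transitivity ((-1) ^+ j * 'C(N, j)%:R * (2 * (r * exp_rate s j)) / D).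
    by field; rewrite gt_eqF.
  by rewrite ra; field; rewrite !gt_eqF.
rewrite /exp_mix_hat; under eq_bigr => j _ do rewrite e.
rewrite -mulr_sumr beta_sum//.
rewrite ler_wpM2l ?divr_ge0 ?sqrtr_ge0 ?(ltW s0)//.
have P0 : 0 < \prod_(i < N.+1) (x + i%:R) by apply: prodr_gt0 => i _; rewrite ltr_wpDr.
rewrite ler_pdivlMr// mulrC ler_pdivrMr// -natrM mulnC -factS.
have -> : (N.+1)`!%:R = \prod_(i < N.+1) (1 + i%:R) :> R.
  elim: (N.+1) => [|m IH]; first by rewrite big_ord0 fact0.
  by rewrite big_ord_recr /= -IH factS natrM mulrC nat1r.
by apply: ler_prod => i _; rewrite addr_ge0 ?(ltW x0)//= lerD2r.
Qed.

Lemma sqr_le_exp (x : R) : 0 <= x -> x ^+ 2 <= 2 * expR x.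
Proof.
move=> x0; have := expR_ge1Dxn 1 x0.
rewrite (_ : 2`!%:R = 2 :> R)// => h; rewrite -ler_pdivrMl// mulrC.
by apply: le_trans h; rewrite lerDr.
Qed.

Lemma lin_annihilate_eq0 (q0 : nat -> R) n j a l : (j < n)%N -> q0 j * expR a = 1 ->
  lin (fun u => expR (a * u)) (annihilate q0 n l) = 0 /\
  lin (fun u => expR (- a * u)) (annihilate q0 n l) = 0.
Proof.
move=> jn e; split.
  by rewrite lin_annihilate (bigD1 (Ordinal jn))//= e subrr !mul0r.
by rewrite lin_annihilate (bigD1 (Ordinal jn))//= opprK e subrr mulr0 !mul0r.
Qed.

(** The rates are tuned to c by s = 1 + c^2 / th, so that all of them exceed |c|.
    Kill the moments of l at these rates; the resulting measure A has moment of
    order c equal to that of l times a product bounded away from 0.  Integrating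
    the kernel potential of A, which Cauchy-Schwarz bounds by the form at A,
    against exp(c z) recovers this moment by [exp_mix_transform].  All losses are
    powers of s, hence at most exponential in |c|. *)
Lemma exp_le_gamma_mix : exists C K : R, [/\ 0 <= C, 0 <= K &
  forall (c : R) (l : seq (R * R)), (forall p, p \in l -> `|p.2| <= B) ->
    lin (fun u => expR (c * u)) l ^+ 2 <= C * expR (K * `|c|) * qf gamma_mix l].
Proof.
have B'0 : 0 <= B' by rewrite addr_ge0// mulr_ge0.
have k00 : 0 <= gamma_mix 0 0.
  apply: pint_ge0 => t _; rewrite mulr_ge0 ?expR_ge0//.
  by rewrite mulr_ge0 ?powR_ge0 ?expR_ge0.
set k0 := Num.sqrt (pi / th) / N.+1%:R.
have k0p : 0 < k0 by rewrite divr_gt0// sqrtr_gt0 divr_gt0// pi_gt0.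
set e0 := expR (- Num.sqrt th).
have e01 : 0 < 1 - e0 by rewrite subr_gt0 expR_lt1 oppr_lt0 sqrtr_gt0.
set p0 := ((1 - e0) ^+ 2) ^+ N.+1.
have p0p : 0 < p0 by rewrite !exprn_gt0.
exists ((2 * B') ^+ 2 * 16 ^+ N.+1 * gamma_mix 0 0 * (1 + 2 / th) ^+ (2 * N.+1) / (k0 * p0) ^+ 2).
exists (2 * B' + (2 * N.+1)%:R).
have thV : 0 <= 2 / th by rewrite divr_ge0 ?(ltW th0).
split; first by rewrite divr_ge0 ?sqr_ge0// !mulr_ge0 ?sqr_ge0 ?exprn_ge0// addr_ge0.
  by rewrite addr_ge0// mulr_ge0.
move=> c l lB; set s := 1 + c ^+ 2 / th.
have s1 : 1 <= s by rewrite lerDl divr_ge0 ?sqr_ge0 ?(ltW th0).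
have s0 : 0 < s by lra.
have sth : s * th = th + c ^+ 2 by rewrite /s; field; rewrite gt_eqF.
have csth : `|c| <= Num.sqrt (s * th).
  by rewrite -sqrtr_sqr ler_wsqrtr// sth lerDr ltW.
have sq0 : 0 < Num.sqrt (s * th) by rewrite sqrtr_gt0 mulr_gt0.
have cal j : `|c| < exp_rate s j.
  by apply: le_lt_trans csth _; apply: lt_le_trans (exp_rate_ge j s0); lra.
set A := annihilate (q s) N.+1 l.
have sA p : p \in A -> `|p.2| <= B' := @supp_annihilate R B (q s) N.+1 l lB p.
have qe j : q s j * expR (exp_rate s j) = 1 by rewrite -expRD addNr expR0.
have a1 j : (j < N.+1)%N -> lin (fun u => expR (- exp_rate s j * u)) A = 0.
  by move=> jN; have [] := lin_annihilate_eq0 l jN (qe j).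
have a2 j : (j < N.+1)%N -> lin (fun u => expR (exp_rate s j * u)) A = 0.
  by move=> jN; have [] := lin_annihilate_eq0 l jN (qe j).
have [Ii Ie] := exp_mix_transform s0 cal sA a1 a2.
set lc := lin _ l; set Q := qf gamma_mix l.
have Q0 : 0 <= Q := psd_gamma_mix N th0 l.
have q01 j : 0 <= q s j <= 1.
  by rewrite expR_ge0 expR_le1 oppr_le0 ltW// exp_rate_gt0.
have QA : qf (exp_mix s) A <= 16 ^+ N.+1 * (s ^+ N * Q).
  apply: le_trans (qf_annihilate N.+1 l (psd_exp_mix N th0 s0) (exp_mix_sym th N s) _ q01) _.
    by move=> u v y; exact: exp_mix_shift.
  by rewrite ler_wpM2l ?exprn_ge0//; have := kle_exp_mix N th0 s1 l; rewrite qfZ.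
set M := expR (`|c| * B') * Num.sqrt (16 ^+ N.+1 * (s ^+ N * Q) * (s ^+ N * gamma_mix 0 0)).
have M0 : 0 <= M by rewrite mulr_ge0 ?expR_ge0 ?sqrtr_ge0.
have bnd z : - B' <= z <= B' -> `|expR (c * z) * lin (fun u => exp_mix s u z) A| <= M.
  move=> zB; rewrite normrM ger0_norm ?expR_ge0//; apply: ler_pM; rewrite ?expR_ge0 ?normr_ge0//.
    rewrite ler_expR (le_trans (ler_norm _))// normrM ler_wpM2l ?normr_ge0//.
    by rewrite ler_norml.
  rewrite -sqrtr_sqr ler_wsqrtr//.
  have -> : lin (fun u => exp_mix s u z) A = bil (exp_mix s) A [:: (1, z)].
    by apply: eq_lin => u; rewrite lin_cons lin_nil mul1r addr0.
  apply: le_trans (bil_CS A [:: (1, z)] (psd_exp_mix N th0 s0) (exp_mix_sym th N s)) _.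
  apply: ler_pM => //; try exact: psd_exp_mix.
  rewrite /qf /bil !lin_cons !lin_nil !mul1r !addr0; exact: exp_mix_diag_le.
have Ib : `|exp_mix_hat s c * lin (fun u => expR (c * u)) A| <= M * (2 * B').
  rewrite -Ie.
  have mI : measurable (`[- B', B']%classic : set (measurableTypeR R)) by exact: measurable_itv.
  apply: le_trans (le_normr_Rintegral mI Ii) _.
  have BB : (- B' <= B') by lra.
  have muI : mu `[- B', B']%classic = (2 * B')%:E.
    have h := lebesgue_measure_itv `[- B', B']; apply: etrans h _.
    rewrite /= lte_fin; case: ltP => hB; first by rewrite -EFinD; congr EFin; ring.
    have -> : B' = 0 by lra.
    by rewrite mulr0.
  rewrite [leRHS](_ : _ = \int[mu]_(z in `[- B', B']) M); last first.
    by rewrite Rintegral_cst//; congr (_ * _); rewrite -[LHS]/(fine (2 * B')%:E) -muI.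
  apply: le_Rintegral => //.
  - by apply: integrable_norm.
  - apply: measurable_bounded_integrable => //.
      by rewrite -[X in (X < _)%E]/(mu `[- B', B']%classic) muI ltry.
    exists M; split; first exact: num_real.
    by move=> x Mx z _ /=; rewrite ger0_norm// ltW.
have Ae : lin (fun u => expR (c * u)) A = \prod_(j < N.+1) ((1 - q s j * expR c) * (1 - q s j * expR (- c))) * lc.
  exact: lin_annihilate.
set P := \prod_(j < N.+1) _ in Ae.
have Pp : p0 <= P.
  rewrite /p0 /P -[X in _ ^+ X](card_ord N.+1) -prodr_const; apply: ler_prod => j _.
  rewrite sqr_ge0/= expr2.
  have qc (c' : R) : `|c'| = `|c| -> 1 - e0 <= 1 - q s j * expR c'.
    move=> cc; rewrite lerD2l lerN2 -expRD ler_expR.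
    have := exp_rate_ge j s0; have := ler_norm c'; rewrite cc.
    have : Num.sqrt th <= Num.sqrt (s * th).
      by rewrite ler_wsqrtr// sth lerDl sqr_ge0.
    lra.
  by apply: ler_pM; rewrite ?(ltW e01)//; apply: qc; rewrite ?normrN.
have kh : k0 / s <= exp_mix_hat s c.
  apply: le_trans (@exp_mix_hat_ge s c s0 _); last by rewrite sth lerDr ltW.
  by rewrite /k0 mulrAC.
have lcb : k0 / s * p0 * `|lc| <= M * (2 * B').
  apply: le_trans Ib; rewrite Ae mulrA normrM ler_wpM2r ?normr_ge0//.
  apply: le_trans (ler_norm _); apply: ler_pM => //; first by rewrite divr_ge0 ?ltW.
  exact: ltW.
have lcb2 : (k0 / s * p0) ^+ 2 * lc ^+ 2 <= M ^+ 2 * (2 * B') ^+ 2.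
  rewrite -(real_normK (num_real lc)) -!exprMn; apply: lerXn2r => //.
  - by rewrite nnegrE !mulr_ge0 ?normr_ge0 ?invr_ge0 ?(ltW s0) ?(ltW k0p) ?(ltW p0p).
  - by rewrite nnegrE mulr_ge0// mulr_ge0.
have M2 : M ^+ 2 = expR (2 * B' * `|c|) * (16 ^+ N.+1 * gamma_mix 0 0 * s ^+ (2 * N) * Q).
  rewrite /M exprMn sqr_sqrtr; last first.
    by rewrite !mulr_ge0 ?exprn_ge0 ?(ltW s0).
  rewrite -expRM_natl mulr_natl; congr (expR _ * _); first by rewrite -mulr_natl; ring.
  by rewrite mulnC exprM; ring.
have sb : s <= (1 + 2 / th) * expR `|c|.
  rewrite /s mulrDl mul1r; apply: lerD.
    by have := expR_ge1Dx `|c|; have := normr_ge0 c; lra.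
  have -> : 2 / th * expR `|c| = (2 * expR `|c|) / th by ring.
  apply: ler_wpM2r; first by rewrite invr_ge0 (ltW th0).
  by rewrite -(real_normK (num_real c)); exact: sqr_le_exp.
have sb2 : s ^+ (2 * N.+1) <= (1 + 2 / th) ^+ (2 * N.+1) * expR ((2 * N.+1)%:R * `|c|).
  rewrite expRM_natl -exprMn lerXn2r// nnegrE ?(ltW s0)//.
  by rewrite mulr_ge0 ?expR_ge0// addr_ge0.
have e2 : lc ^+ 2 <= (2 * B') ^+ 2 * 16 ^+ N.+1 * gamma_mix 0 0 / (k0 * p0) ^+ 2 * expR (2 * B' * `|c|) * Q * s ^+ (2 * N.+1).
  move: lcb2; rewrite M2.
  have kp : 0 < (k0 / s * p0) ^+ 2 by rewrite exprn_gt0// mulr_gt0// divr_gt0.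
  rewrite mulrC -ler_pdivlMr// => /le_trans; apply.
  rewrite le_eqVlt; apply/orP; left; apply/eqP.
  rewrite mulnS exprD !exprMn; move: (s ^+ (2 * N)) => s2N.
  field; rewrite (lt0r_neq0 p0p) (lt0r_neq0 s0) nat1r pnatr_eq0 /= andbT.
  by rewrite gt_eqF// sqrtr_gt0 divr_gt0// pi_gt0.
apply: le_trans e2 _.
have -> : (2 * B' + (2 * N.+1)%:R) * `|c| = 2 * B' * `|c| + (2 * N.+1)%:R * `|c| by ring.
rewrite expRD.
rewrite [leRHS](_ : _ = (2 * B') ^+ 2 * 16 ^+ N.+1 * gamma_mix 0 0 / (k0 * p0) ^+ 2 * expR (2 * B' * `|c|) * Q
  * ((1 + 2 / th) ^+ (2 * N.+1) * expR ((2 * N.+1)%:R * `|c|))); last by ring.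
by rewrite ler_wpM2l// !mulr_ge0 ?invr_ge0 ?sqr_ge0 ?exprn_ge0 ?expR_ge0// mulr_ge0 ?(ltW k0p) ?(ltW p0p).
Qed.

(** exp(b u^2) is the mean of exp(c u) over a centred Gaussian c, and the
    exponential growth in |c| of the previous bound is integrable against it. *)
Lemma expsq_le_gamma_mix (b1 : R) : exists C : R, 0 <= C /\
  forall (b : R) (l : seq (R * R)), 0 < b -> b <= b1 ->
    (forall p, p \in l -> `|p.2| <= B) ->
    lin (fun u => expR (b * u ^+ 2)) l ^+ 2 <= C * qf gamma_mix l.
Proof.
have [C [K [C0 K0 H]]] := exp_le_gamma_mix.
exists (4 * C * expR (b1 * K ^+ 2 / 2)); split; first by rewrite !mulr_ge0 ?expR_ge0.
move=> b l b0 bb lB; set Q := qf gamma_mix l.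
have Q0 : 0 <= Q := psd_gamma_mix N th0 l.
have f0 : 0 < (4 * b)^-1 by rewrite invr_gt0 mulr_gt0.
have G (u : R) : ritg (fun c => expR (c * u) * expR (- ((4 * b)^-1 * c ^+ 2))) /\
   rint (fun c => expR (c * u) * expR (- ((4 * b)^-1 * c ^+ 2)))
   = Num.sqrt (pi / (4 * b)^-1) * expR (b * u ^+ 2).
  have [i1 i2] := gauss_int (2 * b * u) f0.
  have e c : expR (b * u ^+ 2) * expR (- ((4 * b)^-1 * (c - 2 * b * u) ^+ 2)) =
      expR (c * u) * expR (- ((4 * b)^-1 * c ^+ 2)).
    by rewrite -!expRD; congr expR; field; rewrite gt_eqF.
  split; first exact: eq_ritg e (ritgZ _ i1).
  by rewrite -(eq_rint e) rintZ// i2 mulrC.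
set w := Num.sqrt _ in G.
have w0 : 0 < w by rewrite sqrtr_gt0 divr_gt0// pi_gt0.
have [i1 e1] := lin_rint l (fun u => (G u).1).
set f := fun c => lin _ l in i1 e1.
have e1' : rint f = w * lin (fun u => expR (b * u ^+ 2)) l.
  by rewrite -linZ -e1; apply: eq_lin => u; rewrite (G u).2.
(* exp (k |c|) is at most exp (k c) + exp (- k c), whose Gaussian mean is known *)
pose k := K / 2.
pose g c := Num.sqrt (C * Q) * (expR (c * k) * expR (- ((4 * b)^-1 * c ^+ 2))
  + expR (c * - k) * expR (- ((4 * b)^-1 * c ^+ 2))).
have gs : ritg (fun c => expR (c * k) * expR (- ((4 * b)^-1 * c ^+ 2))
    + expR (c * - k) * expR (- ((4 * b)^-1 * c ^+ 2))).
  exact: (ritgD (G k).1 (G (- k)).1).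
have gi : ritg g by exact: ritgZ.
have ge : rint g = w * (Num.sqrt (C * Q) * 2 * expR (b * k ^+ 2)).
  rewrite rintZ// (rintD (G k).1 (G (- k)).1) (G k).2 (G (- k)).2 sqrrN; ring.
have fg c : `|f c| <= g c.
  have -> : f c = expR (- ((4 * b)^-1 * c ^+ 2)) * lin (fun u => expR (c * u)) l.
    by rewrite /f -linZ; apply: eq_lin => u; rewrite mulrC.
  rewrite normrM ger0_norm ?expR_ge0//.
  have -> : g c = expR (- ((4 * b)^-1 * c ^+ 2)) * (Num.sqrt (C * Q) * (expR (c * k) + expR (c * - k))).
    by rewrite /g; ring.
  apply: ler_wpM2l; first exact: expR_ge0.
  rewrite -sqrtr_sqr; apply: (@le_trans _ _ (Num.sqrt (C * Q) * expR (k * `|c|))).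
    rewrite -[X in _ * X](ger0_norm (expR_ge0 _)) -sqrtr_sqr -sqrtrM ?mulr_ge0//.
    rewrite ler_wsqrtr// (le_trans (H c l lB))//.
    have -> : expR (k * `|c|) ^+ 2 = expR (K * `|c|).
      by rewrite -expRM_natl; congr expR; rewrite /k; field.
    by rewrite mulrAC.
  rewrite ler_wpM2l ?sqrtr_ge0//; case: (ger0P c) => _.
    by rewrite mulrC lerDl expR_ge0.
  by rewrite [k * _]mulrC mulrN mulNr lerDr expR_ge0.
have h1 : rint f <= rint g by apply: le_rint => // c; exact: le_trans (ler_norm _) (fg c).
have h2 : - rint f <= rint g.
  rewrite -mulN1r -rintZ//; apply: le_rint => //; first exact: ritgZ.
  by move=> c; rewrite mulN1r; apply: le_trans (fg c); rewrite -normrN ler_norm.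
have h3 : `|lin (fun u => expR (b * u ^+ 2)) l| <= Num.sqrt (C * Q) * 2 * expR (b * k ^+ 2).
  rewrite -(ler_pM2l w0) -ge -{1}(gtr0_norm w0) -normrM -e1' ler_norml h1 andbT.
  by rewrite lerNl.
rewrite -(real_normK (num_real (lin _ _))).
apply: (@le_trans _ _ ((Num.sqrt (C * Q) * 2 * expR (b * k ^+ 2)) ^+ 2)).
  apply: lerXn2r => //.
  by rewrite nnegrE mulr_ge0 ?expR_ge0// mulr_ge0 ?sqrtr_ge0.
rewrite !exprMn sqr_sqrtr ?mulr_ge0// -expRM_natl.
rewrite [leLHS](_ : _ = 4 * C * expR (b * K ^+ 2 / 2) * Q); last first.
  by rewrite [2 * (b * _)](_ : _ = b * K ^+ 2 / 2); [ring|field].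
apply: ler_wpM2r => //; apply: ler_wpM2l; first by rewrite mulr_ge0.
by rewrite ler_expR ler_pM2r ?invr_gt0//; apply: ler_wpM2r; rewrite ?sqr_ge0.
Qed.

End key_bound.

(** * Tensor products *)

Section tensor.
Variables (R : realType) (th : R) (N : nat).
Hypothesis th0 : 0 < th.

Lemma kle_trans (X : Type) (k1 k2 k3 : X -> X -> R) : kle k1 k2 -> kle k2 k3 -> kle k1 k3.
Proof. by move=> h1 h2 l; exact: le_trans (h1 l) (h2 l). Qed.

Lemma kle_eq (X : Type) (k1 k2 : X -> X -> R) : (forall i j, k1 i j = k2 i j) -> kle k1 k2.
Proof. by move=> e l; rewrite (eq_qf l e). Qed.

Lemma kleZ (X : Type) (a : R) (k1 k2 : X -> X -> R) : 0 <= a -> kle k1 k2 ->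
  kle (fun i j => a * k1 i j) (fun i j => a * k2 i j).
Proof. by move=> a0 h l; rewrite !qfZ ler_wpM2l. Qed.

Lemma gauss_narrow (X : Type) (x : X -> R) (a b : R) : 0 < a -> a <= b ->
  kle (gauss a x) (fun i j => Num.sqrt (b / a) * gauss b x i j).
Proof.
move=> a0 ab l; have := gauss_line_narrow a0 ab (push x l).
by rewrite !qf_push.
Qed.

Lemma gaussL_narrow (I X : Type) (L : seq I) (x : I -> X -> R) (a b : R) :
  0 < a -> a <= b ->
  kle (gaussL a L x) (fun i j => (b / a) `^ ((size L)%:R / 2) * gaussL b L x i j).
Proof.
move=> a0 ab; have b0 : 0 < b by exact: lt_le_trans ab.
elim: L => [|c L IH] /=.
  by apply: kle_eq => i j; rewrite !gaussL_nil mul0r powRr0 mul1r.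
apply: (@kle_trans _ _ (fun i j => (b / a) `^ ((size L)%:R / 2) * gaussL b L x i j * gauss a (x c) i j)).
  apply: kle_trans (kle_gaussM (x c) (ltW a0) IH).
  by apply: kle_eq => i j; rewrite gaussL_cons.
apply: (@kle_trans _ _ (fun i j => (b / a) `^ ((size L)%:R / 2) * (gauss a (x c) i j * gaussL b L x i j))).
  by apply: kle_eq => i j; ring.
apply: kle_trans (kleZ (powR_ge0 _ _) (kle_gaussLM L x (ltW b0) (gauss_narrow (x c) a0 ab))) _.
apply: kle_eq => i j; rewrite gaussL_cons -[(size L).+1%:R]natr1 mulrDl powRD; last first.
  by rewrite (gt_eqF (_ : 0 < b / a)) ?divr_gt0// implybT.
by rewrite mul1r powR12_sqrt ?divr_ge0 ?(ltW a0) ?(ltW b0)//; ring.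
Qed.

(** Two Gaussian kernels of different widths in complementary coordinates: replace
    the wider one by the narrower width, at the cost given by
    [gauss_line_narrow]; the sum on the right covers both cases. *)
Lemma gaussLM_gauss_le (I X : Type) (L : seq I) (c : I) (x : I -> X -> R) (s t : R) l :
  0 < s -> 0 < t ->
  qf (fun i j => gaussL (th / t) L x i j * gauss (th / s) (x c) i j) l <=
  (t / s) `^ ((size L)%:R / 2) * qf (gaussL (th / s) (c :: L) x) l
  + (s / t) `^ (2^-1) * qf (gaussL (th / t) (c :: L) x) l.
Proof.
move=> s0 t0.
have qp u : 0 < u -> 0 <= qf (gaussL (th / u) (c :: L) x) l.
  by move=> u0; apply: psd_gaussL; rewrite divr_ge0 ?ltW.
have [st|ts] := leP s t.
  have le1 : th / t <= th / s by rewrite ler_wpM2l ?(ltW th0)// lef_pV2.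
  have := kle_gaussM (x c) (_ : 0 <= th / s) (gaussL_narrow L x (divr_gt0 th0 t0) le1) l.
  rewrite divr_ge0 ?(ltW th0) ?(ltW s0)// => /(_ isT) h.
  apply: le_trans h _.
  rewrite -[leLHS]addr0; apply: lerD; last by rewrite mulr_ge0 ?powR_ge0 ?qp.
  rewrite -qfZ le_eqVlt; apply/orP; left; apply/eqP; apply: eq_qf => i j.
  rewrite gaussL_cons mulrA; congr (_ `^ _ * _ * _).
  by field; rewrite !gt_eqF.
have le1 : th / s <= th / t by rewrite ler_wpM2l ?(ltW th0)// lef_pV2// ltW.
have := kle_gaussLM L x (_ : 0 <= th / t) (gauss_narrow (x c) (divr_gt0 th0 s0) le1) l.
rewrite divr_ge0 ?(ltW th0) ?(ltW t0)// => /(_ isT) h.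
rewrite (@eq_qf _ _ _ (fun i j => gauss (th / s) (x c) i j * gaussL (th / t) L x i j)); last first.
  by move=> i j; rewrite mulrC.
apply: le_trans h _.
rewrite -[leLHS]add0r; apply: lerD; first by rewrite mulr_ge0 ?powR_ge0 ?qp.
rewrite -qfZ le_eqVlt; apply/orP; left; apply/eqP; apply: eq_qf => i j.
rewrite gaussL_cons powR12_sqrt ?divr_ge0 ?(ltW s0) ?(ltW t0)//.
have -> : th / t / (th / s) = s / t by field; rewrite !gt_eqF.
ring.
Qed.

(** Each coordinate costs one half of smoothness: this is the exponent of the
    gamma weight after m coordinates have been merged. *)
Definition tensor_exponent (m : nat) : R := N%:R + 1 - m%:R / 2.

Lemma tensor_exponent_gt0 m : (m <= N.+1)%N -> 0 < tensor_exponent m.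
Proof.
move=> mN; have : m%:R <= N%:R + 1 :> R by rewrite natr1 ler_nat.
have : 0 <= N%:R :> R by []. rewrite /tensor_exponent; lra.
Qed.

Lemma gamma_wtD (q a t : R) : 0 < t -> gamma_wt q t * t `^ a = gamma_wt (q + a) t.
Proof.
move=> t0; rewrite /gamma_wt mulrAC -powRD; last by rewrite (gt_eqF t0) implybT.
by congr (_ `^ _ * _); ring.
Qed.

Lemma pitg_gamma_wt (q : R) : 0 < q -> pitg (gamma_wt q).
Proof.
move=> q0; apply: eq_pitg (pitg_gamma q0 ltr01) => t _.
by rewrite /gamma_wt mul1r.
Qed.

Lemma pitg_gamma_wt_gauss (I X : Type) (L : seq I) (x : I -> X -> R) (q : R) i j : 0 < q ->
  pitg (fun t => gamma_wt q t * gaussL (th / t) L x i j).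
Proof.
move=> q0; apply: pitg_gamma_wtM => //; first exact: ltW.
by apply: sumr_ge0 => *; exact: sqr_ge0.
Qed.

Lemma gamma_wt_ge0 (q t : R) : 0 <= gamma_wt q t.
Proof. by rewrite mulr_ge0 ?powR_ge0 ?expR_ge0. Qed.

(** Induction on the coordinates.  Merging the mixture over t for the old
    coordinates with the mixture over s for the new one produces products of
    kernels with two widths; [gaussLM_gauss_le] reduces them to a single width, and
    one of the two integrals is then a finite constant. *)
Lemma tensor_gamma_mix (I : Type) (C1 : R) (L : seq I) : 0 <= C1 -> (size L <= N)%N ->
  exists C : R, 0 <= C /\ forall (X : Type) (x f : I -> X -> R),
   (forall c, kle (fun i j => f c i * f c j) (fun i j => C1 * gamma_mix th N (x c i) (x c j))) ->
   kle (fun i j => (\prod_(c <- L) f c i) * (\prod_(c <- L) f c j))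
       (fun i j => C * pint (fun t => gamma_wt (tensor_exponent (size L)) t * gaussL (th / t) L x i j)).
Proof.
move=> C10; elim: L => [|c L IH] /= LN.
  have q0 : 0 < tensor_exponent 0 by apply: tensor_exponent_gt0.
  have i0 := pitg_gamma_wt q0.
  have G0 : 0 < pint (gamma_wt (tensor_exponent 0)) by apply: (@Gamma_gt0 R (tensor_exponent 0)).
  exists (pint (gamma_wt (tensor_exponent 0)))^-1; split; first by rewrite invr_ge0 ltW.
  move=> X x f _; apply: kle_eq => i j; rewrite !big_nil mul1r.
  rewrite (eq_pint (g := gamma_wt (tensor_exponent 0))) ?mulVf ?gt_eqF// => t _.
  by rewrite gaussL_nil mulr1.
have [C [C0 H]] := IH (ltnW LN); set m := size L.
have mN : (m <= N.+1)%N by apply: leq_trans (ltnW LN) _.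
have qm : 0 < tensor_exponent m by apply: tensor_exponent_gt0.
have qm1 : 0 < tensor_exponent m.+1 by apply: tensor_exponent_gt0; exact: leq_trans LN _.
have qN : 0 < N%:R + 1 :> R by rewrite ltr_wpDl.
pose M0 : R := pint (gamma_wt (N%:R + 1)).
have M00 : 0 <= M0 by apply: pint_ge0 => *; exact: gamma_wt_ge0.
exists (C * (C1 * (M0 + M0))); split; first by rewrite !mulr_ge0// addr_ge0.
move=> X x f Hf l.
pose q t := qf (gaussL (th / t) (c :: L) x) l.
have q0 t : 0 < t -> 0 <= q t by move=> t0; apply: psd_gaussL; rewrite divr_ge0 ?ltW.
have [iJ eJ] := qf_pint l (fun i j => pitg_gamma_wt_gauss (c :: L) x i j qm1).
pose J := pint (fun t => gamma_wt (tensor_exponent m.+1) t * q t).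
have J0 : 0 <= J by apply: pint_ge0 => t t0; rewrite mulr_ge0 ?gamma_wt_ge0 ?q0.
(* peel off the coordinate c as a rank-one weight *)
apply: (@le_trans _ _ (C * qf (fun i j => pint (fun t => gamma_wt (tensor_exponent m) t *
    (f c i * f c j * gaussL (th / t) L x i j))) l)).
  have := kle_wt (f c) (H X x f Hf) l.
  rewrite (@eq_qf _ _ _ (fun i j => (\prod_(c0 <- c :: L) f c0 i) * (\prod_(c0 <- c :: L) f c0 j))).
    move=> /le_trans; apply; rewrite -qfZ le_eqVlt; apply/orP; left; apply/eqP.
    apply: eq_qf => i j; rewrite mulrCA; congr (_ * _).
    rewrite -pintZ; last exact: pitg_gamma_wt_gauss.
    by apply: eq_pint => t _; ring.
  by move=> i j; rewrite !big_cons; ring.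
rewrite qfZ -mulrA ler_wpM2l//.
have iA i j : pitg (fun t => gamma_wt (tensor_exponent m) t * (f c i * f c j * gaussL (th / t) L x i j)).
  apply: eq_pitg (pitgZ (f c i * f c j) (pitg_gamma_wt_gauss L x i j qm)) => t _; ring.
have [iA' ->] := qf_pint l iA.
have -> : qf (fun i j => pint (fun t => gamma_wt (tensor_exponent m.+1) t * gaussL (th / t) (c :: L) x i j)) l = J.
  by rewrite eJ.
(* for each width t of the first coordinates, bound the last one *)
have inner t : 0 < t -> qf (fun i j => f c i * f c j * gaussL (th / t) L x i j) l <=
    C1 * (t `^ (m%:R / 2) * J + M0 * t `^ (- 2^-1) * q t).
  move=> t0.
  apply: le_trans (kle_gaussLM L x (_ : 0 <= th / t) (Hf c) l) _.
    by rewrite divr_ge0 ?ltW.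
  have iB i j : pitg (fun s => gamma_wt (N%:R + 2^-1) s * (gaussL (th / t) L x i j * gauss (th / s) (x c) i j)).
    apply: eq_pitg (pitgZ (gaussL (th / t) L x i j) (pitg_gamma_mix N th0 (x c i) (x c j))) => s _.
    by rewrite /gauss_line /gauss; ring.
  rewrite (@eq_qf _ _ _ (fun i j => C1 * pint (fun s => gamma_wt (N%:R + 2^-1) s *
     (gaussL (th / t) L x i j * gauss (th / s) (x c) i j)))); last first.
    move=> i j; rewrite -mulrA; congr (_ * _); rewrite mulrC -pintZ; last exact: pitg_gamma_mix.
    by apply: eq_pint => s _; rewrite /gauss_line /gauss; ring.
  rewrite qfZ ler_wpM2l//; have [iB' ->] := qf_pint l iB.
  have -> : t `^ (m%:R / 2) * J + M0 * t `^ (- 2^-1) * q t =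
      pint (fun s => t `^ (m%:R / 2) * (gamma_wt (tensor_exponent m.+1) s * q s) +
                     t `^ (- 2^-1) * q t * gamma_wt (N%:R + 1) s).
    rewrite pintD; [|exact: pitgZ|by apply: pitgZ; exact: pitg_gamma_wt].
    by rewrite !pintZ//; [rewrite -/M0 -/J; ring|exact: pitg_gamma_wt].
  apply: le_pint => //.
    by apply: pitgD; [exact: pitgZ|apply: pitgZ; exact: pitg_gamma_wt].
  move=> s s0.
  apply: (le_trans (ler_wpM2l (gamma_wt_ge0 _ _) (gaussLM_gauss_le L c x l s0 t0))).
  rewrite mulrDr; apply: lerD.
    rewrite le_eqVlt; apply/orP; left; apply/eqP.
    have -> : gamma_wt (tensor_exponent m.+1) s = gamma_wt (N%:R + 2^-1) s * s `^ (- (m%:R / 2)).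
      by rewrite gamma_wtD//; congr gamma_wt; rewrite /tensor_exponent -[m.+1%:R]natr1; field.
    rewrite powRM ?invr_ge0 ?(ltW s0) ?(ltW t0)// -(powR_inv1 (ltW s0)) -powRrM mulN1r (powR_inv1 (ltW s0)) /q /m.
    ring.
  rewrite le_eqVlt; apply/orP; left; apply/eqP.
  have -> : gamma_wt (N%:R + 1) s = gamma_wt (N%:R + 2^-1) s * s `^ (2^-1).
    by rewrite gamma_wtD//; congr gamma_wt; field.
  rewrite powRM ?invr_ge0 ?(ltW s0) ?(ltW t0)// -(powR_inv1 (ltW t0)) -powRrM mulN1r (powR_inv1 (ltW t0)) /q.
  ring.
have i1 : pitg (fun t => J * gamma_wt (N%:R + 1) t) by apply: pitgZ; exact: pitg_gamma_wt.
have i2 : pitg (fun t => M0 * (gamma_wt (tensor_exponent m.+1) t * q t)) by exact: pitgZ.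
have -> : C1 * (M0 + M0) * J = pint (fun t => C1 * (J * gamma_wt (N%:R + 1) t + M0 * (gamma_wt (tensor_exponent m.+1) t * q t))).
  rewrite pintZ; last exact: pitgD.
  rewrite pintD// !pintZ//; last exact: pitg_gamma_wt.
  by rewrite -/M0 -/J; ring.
apply: le_pint => //; first by apply: pitgZ; exact: pitgD.
move=> t t0; apply: le_trans (ler_wpM2l (gamma_wt_ge0 _ _) (inner t t0)) _.
rewrite mulrCA ler_wpM2l// mulrDr le_eqVlt; apply/orP; left; apply/eqP.
have -> : gamma_wt (N%:R + 1) t = gamma_wt (tensor_exponent m) t * t `^ (m%:R / 2).
  by rewrite gamma_wtD//; congr gamma_wt; rewrite /tensor_exponent; ring.
have -> : gamma_wt (tensor_exponent m.+1) t = gamma_wt (tensor_exponent m) t * t `^ (- 2^-1).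
  by rewrite gamma_wtD//; congr gamma_wt; rewrite /tensor_exponent -[m.+1%:R]natr1; field.
ring.
Qed.

End tensor.

(** * Taylor expansion of the Gaussian kernel *)

Section smooth_features.
Variables (R : realType) (I : finType) (X : Type) (x : I -> X -> R).
Implicit Types A : X -> X -> R.

Notation L := (index_enum I).
Definition dot (i j : X) : R := \sum_c x c i * x c j.
Definition nsq (i : X) : R := \sum_c x c i ^+ 2.

Lemma psd_dotX A n : psd A -> psd (fun i j => A i j * dot i j ^+ n).
Proof.
move=> Ap; elim: n => [|n IH]; first by apply: psd_eq Ap => i j; rewrite mulr1.
apply: (@psd_eq _ _ (fun i j => \sum_(c <- L) x c i * x c j * (A i j * dot i j ^+ n))).
  by move=> i j; rewrite -mulr_suml exprS; rewrite -/(dot i j); ring.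
by apply: psd_sum => c; exact: psd_wt.
Qed.

Lemma psd_dot_series A (u : nat -> R) (F : X -> X -> R) : psd A ->
  (forall n, 0 <= u n) ->
  (forall i j, (\sum_(0 <= n < M) u n * dot i j ^+ n) @[M --> \oo] --> F i j) ->
  psd (fun i j => A i j * F i j).
Proof.
move=> Ap u0 uF.
apply: (@psd_cvg _ _ (fun M i j => A i j * \sum_(0 <= n < M) u n * dot i j ^+ n)).
  move=> M; apply: (@psd_eq _ _ (fun i j => \sum_(0 <= n < M) u n * (A i j * dot i j ^+ n))).
    by move=> i j; rewrite mulr_sumr; apply: eq_bigr => n _; rewrite mulrCA.
  by apply: psd_sum => n; apply: psdZ => //; exact: psd_dotX.
by move=> i j; apply: cvgM; [exact: cvg_cst|exact: uF].
Qed.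

Lemma gaussLE (a : R) i j :
  gaussL a L x i j = expR (- (a * nsq i)) * expR (- (a * nsq j)) * expR (2 * a * dot i j).
Proof.
rewrite /gaussL -!expRD; congr expR.
have -> : \sum_(c <- L) (x c i - x c j) ^+ 2 = nsq i + nsq j - 2 * dot i j.
  rewrite /nsq /dot mulr_sumr -sumrN -!big_split /=.
  by apply: eq_bigr => c _; ring.
ring.
Qed.

(** The k-th term of G_a(u, v) = exp(- a |u|^2 - a |v|^2) sum_k (2 a <u,v>)^k / k!. *)
Definition taylor (a : R) (k : nat) i j :=
  expR (- (a * nsq i)) * expR (- (a * nsq j)) * ((2 * a) ^+ k / k`!%:R * dot i j ^+ k).

Lemma psd_expnsqN (a : R) : psd (fun i j : X => expR (- (a * nsq i)) * expR (- (a * nsq j))).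
Proof. by move=> l; rewrite qf_rank1 sqr_ge0. Qed.

Lemma expR_seriesM (c z : R) :
  (\sum_(0 <= n < M) c ^+ n / n`!%:R * z ^+ n) @[M --> \oo] --> expR (c * z).
Proof.
have := @expR_series R (c * z); apply: cvg_trans; apply: near_eq_cvg.
apply: nearW => M; apply: eq_bigr => n _; rewrite exprMn; ring.
Qed.

Lemma cvg_truncated (v : nat -> R) K :
  (\sum_(0 <= n < M) (if (n < K)%N then v n else 0)) @[M --> \oo]
    --> \sum_(0 <= n < K) v n.
Proof.
apply: cvg_near_cst; exists K => // M /= KM.
rewrite (@big_cat_nat _ _ _ K)//= [X in _ + X]big_nat_cond [X in _ + X]big1 ?addr0.
  by rewrite !big_mkord; apply: eq_bigr => n _; rewrite ltn_ord.
by move=> n; rewrite andbT => /andP[Kn _]; rewrite ltnNge Kn.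
Qed.

(** All inequalities hold coefficient by coefficient in powers of <u, v>.  For the
    tail, (2 a)^k <= 2^-K (4 a0)^k when k >= K and a <= a0, and
    exp(- a |u|^2 - a |v|^2 + 4 a0 <u, v>) is the kernel on the right. *)
Lemma taylor_tail (a a0 : R) K l : 0 < a -> a <= a0 ->
  \sum_(0 <= k < K) qf (taylor a k) l <= qf (gaussL a L x) l /\
  qf (gaussL a L x) l <= \sum_(0 <= k < K) qf (taylor a k) l
    + 2 ^- K * qf (fun i j => expR ((2 * a0 - a) * nsq i) * expR ((2 * a0 - a) * nsq j)
                               * gaussL (2 * a0) L x i j) l.
Proof.
move=> a_gt0 aa0.
set e := fun i j => expR (- (a * nsq i)) * expR (- (a * nsq j)).
pose v n : R := (2 * a) ^+ n / n`!%:R.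
have v0 n : 0 <= v n by rewrite divr_ge0// exprn_ge0// mulr_ge0// ltW.
have tr i j : (\sum_(0 <= n < M) (if (n < K)%N then v n else 0) * dot i j ^+ n)
     @[M --> \oo] --> \sum_(0 <= n < K) v n * dot i j ^+ n.
  have h := @cvg_truncated (fun n => v n * dot i j ^+ n) K.
  rewrite (_ : (fun M => \sum_(0 <= n < M) (if (n < K)%N then v n else 0) * dot i j ^+ n) =
    (fun M => \sum_(0 <= n < M) (if (n < K)%N then v n * dot i j ^+ n else 0))).
    exact: h.
  apply/funext => M; apply: eq_bigr => n _.
  by case: ifP => // _; rewrite mul0r.
have sumE : \sum_(0 <= k < K) qf (taylor a k) l =
    qf (fun i j => e i j * \sum_(0 <= n < K) v n * dot i j ^+ n) l.
  rewrite -qf_sum; apply: eq_qf => i j; rewrite mulr_sumr; apply: eq_bigr => n _.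
  by [].
have gE : qf (gaussL a L x) l = qf (fun i j => e i j * expR (2 * a * dot i j)) l.
  by apply: eq_qf => i j; rewrite gaussLE.
have ep : psd e := psd_expnsqN a.
rewrite sumE gE; split.
  rewrite -subr_ge0 -qfB.
  apply: (psd_eq (k := fun i j => e i j * (expR (2 * a * dot i j) - \sum_(0 <= n < K) v n * dot i j ^+ n))).
    by move=> i j; ring.
  apply: (@psd_dot_series e (fun n => if (n < K)%N then 0 else v n)) => // [n|i j].
    by case: ifP.
  have h := cvgB (@expR_seriesM (2 * a) (dot i j)) (tr i j).
  rewrite (_ : (fun M => \sum_(0 <= n < M) (if (n < K)%N then 0 else v n) * dot i j ^+ n) =
    (fun M => \sum_(0 <= n < M) (2 * a) ^+ n / n`!%:R * dot i j ^+ n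
     - \sum_(0 <= n < M) (if (n < K)%N then v n else 0) * dot i j ^+ n)).
    exact: h.
  apply/funext => M; rewrite -sumrB; apply: eq_bigr => n _; rewrite /v; case: ifP => _; ring.
have -> : qf (fun i j => expR ((2 * a0 - a) * nsq i) * expR ((2 * a0 - a) * nsq j) * gaussL (2 * a0) L x i j) l
    = qf (fun i j => e i j * expR (4 * a0 * dot i j)) l.
  apply: eq_qf => i j; rewrite gaussLE /e -!expRD; congr expR; ring.
rewrite -qfZ -qfD -subr_ge0 -qfB.
apply: (psd_eq (k := fun i j => e i j * (\sum_(0 <= n < K) v n * dot i j ^+ n
    + 2 ^- K * expR (4 * a0 * dot i j) - expR (2 * a * dot i j)))).
  by move=> i j; ring.
apply: (@psd_dot_series e (fun n => (if (n < K)%N then v n else 0) + 2 ^- K * ((4 * a0) ^+ n / n`!%:R) - v n)) => // [n|i j].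
  have f0 : 0 <= (4 * a0) ^+ n / n`!%:R.
    by rewrite divr_ge0// exprn_ge0// mulr_ge0// (le_trans (ltW a_gt0)).
  have i0 : 0 <= 2 ^- K :> R by rewrite invr_ge0 exprn_ge0.
  case: ltnP => nK; first by rewrite addrAC subrr add0r mulr_ge0.
  rewrite add0r subr_ge0 /v mulrA ler_wpM2r ?invr_ge0//.
  have -> : 2 ^- K * (4 * a0) ^+ n = 2 ^+ (n - K) * (2 * a0) ^+ n.
    have -> : 4 * a0 = 2 * (2 * a0) by ring.
    by rewrite exprMn -[in 2 ^+ n](subnK nK) exprD; field; rewrite expf_neq0.
  rewrite -[leLHS]mul1r.
  apply: ler_pM => //; first by rewrite exprn_ge0// mulr_ge0// ltW.
    by rewrite exprn_ege1// ler1n.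
  have a0_ge0 : 0 <= a0 by exact: le_trans (ltW a_gt0) _.
  by apply: lerXn2r; rewrite ?nnegrE ?mulr_ge0 ?(ltW a_gt0)//; rewrite ler_wpM2l.
have h := cvgB (cvgD (tr i j) (cvgM (cvg_cst (2 ^- K : R)) (@expR_seriesM (4 * a0) (dot i j))))
  (@expR_seriesM (2 * a) (dot i j)).
rewrite (_ : (fun M => \sum_(0 <= n < M) ((if (n < K)%N then v n else 0)
     + 2 ^- K * ((4 * a0) ^+ n / n`!%:R) - v n) * dot i j ^+ n) =
  (fun M => \sum_(0 <= n < M) (if (n < K)%N then v n else 0) * dot i j ^+ n + 2 ^- K * (\sum_(0 <= n < M) (4 * a0) ^+ n / n`!%:R * dot i j ^+ n)
   - \sum_(0 <= n < M) (2 * a) ^+ n / n`!%:R * dot i j ^+ n)).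
  exact: h.
apply/funext => M; rewrite mulr_sumr -big_split -sumrB; apply: eq_bigr => n _ /=; rewrite /v; ring.
Qed.

Lemma psd_taylor (a : R) k : 0 < a -> psd (taylor a k).
Proof.
move=> a0; apply: (@psd_eq _ _ (fun i j => (2 * a) ^+ k / k`!%:R *
   (expR (- (a * nsq i)) * expR (- (a * nsq j)) * dot i j ^+ k))).
  by move=> i j; rewrite /taylor; ring.
apply: psdZ; first by rewrite divr_ge0// exprn_ge0// mulr_ge0// ltW.
by apply: psd_dotX; exact: psd_expnsqN.
Qed.

End smooth_features.

(** * Domination by a general mixture *)

Lemma push_bounded (R : realType) (X : Type) (g : X -> R) (B : R) (l : seq (R * X)) :
  (forall i, `|g i| <= B) -> forall p, p \in push g l -> `|p.2| <= B.
Proof.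
move=> gB; elim: l => [//|q l IH] p; rewrite inE => /orP[/eqP ->|]; first exact: gB.
exact: IH.
Qed.

Section domination.
Variables (R : realType) (I : finType) (nu : R).
Hypothesis nu0 : 0 < nu.
Notation L := (index_enum I).
Variable w : R -> R.
Hypothesis wi : pitg w.
Hypothesis w0 : forall t, 0 < t -> 0 <= w t.
Hypothesis w_low : exists q0 : R, forall q tau, q0 <= q -> 0 < tau ->
  exists2 c, 0 < c & forall t, 0 < t -> t <= tau -> c * t `^ (q - 1) <= w t.

Definition mixk (X : Type) (x : I -> X -> R) (i j : X) :=
  pint (fun t => w t * gaussL (nu / t) L x i j).

Lemma cpos_gaussL (X : Type) (x : I -> X -> R) i j : cpos (fun t => gaussL (nu / t) L x i j).
Proof.
apply: cpos_expR; apply: cposN; apply: cposM; last exact: cst_cpos.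
exact: cpos_div.
Qed.

Lemma pitg_mixk (X : Type) (x : I -> X -> R) i j :
  pitg (fun t => w t * gaussL (nu / t) L x i j).
Proof.
apply: pitg_le wi => [|t t0].
  by apply: measurable_funM; [exact: pmeas_pitg|apply: cpos_meas; exact: cpos_gaussL].
rewrite normrM (ger0_norm (w0 t0)) ger0_norm ?gaussL_ge0//.
by rewrite ler_piMr ?w0// gaussL_le1// divr_ge0 ?ltW.
Qed.

Lemma qf_mixk (X : Type) (x : I -> X -> R) l :
  pitg (fun t => w t * qf (gaussL (nu / t) L x) l) /\
  qf (mixk x) l = pint (fun t => w t * qf (gaussL (nu / t) L x) l).
Proof. by apply: qf_pint => i j; exact: pitg_mixk. Qed.

Lemma qf_mixk_ge0 (X : Type) (x : I -> X -> R) : psd (mixk x).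
Proof.
move=> l; rewrite (qf_mixk x l).2; apply: pint_ge0 => t t0.
by rewrite mulr_ge0 ?w0//; apply: psd_gaussL; rewrite divr_ge0 ?ltW.
Qed.

(** G_(nu/tau) is dominated by G_(nu/t) for all t in [tau/2, tau], by
    [gaussL_narrow], and w is bounded below there. *)
Lemma gaussL_le_mixk (tau : R) : 0 < tau -> exists2 C : R, 0 <= C &
  forall (X : Type) (x : I -> X -> R) l, qf (gaussL (nu / tau) L x) l <= C * qf (mixk x) l.
Proof.
move=> tau0; have [q0 H] := w_low.
have [c c0 Hc] := H (Num.max q0 1) tau (ltac:(by rewrite le_max lexx)) tau0.
set q := Num.max q0 1 in Hc.
have q1 : 0 <= q - 1 by rewrite subr_ge0 le_max lexx orbT.
pose m : R := (size L)%:R / 2.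
have t20 : 0 < tau / 2 by rewrite divr_gt0.
set k := c * (tau / 2) `^ (q - 1) / 2 `^ m.
have k0 : 0 < k by rewrite /k divr_gt0 ?powR_gt0// mulr_gt0 ?powR_gt0.
exists (k * (tau / 2))^-1; first by rewrite invr_ge0 ltW// mulr_gt0.
move=> X x l; rewrite [leRHS]mulrC ler_pdivlMr; last exact: (mulr_gt0 k0 t20).
set Q := qf (gaussL (nu / tau) L x) l.
have Q0 : 0 <= Q by apply: psd_gaussL; rewrite divr_ge0 ?ltW.
have [i ->] := qf_mixk x l.
have qt t : 0 < t -> 0 <= qf (gaussL (nu / t) L x) l.
  by move=> t0; apply: psd_gaussL; rewrite divr_ge0 ?ltW.
have := @pint_ge R _ (k * Q) (tau / 2) tau t20 _ i _ _.
have -> : tau - tau / 2 = tau / 2 by field.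
move=> h; rewrite mulrA [Q * k]mulrC; apply: h => [|t t0|t /andP[t2 tt]].
- by rewrite ler_pdivrMr// mulr_natr mulr2n lerDl ltW.
- by rewrite mulr_ge0 ?w0 ?qt.
have t0 : 0 < t by exact: lt_le_trans t20 t2.
have h1 : Q <= 2 `^ m * qf (gaussL (nu / t) L x) l.
  have le1 : nu / tau <= nu / t by rewrite ler_wpM2l ?(ltW nu0)// lef_pV2.
  have := gaussL_narrow L x (divr_gt0 nu0 tau0) le1 l.
  rewrite qfZ => /le_trans; apply; rewrite ler_wpM2r ?qt//.
  apply: ge0_ler_powR; [by rewrite divr_ge0| |by rewrite nnegrE|].
    by rewrite nnegrE !divr_ge0 ?(ltW nu0) ?(ltW t0) ?(ltW tau0).
  have -> : nu / t / (nu / tau) = tau / t by field; rewrite !gt_eqF.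
  by rewrite ler_pdivrMr// mulrC -ler_pdivrMr.
have h2 : c * (tau / 2) `^ (q - 1) <= w t.
  apply: le_trans (Hc t t0 tt); rewrite ler_wpM2l ?(ltW c0)//.
  by apply: ge0_ler_powR => //; rewrite nnegrE ltW.
rewrite /k -mulrA; apply: ler_pM => //.
- by rewrite mulr_ge0 ?powR_ge0 ?ltW.
- by rewrite mulr_ge0// invr_ge0 powR_ge0.
- by rewrite mulrC ler_pdivrMr ?powR_gt0// mulrC.
Qed.

(** Take the tensor bound with scale th = nu / 2 and N so large that its gamma
    weight lies below w near 0.  The product of G_(th/t) and G_(2 a0) is
    G_(th/t + 2 a0), which is compared with G_(nu/t) = G_(2 th/t) when
    th / t >= 2 a0, that is t <= tau, and with the fixed kernel G_(4 a0)
    otherwise; the second case uses [gaussL_le_mixk]. *)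
Lemma expnsq_gauss_le_mixk (B b1 a0 : R) : 0 <= B -> 0 < a0 -> exists2 C : R, 0 <= C &
  forall (X : Type) (x : I -> X -> R), (forall c i, `|x c i| <= B) ->
  forall b l, 0 < b -> b <= b1 ->
   qf (fun i j => expR (b * nsq x i) * expR (b * nsq x j) * gaussL (2 * a0) L x i j) l
   <= C * qf (mixk x) l.
Proof.
move=> B0 a00.
have th0 : 0 < nu / 2 by rewrite divr_gt0.
set th := nu / 2 in th0.
have [q0 H] := w_low.
(* N is chosen so that the exponent of the product kernel exceeds q0 *)
pose d := size L.
pose N : nat := (d + d + Num.bound `|q0|)%N.
have dN : (d <= N)%N by rewrite /N -addnA leq_addr.
have qeN : q0 <= tensor_exponent R N d.
  rewrite /tensor_exponent /N !natrD.
  have : q0 <= (Num.bound `|q0|)%:R by rewrite (le_trans (ler_norm _))// ltW// archi_boundP.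
  have : 0 <= d%:R :> R by []. lra.
have qep : 0 < tensor_exponent R N d by apply: tensor_exponent_gt0; exact: leq_trans dN _.
have [C1 [C10 HC1]] := expsq_le_gamma_mix N th0 B0 b1.
have [C2 [C20 HC2]] := @tensor_gamma_mix R th N th0 I C1 L C10 dN.
set tau := th / (2 * a0).
have tau0 : 0 < tau by rewrite divr_gt0// mulr_gt0.
have [c3 c30 Hc3] := H _ tau qeN tau0.
have [C4 C40 HC4] := gaussL_le_mixk tau0.
pose m : R := 2 `^ (d%:R / 2).
have m0 : 0 <= m :> R by rewrite powR_ge0.
pose G : R := pint (gamma_wt (tensor_exponent R N d)).
have G0 : 0 <= G by apply: pint_ge0 => *; exact: gamma_wt_ge0.
exists (C2 * (m * (c3^-1 + G * C4))).
  by rewrite !mulr_ge0// addr_ge0 ?mulr_ge0 ?invr_ge0 ?(ltW c30).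
move=> X x xB b l b0 bb.
have HT := HC2 X x (fun c i => expR (b * x c i ^+ 2)) _.
have {}HT : kle (fun i j => expR (b * nsq x i) * expR (b * nsq x j))
   (fun i j => C2 * pint (fun t => gamma_wt (tensor_exponent R N d) t * gaussL (th / t) L x i j)).
  apply: kle_trans (HT _).
    by apply: kle_eq => i j; rewrite /nsq !mulr_sumr !expR_sum.
  move=> c l'; rewrite qf_rank1 qfZ.
  have := HC1 b (push (x c) l') b0 bb _.
  rewrite qf_push lin_push; apply; exact: push_bounded.
have iG i j := @pitg_gamma_wt_gauss R th th0 I X L x (tensor_exponent R N d) i j qep.
have a20 : 0 <= 2 * a0 by rewrite mulr_ge0 ?ltW.
apply: le_trans (kle_gaussLM L x a20 HT l) _.
have iG2 i j : pitg (fun t => gamma_wt (tensor_exponent R N d) t * gaussL (th / t + 2 * a0) L x i j).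
  apply: eq_pitg (pitgZ (gaussL (2 * a0) L x i j) (iG i j)) => t _.
  by rewrite mulrCA /gaussL -expRD; congr (_ * expR _); ring.
rewrite (@eq_qf _ _ _ (fun i j => C2 * pint (fun t => gamma_wt (tensor_exponent R N d) t * gaussL (th / t + 2 * a0) L x i j))); last first.
  move=> i j; rewrite -mulrA; congr (_ * _); rewrite mulrC -pintZ//.
  apply: eq_pint => t _.
  by rewrite mulrCA /gaussL -expRD; congr (_ * expR _); ring.
rewrite qfZ -!mulrA ler_wpM2l//; have [i2 ->] := qf_pint l iG2.
set Q := qf (mixk x) l; have [iQ eQ] := qf_mixk x l.
have Q0 : 0 <= Q by exact: qf_mixk_ge0.
set q4 := qf (gaussL (nu / tau) L x) l.
have q40 : 0 <= q4 by apply: psd_gaussL; rewrite divr_ge0 ?ltW.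
have q4Q : q4 <= C4 * Q by exact: HC4.
have qt t : 0 < t -> 0 <= qf (gaussL (nu / t) L x) l.
  by move=> t0; apply: psd_gaussL; rewrite divr_ge0 ?ltW.
have iW := pitg_gamma_wt qep.
apply: (@le_trans _ _ (pint (fun t => m * (c3^-1 * (w t * qf (gaussL (nu / t) L x) l)
     + q4 * gamma_wt (tensor_exponent R N d) t)))); last first.
  rewrite pintZ; last by apply: pitgD; exact: pitgZ.
  rewrite pintD; [|exact: pitgZ|exact: pitgZ].
  rewrite !pintZ// -eQ -/Q -/G ler_wpM2l// mulrDl lerD2l -mulrA [q4 * _]mulrC ler_wpM2l//.
apply: le_pint => //.
  by apply: pitgZ; apply: pitgD; exact: pitgZ.
move=> t t0.
have narrow2 b' : 0 < b' -> th / t + 2 * a0 <= b' -> b' <= 2 * (th / t + 2 * a0) ->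
    qf (gaussL (th / t + 2 * a0) L x) l <= m * qf (gaussL b' L x) l.
  move=> b'0 le1 le2; have a'0 : 0 < th / t + 2 * a0 by rewrite addr_gt0 ?divr_gt0 ?mulr_gt0.
  have := gaussL_narrow L x a'0 le1 l; rewrite qfZ => /le_trans; apply.
  rewrite ler_wpM2r//; first by apply: psd_gaussL; exact: ltW.
  apply: ge0_ler_powR; [by rewrite divr_ge0| |by rewrite nnegrE|].
    by rewrite nnegrE divr_ge0 ?(ltW b'0) ?(ltW a'0).
  by rewrite ler_pdivrMr.
have t0V : 0 < th / t by rewrite divr_gt0.
have a2 : 0 < 2 * a0 by rewrite mulr_gt0.
have nuth : nu = 2 * th by rewrite /th; field.
have tauE : nu / tau = 4 * a0 by rewrite nuth /tau; field; rewrite !gt_eqF.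
have [ttau|taut] := leP t tau.
  have le2 : 2 * a0 <= th / t.
    by rewrite ler_pdivlMr// mulrC -ler_pdivlMr.
  have h := narrow2 (nu / t) (divr_gt0 nu0 t0) _ _.
  have {}h : qf (gaussL (th / t + 2 * a0) L x) l <= m * qf (gaussL (nu / t) L x) l.
    by apply: h; rewrite nuth -mulrA; lra.
  apply: le_trans (ler_wpM2l (gamma_wt_ge0 _ _) h) _.
  rewrite mulrCA ler_wpM2l// -[leLHS]addr0; apply: lerD; last by rewrite mulr_ge0 ?gamma_wt_ge0.
  rewrite mulrA ler_wpM2r ?qt// mulrC ler_pdivlMr// mulrC.
  apply: le_trans (Hc3 t t0 ttau); rewrite ler_wpM2l ?(ltW c30)//.
  by rewrite /gamma_wt ler_piMr ?powR_ge0// expR_le1 oppr_le0 ltW.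
have le2 : th / t <= 2 * a0.
  by rewrite ler_pdivrMr// mulrC -ler_pdivrMr// ltW.
have h := narrow2 (nu / tau) (divr_gt0 nu0 tau0) _ _.
have {}h : qf (gaussL (th / t + 2 * a0) L x) l <= m * q4.
  by apply: h; rewrite tauE; lra.
apply: le_trans (ler_wpM2l (gamma_wt_ge0 _ _) h) _.
rewrite mulrCA ler_wpM2l// -[leLHS]add0r; apply: lerD; last by rewrite mulrC.
by rewrite mulr_ge0 ?invr_ge0 ?(ltW c30)// mulr_ge0 ?w0 ?qt.
Qed.

(** Apply the previous bound to the kernel in [taylor_tail]; a single term is at
    most the whole kernel, which the case K = 0 bounds. *)
Theorem taylor_domination (B a0 : R) : 0 <= B -> 0 < a0 -> exists2 C : R, 0 <= C &
  forall (X : Type) (x : I -> X -> R), (forall c i, `|x c i| <= B) ->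
  forall a l, 0 < a -> a <= a0 ->
   (forall k, qf (taylor x a k) l <= C * qf (mixk x) l) /\
   (forall K, qf (gaussL a L x) l <=
      \sum_(0 <= k < K) qf (taylor x a k) l + 2 ^- K * (C * qf (mixk x) l)).
Proof.
move=> B0 a00; have [C C0 H] := @expnsq_gauss_le_mixk B (2 * a0) a0 B0 a00.
exists C => // X x xB a l ap aa0.
have hb : qf (fun i j => expR ((2 * a0 - a) * nsq x i) * expR ((2 * a0 - a) * nsq x j)
    * gaussL (2 * a0) L x i j) l <= C * qf (mixk x) l.
  by apply: H => //; lra.
have t2 K : qf (gaussL a L x) l <=
      \sum_(0 <= k < K) qf (taylor x a k) l + 2 ^- K * (C * qf (mixk x) l).
  apply: le_trans (taylor_tail x K l ap aa0).2 _; rewrite lerD2l.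
  by apply: ler_wpM2l hb; rewrite invr_ge0 exprn_ge0.
split=> // k.
have := t2 0%N; rewrite big_geq// add0r expr0 invr1 mul1r; apply: le_trans.
apply: le_trans (taylor_tail x k.+1 l ap aa0).1.
rewrite big_nat_recr//= lerDr sumr_ge0// => j _; exact: psd_taylor.
Qed.

End domination.

(** * Functionals that are negligible along the prediction errors *)

Lemma cvg_sum0 (R : realType) (I : Type) (r : seq I) (F : I -> nat -> R) :
  (forall c, F c n @[n --> \oo] --> (0 : R)) ->
  (\sum_(c <- r) F c n) @[n --> \oo] --> (0 : R).
Proof.
move=> h; elim: r => [|c r IH].
  by under eq_cvg do rewrite big_nil; exact: cvg_cst.
under eq_cvg do rewrite big_cons.
have h2 := cvgD (h c) IH; rewrite addr0 in h2; exact: h2.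
Qed.

Section weakly_null.
Variables (R : realType) (K : nat -> nat -> R).
Hypothesis Kpsd : psd K.
Hypothesis Ksym : forall i j, K i j = K j i.
Variable l : nat -> seq (R * nat).

Definition coef (i : nat) (m : seq (R * nat)) : R := lin (fun j => (j == i)%:R) m.

Hypothesis l_supp : forall n p, p \in l n -> (p.2 <= n)%N.
Hypothesis l_orth : forall n j, (0 < j)%N -> (j <= n)%N -> lin (K j) (l n) = 0.
Hypothesis l_coef : forall n, coef 0 (l n) = -1.

Local Notation v n := (qf K (l n)).

(** By orthogonality only the mass at the target, the point 0, contributes. *)
Lemma bil_error n (m : seq (R * nat)) : (forall p, p \in m -> (p.2 <= n)%N) ->
  bil K m (l n) = - coef 0 m * v n.
Proof.
have H m' : (forall p, p \in m' -> (p.2 <= n)%N) -> bil K m' (l n) = coef 0 m' * lin (K 0%N) (l n).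
  move=> mn; rewrite /bil /coef -linZr /lin big_seq [RHS]big_seq; apply: eq_bigr => p pm.
  have [->|p0] := eqVneq p.2 0%N; first by rewrite mul1r.
  by rewrite -/(lin (K p.2) (l n)) l_orth ?mul0r ?lt0n// mn.
move=> mn; rewrite H// /qf (H (l n)) ?l_coef; last exact: l_supp.
by rewrite mulN1r mulrNN.
Qed.

Lemma error_min n (m : seq (R * nat)) : (forall p, p \in m -> (p.2 <= n)%N) ->
  coef 0 m = -1 -> v n <= qf K m.
Proof.
move=> mn m1; have := Kpsd (m ++ scale (-1) (l n)).
by rewrite qf_cat// qf_scale bil_scaler bil_error// m1; lra.
Qed.

Hypothesis v_gt0 : forall n, 0 < v n.
Hypothesis v_cvg : v n @[n --> \oo] --> (0 : R).

(** Otherwise f^2 >= e Q along infinitely many errors.  Add up L of the normalized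
    errors, with signs that make f positive and with indices so far apart that each
    new one is almost orthogonal to the previous sum: f is then at least
    L sqrt e while the form is at most 2 L, which contradicts f^2 <= C Q for large
    L. *)
Lemma bounded_functional_negligible (f : nat -> R) (C : R) :
  (forall m, lin f m ^+ 2 <= C * qf K m) ->
  (lin f (l n) ^+ 2 / v n) @[n --> \oo] --> (0 : R).
Proof.
move=> fC; apply: contrapT => ncv.
have [e e0 He] : exists2 e : R, 0 < e & forall N, exists2 n, (N <= n)%N & e * v n <= lin f (l n) ^+ 2.
  apply: contrapT => H; apply: ncv; apply/cvgrPdist_lt => e e0.
  apply: contrapT => H2; apply: H; exists e => // N.
  apply: contrapT => H3; apply: H2; exists N => // n /= Nn.
  rewrite sub0r normrN ger0_norm ?divr_ge0 ?sqr_ge0 ?(ltW (v_gt0 n))//.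
  rewrite ltr_pdivrMr ?v_gt0//; have [//|h] := ltP (lin f (l n) ^+ 2) (e * v n).
  by exfalso; apply: H3; exists n.
(* almost orthogonal normalized errors on which f stays large *)
have step (L : nat) : exists (m : seq (R * nat)) N, [/\ forall p, p \in m -> (p.2 <= N)%N,
    L%:R * Num.sqrt e <= lin f m & qf K m <= 2 * L%:R].
  elim: L => [|L [m [N [mN fm qm]]]].
    by exists [::], 0%N; split => //; rewrite ?mul0r /qf /bil ?lin_nil ?mulr0.
  pose c0 := `|coef 0 m| + 1.
  have c0p : 0 < c0 by rewrite ltr_wpDl.
  have [M _ HM] : \forall n \near \oo, v n < (2 * c0)^-1 ^+ 2.
    have e' : 0 < (2 * c0)^-1 ^+ 2 by rewrite exprn_gt0// invr_gt0 mulr_gt0.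
    have := v_cvg; move/cvgrPdist_lt => /(_ _ e'); apply: filterS => n.
    by rewrite sub0r normrN ger0_norm// ltW.
  (* n is so large that the scalar product of m with the normalized error, which is
     coef 0 m * sqrt (v n) up to sign, is at most 1/2 *)
  have [n Mn fn] := He (maxn N M).
  have Nn : (N <= n)%N by apply: leq_trans Mn; exact: leq_maxl.
  have vn := HM n (leq_trans (leq_maxr _ _) Mn).
  set s := Num.sqrt (v n).
  have s0 : 0 < s by rewrite sqrtr_gt0.
  have s2 : s ^+ 2 = v n by rewrite sqr_sqrtr// ltW.
  have sc : s < (2 * c0)^-1.
    rewrite -(ltr_pXn2r (n := 2))// ?nnegrE ?(ltW s0) ?invr_ge0 ?mulr_ge0 ?(ltW c0p)//.
    by rewrite s2.
  pose sg : R := if 0 <= lin f (l n) then 1 else -1.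
  have sgE : sg * lin f (l n) = `|lin f (l n)|.
    by rewrite /sg; case: ger0P => _; rewrite ?mul1r ?mulN1r.
  have sg2 : sg ^+ 2 = 1 by rewrite /sg; case: ifP; rewrite ?sqrrN expr1n.
  pose g := scale (sg / s) (l n).
  exists (m ++ g), n; split.
  - move=> p; rewrite mem_cat => /orP[/mN pN|]; first exact: leq_trans pN Nn.
    by move=> /mapP[p' /l_supp h ->].
  - rewrite lin_cat lin_scale -natr1 mulrDl mul1r lerD//.
    rewrite mulrAC sgE ler_pdivlMr// -[leRHS]sqrtr_sqr -sqrtrM ?(ltW e0)//.
    by rewrite ler_wsqrtr.
  - rewrite qf_cat// qf_scale bil_scaler bil_error; last by move=> p /mN /leq_trans; apply.
    have -> : (sg / s) ^+ 2 * v n = 1.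
      by rewrite exprMn sg2 mul1r exprVn s2 mulVf// gt_eqF.
    have -> : 2 * (sg / s * (- coef 0 m * v n)) = 2 * (- (sg * coef 0 m) * s).
      by rewrite -s2; field; rewrite gt_eqF.
    have h : `|- (sg * coef 0 m) * s| <= 2^-1.
      rewrite normrM normrN normrM.
      have -> : `|sg| = 1 by rewrite /sg; case: ifP; rewrite ?normrN normr1.
      rewrite mul1r (ger0_norm (ltW s0)).
      apply: (@le_trans _ _ (c0 * (2 * c0)^-1)); last first.
        by rewrite invfM mulrCA divff ?gt_eqF// mulr1.
      apply: ler_pM; rewrite ?normr_ge0 ?(ltW s0) ?(ltW sc)//.
      by rewrite /c0 lerDl.
    have := ler_norm (- (sg * coef 0 m) * s).
    rewrite -natr1; lra.
pose L := (Num.bound (`|2 * C / e|)).+1.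
have [m [N [_ fm qm]]] := step L.
have L0 : 0 < L%:R :> R by [].
have C0 : 0 <= C.
  by have := le_trans (sqr_ge0 _) (fC (l 0%N)); rewrite (pmulr_lge0 _ (v_gt0 0%N)).
have h1 : L%:R ^+ 2 * e <= C * (2 * L%:R).
  apply: (@le_trans _ _ (lin f m ^+ 2)).
    rewrite -[e]sqr_sqrtr ?(ltW e0)// -exprMn; apply: lerXn2r => //.
      by rewrite nnegrE mulr_ge0 ?sqrtr_ge0.
    by rewrite nnegrE (le_trans _ fm)// mulr_ge0 ?sqrtr_ge0.
  by apply: le_trans (fC m) _; rewrite ler_wpM2l.
have h2 : L%:R * e <= 2 * C.
  rewrite -(ler_pM2l L0); apply: le_trans (_ : L%:R ^+ 2 * e <= _); first by rewrite expr2 mulrA.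
  by apply: le_trans h1 _; rewrite mulrC -mulrA mulrCA mulrA.
have h3 : L%:R <= 2 * C / e by rewrite ler_pdivlMr.
have := archi_boundP (normr_ge0 (2 * C / e)).
have := ler_norm (2 * C / e).
move: h3; rewrite /L -natr1; lra.
Qed.

Variables (I : finType) (x : I -> nat -> R).

(** The kernel is a sum of squares of bounded functionals: split off one factor of
    the dot product at a time. *)
Lemma bounded_dot_power_negligible k (f : nat -> R) (C : R) :
  (forall m, qf (fun i j => f i * f j * dot x i j ^+ k) m <= C * qf K m) ->
  (qf (fun i j => f i * f j * dot x i j ^+ k) (l n) / v n) @[n --> \oo] --> (0 : R).
Proof.
elim: k f => [|k IH] f fC.
  have e0 m : qf (fun i j => f i * f j * dot x i j ^+ 0) m = lin f m ^+ 2.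
    by rewrite -qf_rank1; apply: eq_qf => i j; rewrite expr0 mulr1.
  under eq_cvg do rewrite e0.
  by apply: (@bounded_functional_negligible f C) => m; rewrite -e0.
pose F c i := f i * x c i.
have e m : qf (fun i j => f i * f j * dot x i j ^+ k.+1) m =
    \sum_c qf (fun i j => F c i * F c j * dot x i j ^+ k) m.
  rewrite -qf_sum; apply: eq_qf => i j; rewrite exprS /F {1}/dot mulrA mulr_sumr mulr_suml.
  by apply: eq_bigr => c _; ring.
have p c : psd (fun i j => F c i * F c j * dot x i j ^+ k).
  by apply: psd_dotX => m; rewrite qf_rank1 sqr_ge0.
under eq_cvg do rewrite e mulr_suml.
apply: (@cvg_sum0 R I (index_enum I) (fun c n => qf (fun i j => F c i * F c j * dot x i j ^+ k) (l n) / v n)) => c.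
apply: IH => m; apply: le_trans (fC m); rewrite e (bigD1 c)//= lerDl.
by apply: sumr_ge0 => c' _; exact: p.
Qed.

End weakly_null.

(** * Comparison of two mixtures along the errors of one of them *)

(** The lower bound by powers near 0 says that the covariance has finite
    smoothness, whatever the exponent. *)
Definition admissible_weight (R : realType) (w : R -> R) :=
  [/\ pitg w, forall t, 0 < t -> 0 <= w t &
   exists q0 : R, forall q tau, q0 <= q -> 0 < tau ->
     exists2 c, 0 < c & forall t, 0 < t -> t <= tau -> c * t `^ (q - 1) <= w t].

Section strict.
Variables (R : realType) (I : finType) (nu : R) (w : R -> R) (x : I -> nat -> R).
Hypothesis nu0 : 0 < nu.
Hypothesis wg : admissible_weight w.
Notation L := (index_enum I).
Notation K := (mixk nu w x).

Hypothesis x_dist : forall i j, i != j -> 0 < \sum_(c <- L) (x c i - x c j) ^+ 2.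

Lemma cvg_gaussL_diag i j : gaussL (n%:R) L x i j @[n --> \oo] --> ((i == j)%:R : R).
Proof.
have [->|ij] := eqVneq i j.
  rewrite /= /gaussL big1 => [|c _]; last by rewrite subrr expr0n.
  under eq_cvg do rewrite mulr0 oppr0 expR0.
  exact: cvg_cst.
set d := \sum_(c <- L) (x c i - x c j) ^+ 2.
have d0 : 0 < d := x_dist ij.
rewrite mulr0n; apply/cvgrPdist_lt => e e0.
have ed : 0 <= (e * d)^-1 by rewrite invr_ge0 ltW// mulr_gt0.
exists (Num.bound (e * d)^-1).+1 => // n /= hn.
have n0 : 0 < n%:R :> R by rewrite ltr0n (leq_trans _ hn).
have hb : (e * d)^-1 < n%:R.
  by apply: lt_le_trans (archi_boundP ed) _; rewrite ler_nat ltnW.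
rewrite sub0r normrN /gaussL -/d ger0_norm ?expR_ge0// expRN.
have nd0 : 0 < n%:R * d by rewrite mulr_gt0.
apply: (@le_lt_trans _ _ (n%:R * d)^-1).
  rewrite lef_pV2 ?posrE ?expR_gt0// (le_trans _ (expR_ge1Dx _))// lerDr//.
move: hb; rewrite -[X in X < _]mul1r ltr_pdivrMr ?mulr_gt0// => hb.
by rewrite -[X in X < _]mul1r ltr_pdivrMr// mulrCA.
Qed.

(** As a grows, the Gaussian kernel of distinct points tends to the identity
    matrix, so some kernel G_(nu/t) is positive at m; the mixture dominates it. *)
Lemma mixk_gt0 m i0 : coef i0 m != 0 :> R -> 0 < qf K m.
Proof.
move=> c0; case: wg => wi w0 wl.
have ci : 0 < coef i0 m ^+ 2 by rewrite exprn_even_gt0.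
have diag : psd (fun i j : nat => (i == j)%:R : R).
  apply: (@psd_cvg _ _ (fun n => gaussL n%:R L x)) => [n|i j].
    exact: psd_gaussL.
  exact: cvg_gaussL_diag.
have qd : coef i0 m ^+ 2 <= qf (fun i j => (i == j)%:R) m.
  rewrite -subr_ge0 /coef -qf_rank1 -qfB.
  have p0 : psd (fun i j : nat => (i != i0)%:R * (j != i0)%:R * (i == j)%:R : R).
    exact: (psd_wt (fun i : nat => (i != i0)%:R : R) diag).
  apply: (psd_eq _ p0).
    move=> i j; case: (eqVneq i i0) => [->|ii0] /=.
      by rewrite !mul0r mul1r eq_sym subrr.
    rewrite mul0r subr0 mul1r; case: (eqVneq i j) => [<-|_]; last by rewrite mulr0.
    by rewrite mulr1 ii0.
have := cvg_qf (l := m) cvg_gaussL_diag.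
move=> /cvgrPdist_lt /(_ _ ci) [n0 _ Hn].
have := Hn n0.+1 (leqnSn _) => /=.
set g := qf (gaussL _ _ _) m => hg.
have g0 : 0 < g by have := ler_norm (qf (fun i j : nat => (i == j)%:R) m - g); lra.
have tau0 : 0 < nu / n0.+1%:R by rewrite divr_gt0.
have [C C0 HC] := gaussL_le_mixk I nu0 wi w0 wl tau0.
have := HC _ x m.
have -> : nu / (nu / n0.+1%:R) = n0.+1%:R by field; rewrite (gt_eqF nu0) nat1r pnatr_eq0.
rewrite -/g => gC; have := lt_le_trans g0 gC.
have K0 := qf_mixk_ge0 nu0 wi w0 x m.
move=> h; rewrite lt_neqAle K0 andbT eq_sym; apply/eqP => e.
by move: h; rewrite e mulr0 ltxx.
Qed.

Lemma mixk_sym i j : K i j = K j i.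
Proof. by apply: eq_pint => t _; rewrite gaussLC. Qed.

Hypothesis x_lim : forall e : R, 0 < e ->
  exists2 j, (0 < j)%N & \sum_(c <- L) (x c 0%N - x c j) ^+ 2 < e.

(** Mean-square continuity at the target, by dominated convergence. *)
Lemma mixk_diff_small (e : R) : 0 < e ->
  exists2 j, (0 < j)%N & K 0%N 0%N + K j j - 2 * K 0%N j < e.
Proof.
move=> e0; case: wg => wi w0 wl.
have /choice[s Hs] n : exists j, (0 < j)%N /\
    \sum_(c <- L) (x c 0%N - x c j) ^+ 2 < n.+1%:R^-1.
  have n0 : 0 < n.+1%:R^-1 :> R by rewrite invr_gt0.
  by have [j j0 jl] := x_lim n0; exists j.
have pi i j : pitg (fun t => w t * gaussL (nu / t) L x i j) := pitg_mixk nu0 wi w0 x i j.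
have cv : pint (fun t => w t * gaussL (nu / t) L x 0%N (s n)) @[n --> \oo] --> pint w.
  apply: (@pint_cvg R (fun n t => w t * gaussL (nu / t) L x 0%N (s n)) w w) => //.
  - by move=> n; apply: pmeas_pitg.
  - move=> t t0.
    have h : gaussL (nu / t) L x 0%N (s n) @[n --> \oo] --> (1 : R).
      rewrite -[X in _ --> X]expR0; apply: cvgn_expR_comp.
      rewrite -[X in _ --> X]oppr0; apply: cvgN.
      rewrite -[X in _ --> X](mulr0 (nu / t)); apply: cvgM; first exact: cvg_cst.
      apply: (@squeeze_cvgr _ _ _ _ (fun=> 0) (fun n => n.+1%:R^-1)); last 2 first.
      + exact: cvg_cst.
      + exact: cvg_harmonic.
      apply: nearW => n; rewrite (ltW (Hs n).2) andbT.
      by apply: sumr_ge0 => c _; exact: sqr_ge0.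
    have := cvgM (cvg_cst (w t)) h; rewrite mulr1; exact.
  - move=> n t t0; rewrite normrM (ger0_norm (w0 t t0)) ger0_norm ?gaussL_ge0//.
    by rewrite ler_piMr ?w0// gaussL_le1// divr_ge0 ?ltW.
have Kd i : K i i = pint w.
  apply: eq_pint => t _; rewrite /gaussL big1 => [|c _]; last by rewrite subrr expr0n.
  by rewrite mulr0 oppr0 expR0 mulr1.
have e2 : 0 < e / 2 by rewrite divr_gt0.
move: cv => /cvgrPdist_lt /(_ _ e2) [n0 _ Hn].
have := Hn n0 (leqnn _) => /= h.
exists (s n0); first exact: (Hs n0).1.
rewrite !Kd; have := ler_norm (pint w - K 0%N (s n0)).
move: h; rewrite -/(mixk nu w x 0%N (s n0)); lra.
Qed.

End strict.

Section ratio.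
Variables (R : realType) (I : finType) (nu : R) (w w' : R -> R) (x : I -> nat -> R) (B : R).
Hypothesis nu0 : 0 < nu.
Hypothesis wg : admissible_weight w.
Hypothesis w'g : admissible_weight w'.
Notation L := (index_enum I).
Notation K := (mixk nu w x).
Notation K' := (mixk nu w' x).

Hypothesis B0 : 0 <= B.
Hypothesis xB : forall c i, `|x c i| <= B.
Hypothesis x_dist : forall i j, i != j -> 0 < \sum_(c <- L) (x c i - x c j) ^+ 2.
Hypothesis x_lim : forall e : R, 0 < e ->
  exists2 j, (0 < j)%N & \sum_(c <- L) (x c 0%N - x c j) ^+ 2 < e.
Hypothesis ratio_w : forall e : R, 0 < e ->
  exists2 dl : R, 0 < dl & forall t, 0 < t -> t < dl -> `|w' t - w t| <= e * w t.

Variable l : nat -> seq (R * nat).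
Hypothesis l_supp : forall n p, p \in l n -> (p.2 <= n)%N.
Hypothesis l_orth : forall n j, (0 < j)%N -> (j <= n)%N -> lin (K j) (l n) = 0.
Hypothesis l_coef : forall n, coef 0 (l n) = -1.

Let wi : pitg w. Proof. by case: wg. Qed.
Let w0 : forall t, 0 < t -> 0 <= w t. Proof. by case: wg. Qed.
Let Kpsd : psd K. Proof. exact: qf_mixk_ge0. Qed.
Let Ksym := mixk_sym nu w x.

Lemma err_gt0 n : 0 < qf K (l n).
Proof. by apply: (mixk_gt0 nu0 wg x_dist (i0 := 0%N)); rewrite l_coef oppr_eq0 oner_eq0. Qed.

(** The optimal error is at most the error of predicting by a single nearby
    observation. *)
Lemma err_cvg0 : qf K (l n) @[n --> \oo] --> (0 : R).
Proof.
apply/cvgrPdist_lt => e e0.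
have [j j0 hj] := mixk_diff_small nu0 wg x_lim e0.
exists j => // n /= jn; rewrite sub0r normrN ger0_norm ?(ltW (err_gt0 n))//.
pose m : seq (R * nat) := [:: (-1, 0%N); (1, j)].
apply: le_lt_trans hj.
have -> : K 0%N 0%N + K j j - 2 * K 0%N j = qf K m.
  rewrite /qf /bil /m !lin_cons !lin_nil /= (Ksym j 0%N).
  move: (K 0%N 0%N) (K j j) (K 0%N j) => a b c; ring.
apply: (error_min Kpsd Ksym l_supp l_orth l_coef).
  by move=> p; rewrite !inE => /orP[] /eqP ->.
rewrite /coef !lin_cons lin_nil /= (gtn_eqF j0). by rewrite mulr0 mulr1 !addr0.
Qed.

Lemma gauss_err_bound (a0 : R) : 0 < a0 -> exists2 C : R, 0 <= C &
  forall a n, 0 < a -> a <= a0 -> qf (gaussL a L x) (l n) / qf K (l n) <= C.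
Proof.
move=> a00; case: (wg) => _ _ wl.
have [C C0 H] := taylor_domination I nu0 wi w0 wl B0 a00.
exists C => // a n a_gt0 aa0; rewrite ler_pdivrMr ?err_gt0//.
have := (H _ x xB a (l n) a_gt0 aa0).2 0%N.
by rewrite big_geq// add0r expr0 invr1 mul1r.
Qed.

(** Fix k0 terms of the Taylor series with tail below e / 2; each of these terms
    is negligible. *)
Lemma gauss_err_cvg (a : R) : 0 < a ->
  (qf (gaussL a L x) (l n) / qf K (l n)) @[n --> \oo] --> (0 : R).
Proof.
move=> a0; case: (wg) => _ _ wl.
have [C C0 H] := taylor_domination I nu0 wi w0 wl B0 a0.
have {}H m := H _ x xB a m a0 (lexx a).
have tk k : (qf (taylor x a k) (l n) / qf K (l n)) @[n --> \oo] --> (0 : R).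
  pose r := Num.sqrt ((2 * a) ^+ k / k`!%:R).
  pose f i := r * expR (- (a * nsq x i)).
  have e m : qf (taylor x a k) m = qf (fun i j => f i * f j * dot x i j ^+ k) m.
    apply: eq_qf => i j; rewrite /taylor /f.
    have r2 : r * r = (2 * a) ^+ k / k`!%:R.
      by rewrite -expr2 sqr_sqrtr// divr_ge0// exprn_ge0// mulr_ge0// ltW.
    by rewrite -r2; ring.
  under eq_cvg do rewrite e.
  apply: (bounded_dot_power_negligible Kpsd Ksym l_supp l_orth l_coef err_gt0 err_cvg0 (C := C)) => m.
  by rewrite -e; exact: (H m).1.
apply/cvgrPdist_lt => e e0.
have [k0 hk] : exists k, 2 ^- k * C < e / 2.
  have C1 : 0 < C + 1 by rewrite ltr_wpDl.
  pose k := Num.bound (`|(C + 1) / (e / 2)|); exists k.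
  have hb : (C + 1) / (e / 2) < k%:R.
    by apply: le_lt_trans (archi_boundP (normr_ge0 _)); exact: ler_norm.
  have hk : k%:R <= 2 ^+ k :> R by rewrite -natrX ler_nat ltnW// ltn_expl.
  have e20 : 0 < e / 2 by rewrite divr_gt0.
  rewrite mulrC ltr_pdivrMr ?exprn_gt0// mulrC -ltr_pdivrMr//.
  apply: lt_le_trans hk; apply: lt_trans hb.
  by rewrite ltr_pM2r ?invr_gt0// ltrDl.
have := @cvg_sum0 R nat (index_iota 0 k0) (fun k n => qf (taylor x a k) (l n) / qf K (l n)) tk.
have e20 : 0 < e / 2 by rewrite divr_gt0.
move=> /cvgrPdist_lt /(_ _ e20); apply: filterS => n; rewrite !sub0r !normrN => hn.
have g0 : 0 <= qf (gaussL a L x) (l n) by apply: psd_gaussL; exact: ltW.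
rewrite ger0_norm ?divr_ge0 ?(ltW (err_gt0 n))//.
have hn' := le_lt_trans (ler_norm _) hn.
rewrite ltr_pdivrMr ?err_gt0//.
apply: le_lt_trans ((H (l n)).2 k0) _.
move: hn'; rewrite -mulr_suml ltr_pdivrMr ?err_gt0// => hn'.
have h2 : 2 ^- k0 * (C * qf K (l n)) < e / 2 * qf K (l n).
  by rewrite mulrA ltr_pM2r ?err_gt0.
have -> : e * qf K (l n) = e / 2 * qf K (l n) + e / 2 * qf K (l n) by field.
exact: ltrD.
Qed.

(** The part u of |w' - w| that exceeds (e / 2) w vanishes for t < dl, hence sees
    only kernels G_(nu/t) with nu / t <= nu / dl; dominated convergence makes its
    contribution o(Q). *)
Theorem error_ratio_cvg : (qf K' (l n) / qf K (l n)) @[n --> \oo] --> (1 : R).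
Proof.
apply/cvgrPdist_lt => e e0; case: w'g => w'i w'0 _.
have e20 : 0 < e / 2 by rewrite divr_gt0.
have [dl dl0 Hd] := ratio_w e20.
pose u t := Num.max (`|w' t - w t| - e / 2 * w t) 0.
have wwi : pitg (fun t => w' t + w t) by exact: pitgD.
have um : pmeas u.
  apply: measurable_maxr; last exact: measurable_cst.
  apply: measurable_funB.
    apply: measurableT_comp; first exact: normr_measurable.
    by apply: measurable_funB; exact: pmeas_pitg.
  by apply: measurable_funM; [exact: measurable_cst|exact: pmeas_pitg].
have u0 t : 0 <= u t by rewrite le_max lexx orbT.
have ule t : 0 < t -> u t <= w' t + w t.
  move=> t0; rewrite ge_max addr_ge0 ?w0 ?w'0// andbT.
  have : `|w' t - w t| <= w' t + w t.
    by rewrite (le_trans (ler_normB _ _))// !ger0_norm ?w0 ?w'0.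
  have : 0 <= e / 2 * w t by rewrite mulr_ge0 ?w0 ?ltW.
  lra.
have ui : pitg u.
  by apply: pitg_le wwi => // t t0; rewrite ger0_norm ?ule.
have ud t : 0 < t -> t < dl -> u t = 0.
  by move=> t0 td; apply/max_idPr; rewrite subr_le0; exact: Hd.
pose g n t := qf (gaussL (nu / t) L x) (l n) / qf K (l n).
have g0 n t : 0 < t -> 0 <= g n t.
  move=> t0; rewrite divr_ge0 ?(ltW (err_gt0 n))//.
  by apply: psd_gaussL; rewrite divr_ge0 ?ltW.
(* u lives on t >= dl, where the kernels have parameter at most nu / dl *)
have [C C0 HC] := gauss_err_bound (divr_gt0 nu0 dl0).
have gm n : pmeas (fun t => qf (gaussL (nu / t) L x) (l n)).
  have [h _] := @qf_pint R nat (fun t => gaussL (nu / t) L x) (gamma_wt 1) (l n)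
    (fun i j => pitg_gamma_wt_gauss nu0 L x i j ltr01).
  have hm := pmeas_pitg h.
  have em : pmeas (@expR R).
    by apply: measurable_funTS; exact: measurable_expR.
  apply: (eq_measurable_fun _ _ (measurable_funM em hm)) => t; rewrite inE => /in0y t0 /=.
  rewrite /gamma_wt subrr powRr0 mul1r mulrA -expRD subrr expR0 mul1r//.
have ug n t : 0 < t -> `|u t * g n t| <= C * u t.
  move=> t0; rewrite ger0_norm ?(mulr_ge0 (u0 t) (g0 n t t0))//.
  have [td|dt] := ltP t dl; first by rewrite ud// mul0r mulr0.
  rewrite mulrC ler_wpM2r//; apply: HC; first by rewrite divr_gt0.
  by rewrite ler_wpM2l ?(ltW nu0)// lef_pV2.
have ugm : forall k, pmeas (fun t => u t * g k t).
  move=> k; apply: (measurable_funM um).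
  by apply: (measurable_funM (gm k)); exact: measurable_cst.
have ugi : forall k, pitg (fun t => u t * g k t).
  move=> k; apply: (pitg_le (ugm k) _ (pitgZ C ui)) => y y0; exact: ug.
have cv : pint (fun t => u t * g n t) @[n --> \oo] --> pint (fun=> 0).
  apply: (@pint_cvg R (fun n t => u t * g n t) (fun=> 0) (fun t => C * u t)) => //.
  - move=> t t0; rewrite -[X in _ --> X](mulr0 (u t)).
    apply: cvgM; first exact: cvg_cst.
    by apply: gauss_err_cvg; rewrite divr_gt0.
  - exact: pitgZ.
rewrite pint0 in cv.
move: cv => /cvgrPdist_lt /(_ _ e20); apply: filterS => n.
rewrite sub0r normrN => hn.
have {hn} hn := le_lt_trans (ler_norm _) hn.
have V0 := err_gt0 n; set V := qf K (l n) in V0 *.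
have [iK eK] := qf_mixk nu0 wi w0 x (l n).
have [iK' eK'] := qf_mixk nu0 w'i w'0 x (l n).
have -> : 1 - qf K' (l n) / V = (V - qf K' (l n)) / V by field; rewrite gt_eqF.
rewrite normrM [`|V^-1|]ger0_norm ?invr_ge0 ?(ltW V0)// ltr_pdivrMr//.
have bound : `|V - qf K' (l n)| <= e / 2 * V + V * pint (fun t => u t * g n t).
  have -> : e / 2 * V + V * pint (fun t => u t * g n t) =
     pint (fun t => e / 2 * (w t * qf (gaussL (nu / t) L x) (l n)) + V * (u t * g n t)).
    by rewrite pintD; [rewrite !pintZ// /V -eK|exact: pitgZ|exact: pitgZ].
  have iR : pitg (fun t => e / 2 * (w t * qf (gaussL (nu / t) L x) (l n)) + V * (u t * g n t)).
    by apply: pitgD; exact: pitgZ.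
  have pw t : 0 < t -> `|w t * qf (gaussL (nu / t) L x) (l n) - w' t * qf (gaussL (nu / t) L x) (l n)|
      <= e / 2 * (w t * qf (gaussL (nu / t) L x) (l n)) + V * (u t * g n t).
    move=> t0; have q0 : 0 <= qf (gaussL (nu / t) L x) (l n).
      by apply: psd_gaussL; rewrite divr_ge0 ?ltW.
    rewrite -mulrBl normrM (ger0_norm q0) /g -/V.
    rewrite [leRHS](_ : _ = (e / 2 * w t + u t) * qf (gaussL (nu / t) L x) (l n)); last first.
      by field; rewrite gt_eqF.
    rewrite ler_wpM2r// distrC -lerBlDl /u le_max lexx//.
  rewrite {1}/V eK eK' -pintB// ler_norml; apply/andP; split.
    rewrite lerNl -[- pint _]mulN1r -pintZ; last exact: pitgB.
    apply: le_pint => //; first by apply: pitgZ; exact: pitgB.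
    by move=> t t0; rewrite mulN1r; apply: le_trans (pw t t0); rewrite -normrN ler_norm.
  apply: le_pint => //; first exact: pitgB.
  by move=> t t0; apply: le_trans (pw t t0); rewrite ler_norm.
apply: le_lt_trans bound _.
have -> : e * V = e / 2 * V + V * (e / 2) by field.
by rewrite ltrD2l ltr_pM2l.
Qed.

End ratio.

(** * The Matern and CH covariances as mixtures of Gaussian kernels *)

Lemma powR_invN (R : realType) (a r : R) : 0 <= a -> a^-1 `^ (- r) = (a `^ (- r))^-1.
Proof. by move=> a0; rewrite -powR_inv1// -powRrM mulN1r [LHS]powRN. Qed.

Section power_weights.
Variable R : realType.
Variable nu : R.
Hypothesis nu0 : 0 < nu.

Lemma power_admissible (g : R -> R) : pitg (fun t => t `^ (nu - 1) * g t) ->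
  (forall t, 0 < t -> 0 < g t) ->
  (forall t u, 0 < t -> t <= u -> g u <= g t) ->
  admissible_weight (fun t => t `^ (nu - 1) * g t).
Proof.
move=> gi g0 gd; split => // [t t0|].
  by rewrite mulr_ge0 ?powR_ge0 ?(ltW (g0 t t0)).
exists nu => q tau nq tau0.
exists (g tau / tau `^ (q - nu)) => [|t t0 tt]; first by rewrite divr_gt0 ?powR_gt0 ?g0.
have -> : t `^ (q - 1) = t `^ (nu - 1) * t `^ (q - nu).
  rewrite -powRD ?(gt_eqF t0) ?implybT//; congr powR; ring.
rewrite mulrCA ler_wpM2l ?powR_ge0// -mulrA; apply: le_trans (gd t tau t0 tt).
rewrite ler_piMr ?(ltW (g0 _ tau0))// mulrC ler_pdivrMr ?powR_gt0// mul1r.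
by apply: ge0_ler_powR; rewrite ?nnegrE ?subr_ge0 ?(ltW t0) ?(ltW tau0).
Qed.

Lemma power_ratio (g g' : R -> R) : {for 0, continuous g} -> {for 0, continuous g'} ->
  0 < g 0 -> g' 0 = g 0 -> forall e : R, 0 < e ->
  exists2 dl : R, 0 < dl & forall t, 0 < t -> t < dl ->
    `|t `^ (nu - 1) * g' t - t `^ (nu - 1) * g t| <= e * (t `^ (nu - 1) * g t).
Proof.
move=> cg cg' g0 eg e e0.
pose r := g 0 / 2 * Num.min 1 (e / 2).
have m0 : 0 < Num.min 1 (e / 2) by rewrite lt_min ltr01 divr_gt0.
have h0 : 0 < g 0 / 2 by rewrite divr_gt0.
have r0 : 0 < r by rewrite mulr_gt0.
have r1 : r <= g 0 / 2 by rewrite /r ler_piMr ?ge_min ?lexx// ltW.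
have r2 : r <= g 0 / 2 * (e / 2) by rewrite /r ler_wpM2l ?ge_min ?lexx ?orbT// ltW.
have /cvgrPdist_lt/(_ _ r0) H := cg.
have /cvgrPdist_lt/(_ _ r0) H' := cg'.
have [dl dl0 Hd] : \forall t \near (0 : R), `|g 0 - g t| < r /\ `|g' 0 - g' t| < r.
  by near=> t; split; near: t.
exists dl => // t t0 td.
have [h h'] : `|g 0 - g t| < r /\ `|g' 0 - g' t| < r.
  by apply: Hd; rewrite /= sub0r normrN ger0_norm ?ltW.
rewrite eg in h'.
rewrite -mulrBr normrM ger0_norm ?powR_ge0// mulrCA ler_wpM2l ?powR_ge0//.
have gt2 : g 0 / 2 <= g t by have := ler_norm (g 0 - g t); lra.
have d : `|g' t - g t| <= r + r.
  rewrite (_ : g' t - g t = (g 0 - g t) - (g 0 - g' t)); last by ring.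
  by apply: le_trans (ler_normB _ _) _; lra.
apply: le_trans d _; apply: le_trans (_ : e * (g 0 / 2) <= _); first by lra.
by rewrite ler_wpM2l// ltW.
Unshelve. all: by end_near.
Qed.

End power_weights.

Section covariances.
Variable R : realType.
Variable nu : R.
Hypothesis nu0 : 0 < nu.

(** The mixing weights of the two covariances without their common factor
    t^(nu-1). *)
Definition matern_density (phi s2 t : R) :=
  s2 * (2 * phi ^+ 2) `^ (- nu) / Gamma nu * expR (- ((2 * phi ^+ 2)^-1 * t)).

Definition CH_density (alpha beta s2 t : R) :=
  s2 * beta `^ (2 * alpha) * Gamma (nu + alpha) / (Gamma nu * Gamma alpha) *
  (t + beta ^+ 2) `^ (- (nu + alpha)).

Section matern.
Variables phi s2 : R.
Hypotheses (phi0 : 0 < phi) (s20 : 0 < s2).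
Let b := (2 * phi ^+ 2)^-1.
Let b0 : 0 < b. Proof. by rewrite invr_gt0 mulr_gt0// exprn_gt0. Qed.
Let k := s2 * (2 * phi ^+ 2) `^ (- nu) / Gamma nu.
Let k0 : 0 < k.
Proof. by rewrite divr_gt0 ?Gamma_gt0// mulr_gt0// powR_gt0// mulr_gt0// exprn_gt0. Qed.

(** [pint_bessel] with b = 1 / (2 phi^2) and d = nu h^2, for which 2 sqrt (b d) is
    the argument sqrt (2 nu) h / phi of the Bessel function; at h = 0 the integral
    is a Gamma integral. *)
Lemma matern_mixture (h : R) : 0 <= h -> matern_cov nu phi s2 h =
  pint (fun t => t `^ (nu - 1) * matern_density phi s2 t * expR (- (nu / t * h ^+ 2))).
Proof.
move=> h0.
have d0 : 0 <= nu * h ^+ 2 by rewrite mulr_ge0 ?sqr_ge0 ?ltW.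
rewrite (eq_pint (g := fun t => k * (t `^ (nu - 1) * expR (- (b * t)) * expR (- (nu * h ^+ 2 / t))))); last first.
  move=> t _; rewrite /matern_density -/k -/b.
  have -> : nu / t * h ^+ 2 = nu * h ^+ 2 / t by ring.
  by ring.
rewrite pintZ; last exact: pitg_gig.
rewrite /matern_cov; have [->|hn0] := eqVneq h 0.
  rewrite (eq_pint (g := fun t => t `^ (nu - 1) * expR (- (b * t)))); last first.
    by move=> t _; rewrite expr0n mulr0 mul0r oppr0 expR0 mulr1.
  have f0 : 0 < 2 * phi ^+ 2 by rewrite mulr_gt0// exprn_gt0.
  rewrite pint_gamma// /k /b powR_invN ?(ltW f0)//; field.
  by rewrite !gt_eqF ?Gamma_gt0 ?powR_gt0.
have hp : 0 < h by rewrite lt_neqAle eq_sym hn0.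
have dp : 0 < nu * h ^+ 2 by rewrite mulr_gt0// exprn_gt0.
rewrite pint_bessel//=.
set y := Num.sqrt (2 * nu) / phi * h.
have y0 : 0 <= y by rewrite mulr_ge0// divr_ge0 ?sqrtr_ge0 ?ltW.
have y2 : y ^+ 2 = 2 * nu * h ^+ 2 / phi ^+ 2.
  rewrite /y !exprMn sqr_sqrtr ?mulr_ge0 ?ltW// exprVn; ring.
have e1 : 2 * Num.sqrt (b * (nu * h ^+ 2)) = y.
  apply/eqP; rewrite -(@eqrXn2 _ 2)// ?mulr_ge0 ?sqrtr_ge0// exprMn sqr_sqrtr ?mulr_ge0 ?(ltW b0) ?(ltW nu0) ?sqr_ge0//.
  by rewrite y2 /b; apply/eqP; field; rewrite gt_eqF.
have e2 : Num.sqrt (nu * h ^+ 2 / b) = phi ^+ 2 * y.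
  apply/eqP; rewrite -(@eqrXn2 _ 2)// ?sqrtr_ge0 ?(mulr_ge0 (sqr_ge0 phi) y0)//.
  rewrite sqr_sqrtr ?divr_ge0 ?(ltW b0) ?(ltW dp)// exprMn y2 /b invrK.
  by apply/eqP; field; rewrite gt_eqF.
rewrite e1 e2 powRM ?sqr_ge0// /k powRN powRM ?sqr_ge0//.
rewrite powRB; last by rewrite pnatr_eq0 implybT.
rewrite powRr1//; field.
by rewrite !gt_eqF ?Gamma_gt0 ?powR_gt0 ?exprn_gt0.
Qed.

Lemma pitg_matern_density : pitg (fun t => t `^ (nu - 1) * matern_density phi s2 t).
Proof.
apply: eq_pitg (pitgZ k (pitg_gamma nu0 b0)) => t _.
by rewrite /matern_density -/k -/b mulrCA.
Qed.

Lemma matern_admissible : admissible_weight (fun t => t `^ (nu - 1) * matern_density phi s2 t).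
Proof.
apply: power_admissible; first exact: pitg_matern_density.
  by move=> t _; rewrite mulr_gt0 ?expR_gt0.
move=> t u _ tu; rewrite /matern_density -/k ler_wpM2l ?(ltW k0)// ler_expR lerN2.
by rewrite ler_wpM2l// ltW.
Qed.

Lemma matern_density_cont : {for 0, continuous (matern_density phi s2)}.
Proof.
apply: cvgM; first exact: cvg_cst.
apply: (@continuous_comp _ _ _ (fun t => - (b * t)) expR); last exact: continuous_expR.
by apply: cvgN; apply: cvgM; [exact: cvg_cst|exact: cvg_id].
Qed.

Lemma matern_density0 : matern_density phi s2 0 = k.
Proof. by rewrite /matern_density mulr0 oppr0 expR0 mulr1. Qed.

End matern.

Section CH.
Variables alpha beta s2 : R.
Hypotheses (alpha0 : 0 < alpha) (beta0 : 0 < beta) (s20 : 0 < s2).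
Let k := s2 * beta `^ (2 * alpha) * Gamma (nu + alpha) / (Gamma nu * Gamma alpha).
Let na0 : 0 < nu + alpha. Proof. exact: addr_gt0. Qed.
Let k0 : 0 < k.
Proof. by rewrite divr_gt0 ?mulr_gt0 ?Gamma_gt0 ?powR_gt0. Qed.
Let b20 : 0 < beta ^+ 2. Proof. exact: exprn_gt0. Qed.
Let tb t : 0 < t -> 0 < t + beta ^+ 2. Proof. by move=> t0; rewrite addr_gt0. Qed.

Lemma CH_density_gt0 t : 0 < t -> 0 < CH_density alpha beta s2 t.
Proof. by move=> t0; rewrite (mulr_gt0 k0)// powR_gt0// tb. Qed.

Lemma CH_density_anti t u : 0 < t -> t <= u -> CH_density alpha beta s2 u <= CH_density alpha beta s2 t.
Proof.
move=> t0 tu; rewrite /CH_density -/k ler_wpM2l ?(ltW k0)// !powRN.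
have u0 := lt_le_trans t0 tu.
rewrite lef_pV2 ?posrE ?powR_gt0 ?tb//.
by apply: ge0_ler_powR; rewrite ?nnegrE ?(ltW na0) ?(ltW (tb t0)) ?(ltW (tb u0)) ?lerD2r.
Qed.

Lemma pitg_CH_density : pitg (fun t => t `^ (nu - 1) * CH_density alpha beta s2 t).
Proof.
set m := Num.min 1 (beta ^+ 2).
have m0 : 0 < m by rewrite lt_min ltr01.
apply: (pitg_le _ _ (pitgZ (k * m `^ (- (nu + alpha))) (pitg_beta nu0 alpha0))).
  apply: cpos_meas; apply: cposM; first exact: cpos_powR.
  apply: cposM; first exact: cst_cpos.
  apply: (cpos_comp (f := fun t => t + beta ^+ 2) (g := fun t => t `^ (- (nu + alpha)))) => //.
    by apply: cposD; [exact: cpos_id|exact: cst_cpos].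
  exact: cpos_powR.
move=> t t0; rewrite ger0_norm; last exact: (mulr_ge0 (powR_ge0 _ _) (ltW (CH_density_gt0 t0))).
rewrite /CH_density -/k mulrCA -[leRHS]mulrA ler_wpM2l ?(ltW k0)// mulrCA ler_wpM2l ?powR_ge0//.
have t1 : 0 < 1 + t by rewrite addr_gt0.
rewrite -powRM ?(ltW m0) ?(ltW t1)// !powRN lef_pV2 ?posrE ?powR_gt0 ?mulr_gt0 ?tb//.
have mt : m * (1 + t) <= t + beta ^+ 2.
  have h1 : m <= beta ^+ 2 by rewrite ge_min lexx orbT.
  have h2 : m * t <= t by rewrite ler_piMl ?(ltW t0)// ge_min lexx.
  by lra.
by apply: ge0_ler_powR; rewrite ?nnegrE ?(ltW na0) ?(ltW (tb t0)) ?mulr_ge0 ?(ltW m0) ?(ltW t1).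
Qed.

Lemma CH_mixture (h : R) : CH_cov nu alpha beta s2 h =
  pint (fun t => t `^ (nu - 1) * CH_density alpha beta s2 t * expR (- (nu / t * h ^+ 2))).
Proof.
rewrite /CH_cov -/k -/(pint _) -pintZ.
  by apply: eq_pint => t _; rewrite /CH_density -/k (mulrAC nu t^-1); ring.
have := pitgZ k^-1 pitg_CH_density; apply: pitg_le => [|t t0].
  apply: cpos_meas; apply: cposM.
    apply: cposM; first exact: cpos_powR.
    apply: (cpos_comp (f := fun t => t + beta ^+ 2) (g := fun t => t `^ (- (nu + alpha)))) => //.
      by apply: cposD; [exact: cpos_id|exact: cst_cpos].
    exact: cpos_powR.
  by apply: cpos_expR; apply: cposN; exact: cpos_div.
rewrite ger0_norm ?mulr_ge0 ?powR_ge0 ?expR_ge0// /CH_density -/k.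
rewrite [leRHS](_ : _ = t `^ (nu - 1) * (t + beta ^+ 2) `^ (- (nu + alpha))); last first.
  by field; rewrite gt_eqF.
rewrite ler_piMr ?mulr_ge0 ?powR_ge0// expR_le1 oppr_le0 divr_ge0 ?(ltW t0)//.
by rewrite mulr_ge0 ?sqr_ge0 ?ltW.
Qed.

Lemma CH_admissible : admissible_weight (fun t => t `^ (nu - 1) * CH_density alpha beta s2 t).
Proof.
apply: power_admissible; first exact: pitg_CH_density.
  exact: CH_density_gt0.
exact: CH_density_anti.
Qed.

Lemma CH_density_cont : {for 0, continuous (CH_density alpha beta s2)}.
Proof.
apply: cvgM; first exact: cvg_cst.
apply: (@continuous_comp _ _ _ (fun t => t + beta ^+ 2) (fun t => t `^ (- (nu + alpha)))).
  by apply: cvgD; [exact: cvg_id|exact: cvg_cst].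
by apply: cpos_powR; rewrite add0r.
Qed.

Lemma CH_density0 : CH_density alpha beta s2 0 =
  s2 * beta `^ (- (2 * nu)) * Gamma (nu + alpha) / (Gamma nu * Gamma alpha).
Proof.
rewrite /CH_density add0r -powR_mulrn ?ltW// -powRrM.
have e : beta `^ (- (2 * nu)) = beta `^ (2 * alpha) * beta `^ (2%:R * - (nu + alpha)).
  rewrite -powRD ?(gt_eqF beta0) ?implybT//; congr powR; ring.
by rewrite e; ring.
Qed.

End CH.

(** The condition on the parameters is the equality of the mixing weights at 0. *)
Lemma density_eq0 (phi alpha beta s0 s1 : R) : 0 < phi -> 0 < alpha -> 0 < beta ->
  s1 * (beta ^+ 2 / 2) `^ (- nu) * Gamma (nu + alpha) / Gamma alpha = s0 * phi `^ (- (2 * nu)) ->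
  CH_density alpha beta s1 0 = matern_density phi s0 0.
Proof.
move=> phi0 alpha0 beta0 hpar; rewrite CH_density0// matern_density0.
have -> : (2 * phi ^+ 2) `^ (- nu) = 2 `^ (- nu) * phi `^ (- (2 * nu)).
  by rewrite powRM ?sqr_ge0// -powR_mulrn ?ltW// -powRrM mulrN.
rewrite [s0 * _]mulrCA -hpar powRM ?sqr_ge0// -[beta ^+ 2]powR_mulrn ?ltW// -powRrM mulrN.
have -> : 2^-1 `^ (- nu) = (2 `^ (- nu))^-1 :> R.
  by rewrite powR_invN.
by field; rewrite !gt_eqF ?Gamma_gt0 ?powR_gt0.
Qed.

End covariances.

(** * Variance of linear combinations *)

Section variance.
Context (R : realType) (disp : measure_display) (T : measurableType disp).
Variable P : probability T R.

Lemma Lfun2_second_moment (f : {mfun T >-> R}) : ('E_P[f * f] < +oo)%E -> (f : T -> R) \in Lfun P 2%:E.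
Proof.
move=> h; rewrite inE; apply/andP; split; rewrite inE/=; first exact: measurable_funPT.
rewrite /finite_norm unlock; apply: poweR_lty.
move: h; rewrite unlock; congr (_ < _)%E; apply: eq_integral => w _.
by rewrite /= powR_mulrn// real_normK ?num_real.
Qed.

(** The covariance of a centred variable with itself is its second moment, so its
    being a real number already gives square integrability. *)
Lemma Lfun2_centered (f : {mfun T >-> R}) (v : R) : ('E_P[f] = 0)%E -> covariance P f f = v%:E ->
  (f : T -> R) \in Lfun P 2%:E.
Proof.
move=> e0 c; apply: Lfun2_second_moment.
have -> : ('E_P[f * f] = covariance P f f)%E.
  by rewrite covariance.unlock e0 /=; congr expectation; congr (_ * _); apply/funext => w; rewrite /= subr0.
by rewrite c ltry.
Qed.

Variables (X : Type) (Y : X -> T -> R) (k : X -> X -> R).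
Hypothesis Y2 : forall i, Y i \in Lfun P 2%:E.
Hypothesis Yk : forall i j, covariance P (Y i) (Y j) = (k i j)%:E.

Let comb (l : seq (R * X)) : T -> R := fun w => lin (Y ^~ w) l.

Let comb_cons p l : comb (p :: l) = ((p.1 \o* Y p.2) \+ comb l)%R.
Proof. by apply/funext => w; rewrite /comb lin_cons /= mulrC. Qed.

Let comb_nil : comb [::] = cst 0.
Proof. by apply/funext => w; rewrite /comb lin_nil. Qed.

Let Pfin : P [set: T] \is a fin_num. Proof. exact: fin_num_measure. Qed.

Let comb2 l : comb l \in Lfun P 2%:E.
Proof.
elim: l => [|p l IH]; first by rewrite comb_nil Lfun_cst.
have h : p.1 \o* Y p.2 \in Lfun P 2%:E by apply: Lfun_scale; rewrite ?ler1n.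
by rewrite comb_cons; apply: rpredD => //; rewrite lee_fin ler1n.
Qed.

Let cov_combl (g : X -> R) (W : T -> R) l : W \in Lfun P 2%:E ->
  (forall i, covariance P (Y i) W = (g i)%:E) -> covariance P (comb l) W = (lin g l)%:E.
Proof.
move=> W2 Wg; elim: l => [|p l IH]; first by rewrite comb_nil covariance_cst_l lin_nil.
rewrite comb_cons covarianceDl//; last by apply: Lfun_scale => //; rewrite ler1n.
by rewrite IH lin_cons EFinD EFinM covarianceZl ?Wg// ?Lfun2_mul_Lfun1// Lfun_subset12.
Qed.

Lemma variance_lin l : ('V_P[fun w => lin (Y ^~ w) l] = (qf k l)%:E)%E.
Proof.
rewrite /variance -/(comb l).
apply: (@cov_combl (fun i => lin (k i) l)) => // i.
rewrite covarianceC; apply: (@cov_combl (k i)) => // j.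
by rewrite covarianceC Yk.
Qed.

End variance.

(** * The kriging error as a measure on the sites *)

Section kriging_form.
Variables (R : realType) (d : nat) (K : R -> R) (s : nat -> 'rV[R]_d) (s0 : 'rV[R]_d).

(** The target is the point 0 and the observations are the points 1, 2, ... *)
Definition site (i : nat) : 'rV[R]_d := if i is j.+1 then s j else s0.

Definition site_cov (i j : nat) : R := K (enorm (site i - site j)).

Definition obs_form n (v : 'rV[R]_n) : seq (R * nat) :=
  [seq (v 0 i, i.+1) | i : 'I_n <- index_enum 'I_n].

Definition obs_cov n : 'M[R]_n := \matrix_(i, j) K (enorm (s i - s j)).

Definition krig_weights n : 'rV[R]_n :=
  (\col_i K (enorm (s0 - s (i : 'I_n))))^T *m invmx (obs_cov n).

Definition error_form n : seq (R * nat) := (-1, 0%N) :: obs_form (krig_weights n).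

Lemma enormC (u v : 'rV[R]_d) : enorm (u - v) = enorm (v - u).
Proof.
by rewrite /enorm; congr Num.sqrt; apply: eq_bigr => i _; rewrite !mxE -sqrrN opprB.
Qed.

Lemma site_covC i j : site_cov i j = site_cov j i.
Proof. by rewrite /site_cov enormC. Qed.

Lemma lin_obs_form n (v : 'rV[R]_n) f : lin f (obs_form v) = \sum_(i < n) v 0 i * f i.+1.
Proof. by rewrite /lin /obs_form big_map. Qed.

Lemma coef_obs_form n (v : 'rV[R]_n) (i : 'I_n) : coef i.+1 (obs_form v) = v 0 i.
Proof.
rewrite /coef lin_obs_form (bigD1 i)//= eqxx mulr1 big1 ?addr0// => j ji.
by rewrite eqSS val_eqE (negbTE ji) mulr0.
Qed.

Lemma qf_obs_form n (v : 'rV[R]_n) :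
  qf site_cov (obs_form v) = (v *m obs_cov n *m v^T) 0 0.
Proof.
rewrite /qf /bil lin_obs_form [RHS]mxE.
have -> : \sum_(j < n) (v *m obs_cov n) 0 j * v^T j 0 =
    \sum_(j < n) \sum_(i < n) v 0 i * obs_cov n i j * v 0 j.
  by apply: eq_bigr => j _; rewrite !mxE mulr_suml.
rewrite exchange_big/=; apply: eq_bigr => i _.
rewrite lin_obs_form mulr_sumr; apply: eq_bigr => j _.
by rewrite mxE -mulrA; congr (_ * _); rewrite mulrC.
Qed.

Lemma error_form_supp n p : p \in error_form n -> (p.2 <= n)%N.
Proof. by rewrite inE => /orP[/eqP -> //|/mapP[i _ ->]] /=. Qed.

Lemma error_form_coef n : coef 0 (error_form n) = -1.
Proof.
rewrite /coef lin_cons lin_obs_form big1 ?addr0 ?mulr1// => i _.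
by rewrite /= mulr0.
Qed.

Lemma kriging_errorE (disp : measure_display) (T : measurableType disp)
    (Z : 'rV[R]_d -> {mfun T >-> R}) n w :
  kriging_error K Z s s0 n w = lin (fun i => Z (site i) w) (error_form n).
Proof.
rewrite /kriging_error /kriging lin_cons lin_obs_form mulN1r addrC; congr (_ + _).
by rewrite mxE; apply: eq_bigr => i _; rewrite !mxE.
Qed.

Hypothesis cov_gt0 : forall m i, coef i m != 0 -> 0 < qf site_cov m.

(** A vector in the kernel gives a measure on the observation points at which the
    form vanishes; strict positivity makes its coefficients zero. *)
Lemma obs_cov_unit n : obs_cov n \in unitmx.
Proof.
rewrite -row_free_unit -kermx_eq0; apply/rowV0P => v /sub_kermxP vK.
apply/rowP => i; rewrite mxE; apply/eqP; apply: contraT => vi.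
have := cov_gt0 (m := obs_form v) (i := i.+1).
by rewrite coef_obs_form qf_obs_form vK mul0mx mxE ltxx => /(_ vi).
Qed.

Lemma error_form_orth n j : (0 < j)%N -> (j <= n)%N -> lin (site_cov j) (error_form n) = 0.
Proof.
case: j => // j _ jn; rewrite lin_cons lin_obs_form mulN1r.
have : (krig_weights n *m obs_cov n) 0 (Ordinal jn) = site_cov 0 j.+1.
  by rewrite /krig_weights mulmxKV ?obs_cov_unit// !mxE.
rewrite mxE site_covC => <-; apply/eqP; rewrite addrC subr_eq0; apply/eqP.
apply: eq_bigr => i _; congr (_ * _). by rewrite [RHS]mxE site_covC.
Qed.

End kriging_form.

(** * Asymptotic optimality *)

Section asymptotic_equivalence.
Variables (R : realType) (I : finType) (nu : R) (w w' : R -> R) (x : I -> nat -> R) (B : R).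
Hypothesis nu0 : 0 < nu.
Hypotheses (wg : admissible_weight w) (w'g : admissible_weight w').
Notation L := (index_enum I).
Notation K := (mixk nu w x).
Notation K' := (mixk nu w' x).

Hypothesis B0 : 0 <= B.
Hypothesis xB : forall c i, `|x c i| <= B.
Hypothesis x_dist : forall i j, i != j -> 0 < \sum_(c <- L) (x c i - x c j) ^+ 2.
Hypothesis x_lim : forall e : R, 0 < e ->
  exists2 j, (0 < j)%N & \sum_(c <- L) (x c 0%N - x c j) ^+ 2 < e.
Hypothesis ratio_w : forall e : R, 0 < e ->
  exists2 dl : R, 0 < dl & forall t, 0 < t -> t < dl -> `|w' t - w t| <= e * w t.
Hypothesis ratio_w' : forall e : R, 0 < e ->
  exists2 dl : R, 0 < dl & forall t, 0 < t -> t < dl -> `|w t - w' t| <= e * w' t.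

Variables l l' : nat -> seq (R * nat).
Hypothesis l_supp : forall n p, p \in l n -> (p.2 <= n)%N.
Hypothesis l_orth : forall n j, (0 < j)%N -> (j <= n)%N -> lin (K j) (l n) = 0.
Hypothesis l_coef : forall n, coef 0 (l n) = -1.
Hypothesis l'_supp : forall n p, p \in l' n -> (p.2 <= n)%N.
Hypothesis l'_orth : forall n j, (0 < j)%N -> (j <= n)%N -> lin (K' j) (l' n) = 0.
Hypothesis l'_coef : forall n, coef 0 (l' n) = -1.

(** Q'(l'_n) <= Q'(l_n) and Q(l_n) <= Q(l'_n) squeeze Q'(l'_n) / Q(l_n) between
    Q'(l'_n) / Q(l'_n) and Q'(l_n) / Q(l_n), which tend to 1. *)
Lemma optimal_error_ratio_cvg : (qf K' (l' n) / qf K (l n)) @[n --> \oo] --> (1 : R).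
Proof.
have up := error_ratio_cvg nu0 wg w'g B0 xB x_dist x_lim ratio_w l_supp l_orth l_coef.
have lo := error_ratio_cvg nu0 w'g wg B0 xB x_dist x_lim ratio_w' l'_supp l'_orth l'_coef.
have p n : 0 < qf K (l n) := err_gt0 nu0 wg x_dist l_coef n.
have p' n : 0 < qf K' (l' n) := err_gt0 nu0 w'g x_dist l'_coef n.
have {}lo : ((qf K (l' n) / qf K' (l' n))^-1) @[n --> \oo] --> (1 : R).
  by rewrite -[X in _ --> X]invr1; apply: cvgV => //; exact: oner_neq0.
have [[wi w0 _] [w'i w'0 _]] := (wg, w'g).
have h n : qf K (l n) <= qf K (l' n).
  apply: (error_min (qf_mixk_ge0 nu0 wi w0 x) (mixk_sym nu w x) l_supp l_orth l_coef) => //.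
  exact: l'_supp.
have h' n : qf K' (l' n) <= qf K' (l n).
  apply: (error_min (qf_mixk_ge0 nu0 w'i w'0 x) (mixk_sym nu w' x) l'_supp l'_orth l'_coef) => //.
  exact: l_supp.
apply: squeeze_cvgr lo up; apply: nearW => n.
have q : 0 < qf K (l' n) := lt_le_trans (p n) (h n).
rewrite invfM invrK mulrC; apply/andP; split.
  by rewrite ler_pM2l ?p'// lef_pV2 ?posrE ?p.
by rewrite ler_pM2r ?invr_gt0 ?p.
Qed.

End asymptotic_equivalence.

Section sites.
Variables (R : realType) (d : nat) (s : nat -> 'rV[R]_d) (s0 : 'rV[R]_d).

Definition site_coord (c : 'I_d) (i : nat) : R := site s s0 i 0 c.

Lemma enorm_sqr (u v : 'rV[R]_d) : enorm (u - v) ^+ 2 = \sum_c (u 0 c - v 0 c) ^+ 2.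
Proof.
rewrite /enorm sqr_sqrtr; last by apply: sumr_ge0 => c _; exact: sqr_ge0.
by apply: eq_bigr => c _; rewrite !mxE.
Qed.

Lemma site_cov_mixk (K : R -> R) (nu : R) (w : R -> R) :
  (forall h, 0 <= h -> K h = pint (fun t => w t * expR (- (nu / t * h ^+ 2)))) ->
  site_cov K s s0 = mixk nu w site_coord.
Proof.
move=> hK; apply/funext => i; apply/funext => j.
rewrite /site_cov hK ?sqrtr_ge0//; apply: eq_pint => t _.
by rewrite enorm_sqr.
Qed.

Hypotheses (s_inj : injective s) (s0_new : forall n, s n <> s0).

Lemma site_coord_dist i j : i != j -> 0 < \sum_c (site_coord c i - site_coord c j) ^+ 2.
Proof.
move=> ij; have ge0 c : 0 <= (site_coord c i - site_coord c j) ^+ 2 by exact: sqr_ge0.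
rewrite lt_neqAle sumr_ge0// andbT eq_sym psumr_eq0//; apply/negP => /allP h.
have : site s s0 i = site s s0 j.
  apply/rowP => c; apply/eqP; rewrite -subr_eq0 -sqrf_eq0.
  by apply: h; exact: mem_index_enum.
case: i j ij {ge0 h} => [|i] [|j] //= ij.
- by move=> e; case: (@s0_new j).
- by move=> e; case: (@s0_new i).
by move=> /s_inj e; rewrite e eqxx in ij.
Qed.

Lemma coord_le_norm (u : 'rV[R]_d) c : `|u 0 c| <= `|u|.
Proof.
rewrite -[leRHS]/(mx_norm u) mx_normrE.
exact: (le_bigmax _ (fun i : 'I_1 * 'I_d => `|u i.1 i.2|) (0, c)).
Qed.

Lemma site_coord_lim (e : R) : limit_point (range s) s0 -> 0 < e ->
  exists2 j, (0 < j)%N & \sum_c (site_coord c 0%N - site_coord c j) ^+ 2 < e.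
Proof.
move=> lim e0; pose r := Num.min 1 (e / d.+1%:R).
have r0 : 0 < r by rewrite lt_min ltr01 divr_gt0.
have [y [_ [k _ <-] yr]] := lim _ (nbhsx_ballx s0 r r0).
exists k.+1 => //; apply: (@le_lt_trans _ _ (\sum_(c < d) e / d.+1%:R)).
  apply: ler_sum => c _; apply: (@le_trans _ _ (r * r)).
    have : `|s0 0 c - s k 0 c| <= r.
      have := coord_le_norm (s0 - s k) c; rewrite !mxE => /le_trans; apply.
      by apply: ltW; move: yr; rewrite -ball_normE.
    move=> h; rewrite -real_normK ?num_real// expr2.
    by apply: ler_pM.
  apply: (@le_trans _ _ r); last by rewrite ge_min lexx orbT.
  by rewrite ler_piMr ?(ltW r0)// ge_min lexx.
rewrite sumr_const card_ord -[X in X < _]mulr_natr mulrAC ltr_pdivrMr// ltr_pM2l// ltr_nat//.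
Qed.

End sites.

Lemma kriging_variance (R : realType) (d : nat) (D : set 'rV[R]_d)
    (disp : measure_display) (T : measurableType disp) (P : probability T R)
    (Z : 'rV[R]_d -> {mfun T >-> R}) (K : R -> R)
    (s : nat -> 'rV[R]_d) (s0 : 'rV[R]_d) (n : nat) :
  gaussian_measure D P Z K -> (forall k, D (s k)) -> D s0 ->
  fine ('V_P[kriging_error K Z s s0 n])%E = qf (site_cov K s s0) (error_form K s s0 n).
Proof.
move=> [_ Z0 ZK] sD s0D.
have Dsite i : D (site s s0 i) by case: i.
have Z2 i : (Z (site s s0 i) : T -> R) \in Lfun P 2%:E.
  by apply: Lfun2_centered (Z0 _ _) (ZK _ _ _ _).
rewrite (_ : kriging_error _ _ _ _ _ =
  fun w => lin (fun i => Z (site s s0 i) w) (error_form K s s0 n)); last first.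
  by apply/funext => w; exact: kriging_errorE.
rewrite (@variance_lin _ _ _ _ _ (fun i => Z (site s s0 i) : T -> R) (site_cov K s s0))//.
by move=> i j; rewrite ZK.
Qed.

Theorem theorem7 (R : realType) (d : nat) (hd : (1 <= d <= 3)%N)
    (D : set 'rV[R]_d) (hD : bounded_set D)
    (nu phi sigma0sq sigma1sq : R)
    (hnu : 0 < nu) (hphi : 0 < phi)
    (hsigma0 : 0 < sigma0sq) (hsigma1 : 0 < sigma1sq)
    (s : nat -> 'rV[R]_d) (hsD : forall n, D (s n)) (hs_inj : injective s)
    (s0 : 'rV[R]_d) (hs0D : D s0) (hs0 : forall n, s n <> s0)
    (hs0lim : limit_point (range s) s0)
    (alpha beta : R) (halpha : 0 < alpha) (hbeta : 0 < beta)
    (disp : measure_display) (T : measurableType disp)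
    (Z : 'rV[R]_d -> {mfun T >-> R})
    (P0 P1 : probability T R)
    (hP0 : gaussian_measure D P0 Z (matern_cov nu phi sigma0sq))
    (hP1 : gaussian_measure D P1 Z (CH_cov nu alpha beta sigma1sq))
    (hpar : sigma1sq * (beta ^+ 2 / 2) `^ (- nu) * Gamma (nu + alpha)
              / Gamma alpha
            = sigma0sq * phi `^ (- (2 * nu))) :
  fine ('V_P1[kriging_error (CH_cov nu alpha beta sigma1sq) Z s s0 n])%E
    / fine ('V_P0[kriging_error (matern_cov nu phi sigma0sq) Z s s0 n])%E
    @[n --> \oo] --> (1 : R).
Proof.
set K0 := matern_cov _ _ _; set K1 := CH_cov _ _ _ _.
under eq_cvg do rewrite (kriging_variance _ hP1)// (kriging_variance _ hP0)//.
pose x := site_coord s s0.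
pose w0 t := t `^ (nu - 1) * matern_density nu phi sigma0sq t.
pose w1 t := t `^ (nu - 1) * CH_density nu alpha beta sigma1sq t.
have a0 : admissible_weight w0 := matern_admissible hnu hphi hsigma0.
have a1 : admissible_weight w1 := CH_admissible hnu halpha hbeta hsigma1.
have e0 : site_cov K0 s s0 = mixk nu w0 x.
  by apply: site_cov_mixk => h h0; exact: matern_mixture.
have e1 : site_cov K1 s s0 = mixk nu w1 x.
  by apply: site_cov_mixk => h _; exact: CH_mixture.
have dist := site_coord_dist hs_inj hs0.
have pd0 m i : coef i m != 0 -> 0 < qf (site_cov K0 s s0) m.
  by rewrite e0; exact: mixk_gt0.
have pd1 m i : coef i m != 0 -> 0 < qf (site_cov K1 s s0) m.
  by rewrite e1; exact: mixk_gt0.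
have [B B0 xB] : exists2 B : R, 0 <= B & forall c i, `|x c i| <= B.
  have [M [_ hM]] := hD; pose B := Num.max 0 (M + 1); exists B; first by rewrite le_max lexx.
  move=> c i; apply: le_trans (coord_le_norm _ _) _; apply: hM.
    by rewrite lt_max ltrDl ltr01 orbT.
  by case: i.
have d0 : CH_density nu alpha beta sigma1sq 0 = matern_density nu phi sigma0sq 0.
  exact: density_eq0.
have c0 : {for 0, continuous (matern_density nu phi sigma0sq)} by exact: matern_density_cont.
have c1 : {for 0, continuous (CH_density nu alpha beta sigma1sq)} by exact: CH_density_cont.
have g0 : 0 < matern_density nu phi sigma0sq 0.
  by rewrite mulr_gt0 ?expR_gt0// divr_gt0 ?Gamma_gt0// mulr_gt0// powR_gt0// mulr_gt0// exprn_gt0.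
have g1 := g0; rewrite -d0 in g1.
rewrite e0 e1; apply: (optimal_error_ratio_cvg hnu a0 a1 B0 xB dist) => //.
- by move=> e; exact: site_coord_lim.
- exact: power_ratio.
- exact: power_ratio.
- by move=> n p; exact: error_form_supp.
- by move=> n j; rewrite -e0; exact: error_form_orth.
- by move=> n; exact: error_form_coef.
- by move=> n p; exact: error_form_supp.
- by move=> n j; rewrite -e1; exact: error_form_orth.
- by move=> n; exact: error_form_coef.
Qed.
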